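(* Let $d\ge 3$, let $V\in L_{1,loc}(\mathbf{R}^d)$ with $V\ge 0$, and let $\mathcal{G}\subset\mathbf{R}^d$ be a domain as in the context. Suppose that for some $r_0>0$ there is a function $\hat\gamma$ on $(0,r_0)$ with $$\forall\, r\in(0,r_0):\ \hat\gamma(r)\in(0,1),\qquad \limsup_{r\downarrow 0}\, r^{-2(d-2)/d}\,\hat\gamma(r)=\infty,$$ such that for every $r\in(0,r_0)$, with $\hat\delta(r)=\hat\gamma(r)\,\mathrm{mes}_d(\mathcal{G}_r(0))$, $$\lim_{|\mathbf{y}|\to\infty}\bar V^\star(\hat\delta(r),\mathbf{y},r)=\infty .$$ Then the spectrum of the operator $H=-\Delta+V(\mathbf{x})$ is discrete.
   Context: $H=-\Delta+V$ is the Schrödinger operator in $L_2(\mathbf{R}^d)$, understood as usual as the self-adjoint operator associated with the closed quadratic form $\int(|\nabla u|^2+V|u|^2)\,\mathrm{d}\mathbf{x}$. Its spectrum is discrete if it consists only of isolated eigenvalues of finite multiplicity. $\mathcal{G}\subset\mathbf{R}^d$ is a fixed open domain such that (a) $\mathcal{G}$ is bounded and star-shaped with respect to every point of some open ball $B_\rho(0)$, $\rho>0$, contained in $\mathcal{G}$; (b) $\mathrm{diam}(\mathcal{G})=2$. For $r>0$ and $\mathbf{y}\in\mathbf{R}^d$, $\mathcal{G}_r(\mathbf{y})=\{\mathbf{x}\in\mathbf{R}^d: r^{-1}\mathbf{x}\in\mathcal{G}\}+\mathbf{y}$, with closure $\bar{\mathcal{G}}_r(\mathbf{y})$. $\mathrm{mes}_d$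 is Lebesgue measure on $\mathbf{R}^d$. The non-increasing rearrangement of $V$ on $\bar{\mathcal{G}}_r(\mathbf{y})$ is, for $t>0$, $$\bar V^\star(t,\mathbf{y},r)=\sup\{s>0:\ \mathrm{mes}_d(\{\mathbf{x}\in\bar{\mathcal{G}}_r(\mathbf{y}): V(\mathbf{x})\ge s\})\ge t\}\quad(\sup\emptyset=0).$$ *)

(* Defs.v *)
From HB Require Import structures.
From mathcomp Require Import all_boot all_order all_algebra.
From mathcomp Require Import all_classical all_reals all_analysis.
From mathcomp Require Import complex.

Set Implicit Arguments.
Unset Strict Implicit.
Unset Printing Implicit Defensive.

Import Order.TTheory GRing.Theory Num.Theory.
Import numFieldNormedType.Exports.

Local Open Scope classical_set_scope.
Local Open Scope ring_scope.

Section rV_measurable.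
Context {d} {T : measurableType d} (n : nat).

Let coord (i : 'I_n) (x : 'rV[T]_n) : T := x ord0 i.

Let rV_set0 : g_sigma_preimage coord set0.
Proof. exact: sigma_algebra0. Qed.

Let rV_setC A : g_sigma_preimage coord A -> g_sigma_preimage coord (~` A).
Proof. exact: sigma_algebraC. Qed.

Let rV_bigcup (F : _^nat) : (forall i, g_sigma_preimage coord (F i)) ->
  g_sigma_preimage coord (\bigcup_i (F i)).
Proof. exact: sigma_algebra_bigcup. Qed.

(* The product sigma-algebra, exactly as for n.-tuple T in the library; on
   'rV[R]_n it is the Borel sigma-algebra. *)
HB.instance Definition _ := @isMeasurable.Build (measure_tuple_display d)
  'rV[T]_n (g_sigma_preimage coord) rV_set0 rV_setC rV_bigcup.

End rV_measurable.


Section mes_succ.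
Context {R : realType} (n : nat).

Definition rV_cons (p : measurableTypeR R * 'rV[R]_n) : 'rV[R]_n.+1 :=
  \row_i oapp (p.2 ord0) p.1 (unlift ord0 i).

Lemma measurable_coord m (i : 'I_m) :
  measurable_fun [set: 'rV[R]_m] (fun x : 'rV[R]_m => x ord0 i).
Proof.
move=> _ Y mY; rewrite setTI; apply: sub_sigma_algebra => /=.
rewrite -bigcup_seq/=; exists i => /=; first by rewrite mem_index_enum.
by exists Y => //; rewrite setTI.
Qed.

Lemma measurable_rV d (T : measurableType d) m (f : T -> 'rV[R]_m) :
  (forall i, measurable_fun [set: T] (fun x => f x ord0 i : R)) ->
  measurable_fun [set: T] f.
Proof.
move=> mf _ A mA; rewrite setTI.
have : g_sigma_preimage (fun i x => f x ord0 i) `<=` @measurable _ T.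
  apply: smallest_sub; first exact: sigma_algebra_measurable.
  rewrite -bigcup_seq; apply: bigcup_sub => i _.
  by move=> B [C mC <-]; exact: mf.
apply.
rewrite (g_sigma_preimage_comp (fun i (x : 'rV[R]_m) => x ord0 i) f).
by exists A => //; rewrite setTI.
Qed.

Lemma measurable_rV_cons : measurable_fun [set: _] rV_cons.
Proof.
apply: measurable_rV => i.
rewrite (_ : (fun _ => _) = fun p : measurableTypeR R * 'rV[R]_n =>
  oapp (p.2 ord0) p.1 (unlift ord0 i)); last by apply/funext => p; rewrite mxE.
case: (unlift ord0 i) => [j|] //=; last exact: measurable_fst.
exact: (measurableT_comp (measurable_coord j) measurable_snd).
Qed.

Variable mu : {sigma_finite_measure set 'rV[R]_n -> \bar R}.

Definition mes_succ : set 'rV[R]_n.+1 -> \bar R :=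
  pushforward (lebesgue_measure \x mu)%E rV_cons.

Let mes_succ0 : mes_succ set0 = 0%E.
Proof. by rewrite /mes_succ /pushforward preimage_set0 measure0. Qed.

Let mes_succ_ge0 A : (0 <= mes_succ A)%E.
Proof. by apply: integral_ge0 => x _; exact: measure_ge0. Qed.

Let mes_succ_sigma_additive : semi_sigma_additive mes_succ.
Proof. by apply: measure_semi_sigma_additive; exact: measurable_rV_cons. Qed.

HB.instance Definition _ := isMeasure.Build _ _ _
  mes_succ mes_succ0 mes_succ_ge0 mes_succ_sigma_additive.

Lemma measurable_rV_head_behead :
  measurable_fun [set: 'rV[R]_n.+1]
    (fun x : 'rV[R]_n.+1 => (x ord0 ord0 : measurableTypeR R,
      (\row_j x ord0 (lift ord0 j) : 'rV[R]_n))).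
Proof.
apply/measurable_fun_pairP; split; first exact: measurable_coord.
apply: measurable_rV => i.
rewrite (_ : (fun _ => _) = fun x : 'rV[R]_n.+1 => x ord0 (lift ord0 i)).
  exact: measurable_coord.
by apply/funext => x; rewrite /= mxE.
Qed.

Let mes_succ_sigma_finite : sigma_finite [set: 'rV[R]_n.+1] mes_succ.
Proof.
have /sigma_finiteP[F [FT ndF Foo]] := sigma_finiteT (@lebesgue_measure R).
have /sigma_finiteP[G [GT ndG Goo]] := sigma_finiteT mu.
pose u (x : 'rV[R]_n.+1) := (x ord0 ord0 : measurableTypeR R,
      (\row_j x ord0 (lift ord0 j) : 'rV[R]_n)).
have uK p : u (rV_cons p) = p.
  case: p => a v; rewrite /u /rV_cons !mxE unlift_none /=; congr pair.
  by apply/rowP => j; rewrite !mxE liftK.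
exists (fun k => u @^-1` (F k `*` G k)).
  apply/seteqP; split=> // x _.
  have [i _ Fi] : (\bigcup_i F i) (u x).1 by rewrite -FT.
  have [j _ Gj] : (\bigcup_i G i) (u x).2 by rewrite -GT.
  exists (maxn i j) => //; split.
    by move: Fi; exact/subsetPset/ndF/leq_maxl.
  by move: Gj; exact/subsetPset/ndG/leq_maxr.
move=> k; have [mF Fk] := Foo k; have [mG Gk] := Goo k; split.
  rewrite -[X in measurable X]setTI; apply: measurable_rV_head_behead => //.
  exact: measurableX.
rewrite /mes_succ /pushforward -comp_preimage.
rewrite (_ : u \o _ = id); last exact/funext.
by rewrite product_measure1E// lte_mul_pinfty// ge0_fin_numE.
Qed.

HB.instance Definition _ := @Measure_isSigmaFinite.Build _ _ _
  mes_succ mes_succ_sigma_finite.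

End mes_succ.

Fixpoint mes (R : realType) (d : nat) :
    {sigma_finite_measure set 'rV[R]_d -> \bar R} :=
  match d with
  | 0 => \d_(0 : 'rV[R]_0)
  | n.+1 => mes_succ (mes R n)
  end.

Lemma mes_box (R : realType) (d : nat) (a b : 'rV[R]_d)
    (ab : forall i, a ord0 i <= b ord0 i) :
  mes R d [set x | forall i, a ord0 i < x ord0 i <= b ord0 i] =
  (\prod_i (b ord0 i - a ord0 i))%:E.
Proof.
elim: d a b ab => [a b _|d ih a b ab].
  by rewrite big_ord0 /= diracE mem_set// => -[].
pose tl (x : 'rV[R]_d.+1) : 'rV[R]_d := \row_j x ord0 (lift ord0 j).
rewrite big_ord_recl /= /mes_succ /pushforward.
have -> : @rV_cons R d @^-1` [set x | forall i, a ord0 i < x ord0 i <= b ord0 i] =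
    `]a ord0 ord0, b ord0 ord0]%classic `*`
    [set x : 'rV[R]_d | forall i, tl a ord0 i < x ord0 i <= tl b ord0 i].
  apply/seteqP; split=> -[s x] /=.
    move=> h; split.
      by rewrite in_itv /=; have := h ord0; rewrite mxE unlift_none.
    by move=> i; have := h (lift ord0 i); rewrite !mxE liftK.
  rewrite in_itv /= => -[h1 h2] i; rewrite mxE.
  by case: unliftP => [j|] -> //=; have := h2 j; rewrite !mxE.
rewrite product_measure1E //; last first.
  rewrite (_ : [set _ | _] = \bigcap_(i : 'I_d)
     ((fun x : 'rV[R]_d => x ord0 i) @^-1` `]tl a ord0 i, tl b ord0 i]%classic)).
    apply: fin_bigcap_measurable => // i _.
    by rewrite -[X in measurable X]setTI; exact: measurable_coord.
  apply/seteqP; split=> x /= h i; first by move=> _; rewrite /= in_itv; exact: h.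
  by have := h i I; rewrite /= in_itv.
rewrite ih; last by move=> i; rewrite !mxE.
rewrite /= lebesgue_measure_itv /= lte_fin EFinM; congr (_ * _)%E.
  have := ab ord0; rewrite le_eqVlt => /orP[/eqP ->|->]; last by rewrite EFinB.
  by rewrite ltxx subrr.
by congr EFin; apply: eq_bigr => i _; rewrite !mxE.
Qed.

Section geometry.
Context {R : realType} {d : nat}.
Implicit Types (x y : 'rV[R]_d) (G : set 'rV[R]_d) (V : 'rV[R]_d -> R).

(* The library norm on 'rV[R]_d is the sup norm. *)
Definition enorm x : R := Num.sqrt (\sum_i x ord0 i ^+ 2).

Definition eball (rho : R) : set 'rV[R]_d := [set x | enorm x < rho].

Definition ediam G : \bar R :=
  ereal_sup [set (enorm (x - y))%:E | x in G & y in G].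

Definition star_shaped_at G y :=
  forall x (t : R), G x -> 0 <= t <= 1 -> G ((1 - t) *: y + t *: x).

Definition admissible_domain G :=
  [/\ open G, connected G, bounded_set G,
      (exists rho : R, [/\ 0 < rho, eball rho `<=` G &
         forall y, eball rho y -> star_shaped_at G y]) &
      ediam G = 2%:E].

Definition dilate G (r : R) (y : 'rV[R]_d) : set 'rV[R]_d :=
  [set x + y | x in [set x | G (r^-1 *: x)]].

(* Adjoining 0 to the set implements the convention sup set0 = 0. *)
Definition rearrangement V G (t : \bar R) y (r : R) : \bar R :=
  ereal_sup (0%E |` [set s%:E | s in [set s : R | 0 < s /\
    (t <= mes R d [set x | closure (dilate G r y) x /\ (s <= V x)%R])%E]]).

Definition tends_to_infty (f : 'rV[R]_d -> \bar R) :=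
  forall M : R, exists N : R, forall y, N < enorm y -> (M%:E <= f y)%E.

Definition locally_L1 V :=
  measurable_fun setT V /\
  forall K : set 'rV[R]_d, compact K -> (mes R d).-integrable K (EFin \o V).

End geometry.

(* Elements of the complex space L_2(R^d) are represented by functions,
   identified through [aeq]. *)
Section L2.
Context {R : realType} {d : nat}.
Local Notation mu := (mes R d).
Local Notation fn := ('rV[R]_d -> R[i]).
Implicit Types u v : fn.

Definition aeq u v := {ae mu, forall x, u x = v x}.

Definition L2 : set fn :=
  [set u | (fun x => complex.Re (u x)) \in Lfun mu 2%:E /\
           (fun x => complex.Im (u x)) \in Lfun mu 2%:E].

Definition cintegral u : R[i] :=
  Complex (\int[mu]_x complex.Re (u x)) (\int[mu]_x complex.Im (u x)).

Definition inner u v : R[i] := cintegral (fun x => u x * conjc (v x)).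

Definition norm2 u : R := Num.sqrt (complex.Re (inner u u)).

End L2.

(* A linear operator in L_2(R^d) is given by its graph [A]: [A u f] means that
   u lies in the domain and A u = f. *)
Section spectrum.
Context {R : realType} {d : nat}.
Local Notation fn := ('rV[R]_d -> R[i]).
Implicit Types (A : fn -> fn -> Prop) (z : R[i]).

(* A - z is a bijection from the domain of A onto L_2, with bounded inverse. *)
Definition resolvent_set A : set R[i] := [set z |
  [/\ forall u, A u (fun x => z * u x) -> aeq u (fun=> 0),
      forall f, L2 f -> exists u, A u (fun x => z * u x + f x) &
      exists C : R, forall u f, L2 f -> A u (fun x => z * u x + f x) ->
        norm2 u <= C * norm2 f]].

Definition spectrum A : set R[i] := ~` resolvent_set A.

Definition eigenvalue_of A z :=
  exists2 u, A u (fun x => z * u x) & ~ aeq u (fun=> 0).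

Definition finite_multiplicity A z :=
  exists (n : nat) (e : 'I_n -> fn),
    (forall k, A (e k) (fun x => z * e k x)) /\
    forall u, A u (fun x => z * u x) ->
      exists c : 'I_n -> R[i], aeq u (fun x => \sum_k c k * e k x).

Definition isolated_in (S : set R[i]) z :=
  exists2 eps : R, 0 < eps &
    forall w, S w -> ComplexField.Normc.normc (w - z) < eps -> w = z.

Definition discrete_spectrum A :=
  forall z, spectrum A z ->
    [/\ isolated_in (spectrum A) z, eigenvalue_of A z &
        finite_multiplicity A z].

(* The self-adjoint operator associated with a densely defined, closed,
   nonnegative form h with domain D (first representation theorem). *)
Definition form_operator (D : set fn) (h : fn -> fn -> R[i]) :
    fn -> fn -> Prop :=
  fun u f => [/\ D u, L2 f & forall v, D v -> h u v = inner f v].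

End spectrum.

Section schrodinger.
Context {R : realType} {d : nat}.
Local Notation mu := (mes R d).
Local Notation fn := ('rV[R]_d -> R[i]).
Implicit Types (u v g : fn) (phi V : 'rV[R]_d -> R) (i : 'I_d).

Definition partial i phi : 'rV[R]_d -> R :=
  fun x => 'D_(delta_mx ord0 i) phi x.

Definition smooth phi := forall s : seq 'I_d,
  let psi := foldr partial phi s in
  continuous psi /\ forall x i, derivable psi x (delta_mx ord0 i).

Definition test_function phi :=
  smooth phi /\ compact (closure [set x | phi x != 0]).

Definition is_weak_partial i u g := forall phi, test_function phi ->
  cintegral (fun x => u x * (partial i phi x)%:C%C) =
  - cintegral (fun x => g x * (phi x)%:C%C).

Definition weak_partials i u : set fn := [set g | L2 g /\ is_weak_partial i u g].

(* Meaningful for u in H1, and then unique up to aeq. *)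
Definition weak_partial i u : fn := xget (fun=> 0) (weak_partials i u).

Definition H1 : set fn :=
  [set u | L2 u /\ forall i, weak_partials i u !=set0].

Definition form_domain V : set fn :=
  [set u | H1 u /\ mu.-integrable setT
    (fun x => (V x * ComplexField.Normc.normc (u x) ^+ 2)%:E)].

(* Polarization of \int (|grad u|^2 + V |u|^2). *)
Definition schrodinger_form V u v : R[i] :=
  (\sum_i inner (weak_partial i u) (weak_partial i v)) +
  inner (fun x => (V x)%:C%C * u x) v.

Definition schrodinger V : fn -> fn -> Prop :=
  form_operator (form_domain V) (schrodinger_form V).

End schrodinger.

(* Main.v *)
(* Let Q be the cube of half-side l centred at 0.  If V >= s on a subset of
   y + Q of measure at least d0, then comparing u(y) with the values of u on that
   subset gives
     d0 u(y)^2 <= 2 \int_Q (u(y) - u(y+t))^2 dt + (2/s) \int_{y+Q} V u^2.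
   Integrated in y, the first term is at most a multiple of l^(d+2) \int |grad u|^2
   by the translation estimate |u(. + t e_i) - u| <= |t| |d_i u| in L_2.  For the
   sets supplied by the rearrangement, l is comparable with r and d0 with
   gamma(r) r^d, so both terms carry small constants as soon as r^2 / gamma(r) is
   small and s is large; since 2(d-2)/d <= 2, the limsup hypothesis provides such
   r.  On a ball the same comparison on small cubes leaves only finitely many
   averages of u.  Together this yields, for every eps, a finite-rank inequality
     |u|^2 <= eps (\int |grad u|^2 + V u^2) + C sum_j <u, g_j>^2,
   which replaces the compactness of the embedding of the form domain in L_2: it
   reduces the equation A u = z u + f to a finite linear system, so that every
   point of the spectrum is an eigenvalue of finite multiplicity, and, by Bessel's
   inequality, it bounds the number of eigenvalues below any level. *)
Require Import Defs.
From mathcomp Require Import all_boot all_order all_algebra.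
From mathcomp Require Import all_classical all_reals all_analysis.
From mathcomp Require Import measurable_realfun.
From mathcomp Require Import complex.
From mathcomp Require Import ring lra.
Import Order.TTheory GRing.Theory Num.Theory.
Import numFieldNormedType.Exports.
Local Open Scope classical_set_scope.
Local Open Scope ring_scope.

Set Implicit Arguments.
Unset Strict Implicit.
Unset Printing Implicit Defensive.

(** * Semidefinite forms, Cauchy-Schwarz and Riesz representation *)

Section prehilbert.
Context {R : realType} {E : lmodType R}.

(** Elements of L_2 stay functions: a form is a positive semidefinite pairing on a set of vectors,
    and equality is replaced by the vanishing of [ip (u - v) (u - v)], so that no quotient by null
    functions is formed. The abstract part has real scalars only. A complex function is a pair of
    real ones, and multiplication by z becomes a bounded R-linear map [Z] on pairs, in general not
    symmetric. This is the obstacle to solving A u = Z u + f, since Riesz representation needs a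
    symmetric form. The error term of the finite-rank inequality, added to the form, makes it
    coercive with a constant so small that [Z] becomes a contraction relative to it; a least-squares
    problem, whose form is symmetric, then gives the solution. On the analytic side, H^1 functions
    are never approximated by smooth ones: the translation estimate is obtained by duality against
    test functions, whose density in L_2 comes from explicit bumps converging to indicators of
    boxes. The potential enters through W = sqrt(max(V, 0)), which makes the potential energy the
    squared L_2 norm of W u. *)

Record prehilbert (L : set E) (ip : E -> E -> R) : Prop := Prehilbert {
  ph0 : L 0;
  phD : forall u v, L u -> L v -> L (u + v);
  phZ : forall a u, L u -> L (a *: u);
  ipC : forall u v, L u -> L v -> ip u v = ip v u;
  ipDl : forall u v w, L u -> L v -> L w -> ip (u + v) w = ip u w + ip v w;
  ipZl : forall a u v, L u -> L v -> ip (a *: u) v = a * ip u v;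
  ip_ge0 : forall u, L u -> 0 <= ip u u }.

Definition cauchy_in (ip : E -> E -> R) (u_ : nat -> E) :=
  forall e : R, 0 < e -> exists N, forall m n, (N <= m)%N -> (N <= n)%N ->
    ip (u_ m - u_ n) (u_ m - u_ n) <= e.

Definition cvg_in (ip : E -> E -> R) (u_ : nat -> E) (u : E) :=
  forall e : R, 0 < e -> exists N, forall n, (N <= n)%N ->
    ip (u_ n - u) (u_ n - u) <= e.

Definition complete_in (L : set E) ip :=
  forall u_, (forall n, L (u_ n)) -> cauchy_in ip u_ ->
  exists2 u, L u & cvg_in ip u_ u.

Lemma le_sqr_of_quadratic (a b c : R) : 0 <= c ->
  (forall s, 0 <= a + 2 * s * b + s ^+ 2 * c) -> b ^+ 2 <= a * c.
Proof.
move=> c0 h; have [c0'|] := ltP 0 c.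
  have := h (- b / c).
  rewrite (_ : _ + _ = (a * c - b ^+ 2) / c); last by field; rewrite gt_eqF.
  by rewrite pmulr_lge0 ?invr_gt0// subr_ge0.
move=> c0'; have {c0 c0'} c0 : c = 0 by apply/eqP; rewrite eq_le c0 c0'.
have [->|b0] := eqVneq b 0; first by rewrite c0; lra.
(* With [c = 0] the quadratic is affine in [s]; this [s] gives it the value -1. *)
have := h (- (a + 1) / (2 * b)).
rewrite (_ : _ + _ = -1 + (- (a + 1) / (2 * b)) ^+ 2 * c); last by field.
by rewrite c0 mulr0; lra.
Qed.

Lemma sum_CS n (a b : 'I_n -> R) :
  (\sum_i a i * b i) ^+ 2 <= (\sum_i a i ^+ 2) * (\sum_i b i ^+ 2).
Proof.
apply: le_sqr_of_quadratic; first by apply: sumr_ge0 => i _; exact: sqr_ge0.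
move=> s; rewrite (_ : _ + _ = \sum_i (a i + s * b i) ^+ 2).
  by apply: sumr_ge0 => i _; exact: sqr_ge0.
rewrite !mulr_sumr -!big_split/=; apply: eq_bigr => i _; ring.
Qed.

Section one_form.
Variables (L : set E) (ip : E -> E -> R).
Hypothesis H : prehilbert L ip.

Lemma phN u : L u -> L (- u).
Proof. by move=> Lu; rewrite -scaleN1r; exact: (phZ H). Qed.

Lemma phB u v : L u -> L v -> L (u - v).
Proof. by move=> Lu Lv; apply: (phD H) => //; exact: phN. Qed.

Lemma ph_sum n (c : 'I_n -> R) (e : 'I_n -> E) : (forall i, L (e i)) ->
  L (\sum_i c i *: e i).
Proof.
move=> Le; apply: (big_ind L); first exact: (ph0 H).
- by move=> x y; exact: (phD H).
- by move=> i _; exact: (phZ H).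
Qed.

Lemma ipDr u v w : L u -> L v -> L w -> ip w (u + v) = ip w u + ip w v.
Proof.
move=> Lu Lv Lw; rewrite (ipC H) ?(ipDl H) ?(ipC H Lw)//.
exact: (phD H).
Qed.

Lemma ipZr a u v : L u -> L v -> ip v (a *: u) = a * ip v u.
Proof. by move=> Lu Lv; rewrite (ipC H) ?(ipZl H) ?(ipC H Lv)//; exact: (phZ H). Qed.

Lemma ipNl u v : L u -> L v -> ip (- u) v = - ip u v.
Proof. by move=> Lu Lv; rewrite -scaleN1r (ipZl H)// mulN1r. Qed.

Lemma ipNr u v : L u -> L v -> ip v (- u) = - ip v u.
Proof. by move=> Lu Lv; rewrite -scaleN1r ipZr// mulN1r. Qed.

Lemma ipBl u v w : L u -> L v -> L w -> ip (u - v) w = ip u w - ip v w.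
Proof. by move=> Lu Lv Lw; rewrite (ipDl H)// ?ipNl//; exact: phN. Qed.

Lemma ipBr u v w : L u -> L v -> L w -> ip w (u - v) = ip w u - ip w v.
Proof. by move=> Lu Lv Lw; rewrite ipDr// ?ipNr//; exact: phN. Qed.

Lemma ip0l v : L v -> ip 0 v = 0.
Proof. by move=> Lv; rewrite -(scale0r 0) (ipZl H)// ?mul0r//; exact: (ph0 H). Qed.

Lemma ip_suml n (c : 'I_n -> R) (e : 'I_n -> E) v : (forall i, L (e i)) -> L v ->
  ip (\sum_i c i *: e i) v = \sum_i c i * ip (e i) v.
Proof.
move=> Le Lv.
pose K x s := L x /\ ip x v = s.
suff [] : K (\sum_i c i *: e i) (\sum_i c i * ip (e i) v) by [].
apply: (big_ind2 K).
- by split; [exact: (ph0 H)|exact: ip0l].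
- move=> x1 x2 y1 y2 [L1 <-] [L2 <-]; split; first exact: (phD H).
  by rewrite (ipDl H).
- by move=> i _; split; [exact: (phZ H)|rewrite (ipZl H)].
Qed.

Lemma ip_sqrD u v : L u -> L v ->
  ip (u + v) (u + v) = ip u u + 2 * ip u v + ip v v.
Proof.
move=> Lu Lv; have Luv := phD H Lu Lv.
by rewrite (ipDl H)// !ipDr// (ipC H Lv Lu); ring.
Qed.

Lemma ip_sqrB u v : L u -> L v ->
  ip (u - v) (u - v) = ip u u - 2 * ip u v + ip v v.
Proof.
move=> Lu Lv; rewrite ip_sqrD//; last exact: phN.
by rewrite ipNr// ipNl ?ipNr//; [ring|exact: phN].
Qed.

Lemma ip_CS u v : L u -> L v -> ip u v ^+ 2 <= ip u u * ip v v.
Proof.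
move=> Lu Lv; apply: le_sqr_of_quadratic; first exact: (ip_ge0 H).
move=> s; have := ip_ge0 H (phD H Lu (phZ H s Lv)).
rewrite ip_sqrD//; last exact: (phZ H).
by rewrite !(ipZr, ipZl H)//; [rewrite expr2 -!mulrA|exact: (phZ H)].
Qed.

Lemma ip_null u v : L u -> L v -> ip u u = 0 -> ip u v = 0.
Proof.
move=> Lu Lv u0; apply/eqP; rewrite -sqrf_eq0; apply/eqP/le_anti.
by rewrite sqr_ge0 andbT (le_trans (ip_CS Lu Lv))// u0 mul0r.
Qed.

(** For the sum s, expand [ip s s] as [\sum_i c i * ip (e i) s]. Cauchy-Schwarz in R^n and then in
    [E] bounds its square with a factor [ip s s], which cancels. *)
Lemma ip_sqr_sum_le n (c : 'I_n -> R) (e : 'I_n -> E) : (forall i, L (e i)) ->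
  ip (\sum_i c i *: e i) (\sum_i c i *: e i) <=
    (\sum_i c i ^+ 2) * \sum_i ip (e i) (e i).
Proof.
move=> Le; have Ls := ph_sum c Le; set s := \sum_i _ in Ls *.
have s0 := ip_ge0 H Ls.
have p0 : 0 <= \sum_i c i ^+ 2 by apply: sumr_ge0 => i _; exact: sqr_ge0.
have [->|sn0] := eqVneq (ip s s) 0.
  by rewrite mulr_ge0// sumr_ge0// => i _; exact: (ip_ge0 H).
have sp : 0 < ip s s by rewrite lt_neqAle eq_sym sn0.
have e1 : ip s s = \sum_i c i * ip (e i) s by rewrite {1}/s ip_suml.
rewrite -(ler_pM2r sp) -expr2 {1}e1.
apply: (le_trans (sum_CS _ _)); rewrite -mulrA ler_wpM2l// mulr_suml.
by apply: ler_sum => i _; exact: ip_CS.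
Qed.

Lemma ip_sqrD_le u v : L u -> L v -> ip (u + v) (u + v) <= 2 * ip u u + 2 * ip v v.
Proof.
move=> Lu Lv; have := ip_ge0 H (phB Lu Lv).
by rewrite ip_sqrB// ip_sqrD//; lra.
Qed.

Lemma ip_cvg u_ u v : (forall n, L (u_ n)) -> L u -> L v -> cvg_in ip u_ u ->
  forall e : R, 0 < e -> exists N, forall n, (N <= n)%N -> `|ip (u_ n) v - ip u v| <= e.
Proof.
move=> Lun Lu Lv uu e e0.
have v0 := ip_ge0 H Lv.
(* The [+ 1] keeps the quotient meaningful when [v] is a null vector. *)
have d0 : 0 < e ^+ 2 / (ip v v + 1) by rewrite divr_gt0 ?exprn_gt0//; lra.
have [N hN] := uu _ d0; exists N => n /hN {}hN.
rewrite -ler_sqr ?nnegrE ?(ltW e0)// real_normK ?num_real//.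
rewrite -ipBl// (le_trans (ip_CS (phB (Lun n) Lu) Lv))//.
apply: (@le_trans _ _ (e ^+ 2 / (ip v v + 1) * ip v v)).
  exact: ler_wpM2r.
by rewrite mulrAC ler_pdivrMr ?ler_wpM2l ?sqr_ge0//; lra.
Qed.

Variable l : E -> R.
Hypothesis lD : forall u v, L u -> L v -> l (u + v) = l u + l v.
Hypothesis lZ : forall a u, L u -> l (a *: u) = a * l u.
Hypothesis lb : exists C, forall u, L u -> l u ^+ 2 <= C * ip u u.

(* [u] is a near-minimizer of [ip v v - 2 l v]. *)
Lemma riesz_approx eta : 0 < eta ->
  exists2 u, L u & forall w, L w -> (ip u w - l w) ^+ 2 <= eta * ip w w.
Proof.
move=> eta0; have [C0 lb0] := lb; pose C := Num.max C0 0.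
have C_ge0 : 0 <= C by rewrite le_max lexx orbT.
have lC u : L u -> l u ^+ 2 <= C * ip u u.
  move=> Lu; rewrite (le_trans (lb0 _ Lu))// ler_wpM2r//; first exact: (ip_ge0 H).
  by rewrite le_max lexx.
pose J v := ip v v - 2 * l v.
have JC v : L v -> - C <= J v.
  move=> Lv; rewrite /J; have v0 := ip_ge0 H Lv; have := lC _ Lv => lv.
  rewrite lerBrDl addrC -lerBrDl opprK.
  have [l0|l0] := leP (l v) 0; first by nra.
  rewrite -ler_sqr ?nnegrE; [|nra|nra].
  by have := sqr_ge0 (ip v v - C); nra.
have hi : has_inf [set J v | v in L].
  split; first by exists (J 0), 0 => //; exact: (ph0 H).
  by exists (- C) => _ [v Lv <-]; exact: JC.
have [_ [u Lu <-] hu] := inf_adherent eta0 hi.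
exists u => // w Lw; apply: le_sqr_of_quadratic; first exact: (ip_ge0 H).
(* First variation: moving [u] by [s *: w] lowers [J] by at most [eta], which is a quadratic
   inequality in [s] with discriminant bound equal to the claim. *)
move=> s; have Lsw := phZ H s Lw; have Lusw := phD H Lu Lsw.
have : inf [set J v | v in L] <= J (u + s *: w) by apply: ge_inf; [case: hi|exists (u + s *: w)].
move: hu; rewrite /J ip_sqrD// lD// lZ// ipZr// (ipZl H)// ipZr//.
by move: (inf _) => m; lra.
Qed.

(** Both near-representatives are tested on their own difference [w]: [ip w w] is then the
    difference of two errors, each at most sqrt(eta * ip w w), and one factor [ip w w] cancels. *)
Lemma riesz_cauchy (u_ : nat -> E) (eta : nat -> R) : (forall n, L (u_ n)) ->
  (forall n, 0 <= eta n) -> 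
  (forall n w, L w -> (ip (u_ n) w - l w) ^+ 2 <= eta n * ip w w) ->
  forall m n, ip (u_ m - u_ n) (u_ m - u_ n) <= 2 * (eta m + eta n).
Proof.
move=> Lun eta0 h m n; set w := u_ m - u_ n.
have Lw : L w by exact: phB.
have w0 := ip_ge0 H Lw.
have := h m w Lw; have := h n w Lw.
have e : ip w w = (ip (u_ m) w - l w) - (ip (u_ n) w - l w).
  by rewrite {1}/w ipBl//; ring.
move: (ip (u_ m) w - l w) (ip (u_ n) w - l w) e => a b e ha hb.
have [->|] := eqVneq (ip w w) 0; first by have := eta0 m; have := eta0 n; lra.
move=> wn0; have wp : 0 < ip w w by rewrite lt_neqAle eq_sym wn0.
rewrite -(ler_pM2r wp).
have : ip w w * ip w w <= 2 * a ^+ 2 + 2 * b ^+ 2.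
  by rewrite e; have := sqr_ge0 (a + b); nra.
by lra.
Qed.

(** Stated without completeness, so that it also applies to test functions, where the limit of the
    sequence is taken in the larger space L_2. *)
Lemma riesz_seq : exists u_ : nat -> E, [/\ forall n, L (u_ n), cauchy_in ip u_ &
  forall w, L w -> forall e : R, 0 < e -> exists N, forall n, (N <= n)%N ->
    `|ip (u_ n) w - l w| <= e].
Proof.
have h (n : nat) : exists u, L u /\ forall w, L w ->
    (ip u w - l w) ^+ 2 <= n.+1%:R^-1 * ip w w.
  have n0 : 0 < n.+1%:R^-1 :> R by rewrite invr_gt0.
  by have [u] := riesz_approx n0; exists u.
have [u_ hu] := choice h.
have inv (e : R) : 0 < e -> exists N, forall n, (N <= n)%N -> n.+1%:R^-1 <= e :> R.
  move=> e0; exists (Num.trunc e^-1) => n Nn.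
  rewrite -[leRHS]invrK lef_pV2 ?posrE ?invr_gt0//.
  by rewrite ltW// (lt_le_trans (truncnS_gt _))// ler_nat.
exists u_; split.
- by move=> n; have [] := hu n.
- move=> e e0; have [|N hN] := inv (e / 4); first by lra.
  exists N => m n /hN hm /hN hn.
  apply: (@le_trans _ _ (2 * (m.+1%:R^-1 + n.+1%:R^-1))); last first.
    by move: hm hn; move: (m.+1%:R^-1) (n.+1%:R^-1) => x y; lra.
  apply: (riesz_cauchy (eta := fun n => n.+1%:R^-1)) => [k|k|k w Lw].
  + by have [] := hu k.
  + by rewrite invr_ge0.
  + by have [_] := hu k; exact.
- move=> w Lw e e0; have w0 := ip_ge0 H Lw.
  have [|N hN] := inv (e ^+ 2 / (ip w w + 1)); first by rewrite divr_gt0 ?exprn_gt0//; lra.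
  exists N => n /hN hn; rewrite -ler_sqr ?nnegrE ?(ltW e0)// real_normK ?num_real//.
  have [_ /(_ _ Lw) h1] := hu n; rewrite (le_trans h1)//.
  apply: (@le_trans _ _ (e ^+ 2 / (ip w w + 1) * ip w w)); first exact: ler_wpM2r.
  by rewrite mulrAC ler_pdivrMr ?ler_wpM2l ?sqr_ge0//; lra.
Qed.

Lemma riesz : complete_in L ip -> exists2 u, L u & forall w, L w -> ip u w = l w.
Proof.
move=> cL; have [u_ [Lun /(cL _ Lun)[u Lu uu] hu]] := riesz_seq.
exists u => // w Lw; apply/eqP; rewrite -subr_eq0 -normr_le0.
apply/ler_addgt0Pl => e e0; rewrite addr0.
have e2 : 0 < e / 2 by lra.
have [N1 h1] := hu w Lw _ e2.
have [N2 h2] := ip_cvg Lun Lu Lw uu e2.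
have := h1 _ (leq_maxl N1 N2); have := h2 _ (leq_maxr N1 N2).
set a := ip (u_ _) w => ha hb.
rewrite (_ : _ - _ = (ip u w - a) + (a - l w)); last by ring.
by rewrite (le_trans (ler_normD _ _))// distrC; lra.
Qed.

End one_form.
End prehilbert.

(** * Fredholm alternative and eigenvalue count from the finite-rank inequality *)

Section fredholm.
Context {R : realType} {E : lmodType R}.
Variables (L D : set E) (ip q : E -> E -> R).
Hypotheses (HL : prehilbert L ip) (HD : prehilbert D q) (DL : D `<=` L).
Hypothesis cD : complete_in D (fun u v => q u v + ip u v).

(* Garding-type inequality whose error term has finite rank; it replaces the
   compactness of the embedding of [D] into [L]. *)
Definition finite_rank_garding := forall eps : R, 0 < eps ->
  exists (n : nat) (g : 'I_n -> E) (C : R), [/\ 0 <= C, forall j, L (g j) &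
    forall u, D u -> ip u u <= eps * q u u + C * \sum_j ip u (g j) ^+ 2].

Hypothesis garding : finite_rank_garding.

Definition operator_of : E -> E -> Prop :=
  fun u f => [/\ D u, L f & forall v, D v -> q u v = ip f v].

(** Stands for multiplication by a complex number on pairs of real functions. It need not be
    symmetric for [ip], so that [q u v - ip (Z u) v] is in general not a symmetric form. *)
Variable Z : E -> E.
Hypothesis LZ : forall u, L u -> L (Z u).
Hypothesis ZD : forall u v, Z (u + v) = Z u + Z v.
Hypothesis ZZ : forall a u, Z (a *: u) = a *: Z u.
Hypothesis Zb : exists2 m : R, 0 < m & forall u, L u -> ip (Z u) (Z u) <= m * ip u u.

Section perturbed.
Variables (eps K m : R) (n : nat) (g : 'I_n -> E).
Hypotheses (eps0 : 0 < eps) (K0 : 0 <= K) (m0 : 0 <= m) (Lg : forall j, L (g j)).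
Hypothesis mZ : forall u, L u -> ip (Z u) (Z u) <= m * ip u u.
Hypothesis m_eps : 4 * m * eps ^+ 2 <= 1.

(** The finite-rank term makes the form coercive with constant [eps]; by [m_eps], [Z] then has norm
    at most 1/2 relative to [t], which is [ZBt]. *)
Let t u v := q u v + K * \sum_j ip u (g j) * ip v (g j).

Hypothesis coercive : forall u, D u -> ip u u <= eps * t u u.

Let Ht : prehilbert D t.
Proof.
split; [exact: (ph0 HD)|exact: (phD HD)|exact: (phZ HD)|..].
- move=> u v Du Dv; rewrite /t (ipC HD)//; congr (_ + _ * _).
  by apply: eq_bigr => j _; rewrite mulrC.
- move=> u v w Du Dv Dw; rewrite /t (ipDl HD)// addrACA -mulrDr -big_split/=.
  congr (_ + _ * _); apply: eq_bigr => j _.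
  by rewrite (ipDl HL) ?mulrDl//; apply: DL.
- move=> a u v Du Dv; rewrite /t (ipZl HD)// mulrDr mulrCA; congr (_ + _ * _).
  rewrite mulr_sumr; apply: eq_bigr => j _.
  by rewrite (ipZl HL) ?mulrA//; apply: DL.
- move=> u Du; rewrite /t addr_ge0 ?(ip_ge0 HD)// mulr_ge0// sumr_ge0// => j _.
  by rewrite -expr2 sqr_ge0.
Qed.

Let t_ge_q u : D u -> q u u <= t u u.
Proof.
move=> Du; rewrite /t lerDl mulr_ge0// sumr_ge0// => j _.
by rewrite -expr2 sqr_ge0.
Qed.

Let t_le u : D u -> t u u <= (1 + K * \sum_j ip (g j) (g j)) * (q u u + ip u u).
Proof.
move=> Du; rewrite /t mulrDl mul1r lerD//.
  by rewrite lerDl (ip_ge0 HL)//; exact: DL.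
rewrite -mulrA ler_wpM2l//.
apply: (@le_trans _ _ (\sum_j ip (g j) (g j) * ip u u)).
  by apply: ler_sum => j _; rewrite -expr2 mulrC (ip_CS HL)//; exact: DL.
rewrite -mulr_suml ler_wpM2l//; last by rewrite lerDr (ip_ge0 HD).
by apply: sumr_ge0 => j _; exact: (ip_ge0 HL).
Qed.

Let complete_equiv (a : E -> E -> R) (c1 c2 : R) : 0 < c1 -> 0 < c2 ->
  (forall u, D u -> q u u + ip u u <= c1 * a u u) ->
  (forall u, D u -> a u u <= c2 * (q u u + ip u u)) -> complete_in D a.
Proof.
move=> c10 c20 h1 h2 u_ Du cu.
have [] := cD Du.
  move=> e e0; have [|N hN] := cu (e / c1); first exact: divr_gt0.
  exists N => k l /hN h /h{h}; rewrite ler_pdivlMr// mulrC; apply: le_trans.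
  by apply: h1; exact: (phB HD).
move=> u Dul uu; exists u => // e e0.
have [|N hN] := uu (e / c2); first exact: divr_gt0.
exists N => k /hN; rewrite ler_pdivlMr// mulrC; apply: le_trans.
by apply: h2; exact: (phB HD).
Qed.

Let ct : complete_in D t.
Proof.
apply: (@complete_equiv t (1 + eps) (1 + K * \sum_j ip (g j) (g j))).
- by rewrite addr_gt0.
- rewrite ltr_wpDr// mulr_ge0// sumr_ge0// => j _; exact: (ip_ge0 HL).
- by move=> u Du; rewrite mulrDl mul1r lerD ?t_ge_q ?coercive.
- exact: t_le.
Qed.

Let represent f : L f -> exists2 u, D u & forall v, D v -> t u v = ip f v.
Proof.
move=> Lf; apply: (riesz Ht (l := ip f)) => //.
- by move=> u v Du Dv; rewrite (ipDr HL)//; exact: DL.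
- by move=> a u Du; rewrite (ipZr HL)//; exact: DL.
- exists (ip f f * eps) => u Du.
  rewrite (le_trans (ip_CS HL Lf (DL Du)))// -mulrA ler_wpM2l ?coercive//.
  exact: (ip_ge0 HL).
Qed.

Let ZBt u v : D u -> D v -> ip (Z u) v ^+ 2 <= 4^-1 * (t u u * t v v).
Proof.
move=> Du Dv; have Lu := DL Du; have Lv := DL Dv.
rewrite (le_trans (ip_CS HL (LZ Lu) Lv))//.
apply: (@le_trans _ _ ((m * (eps * t u u)) * (eps * t v v))).
  apply: ler_pM; rewrite ?(ip_ge0 HL) ?coercive//; first exact: LZ.
  by rewrite (le_trans (mZ Lu))// ler_wpM2l ?coercive.
rewrite (_ : _ * _ = (m * eps ^+ 2) * (t u u * t v v)); last by ring.
by rewrite ler_wpM2r ?mulr_ge0 ?(ip_ge0 Ht)//; move: m_eps; lra.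
Qed.

Let sqr_le_quarter (x : R) : 0 <= x -> x ^+ 2 <= 4^-1 * (x * x) -> x = 0.
Proof. by move=> x0 h; apply/eqP; rewrite -sqrf_eq0; apply/eqP; nra. Qed.

(* With [S] the [t]-adjoint representation of [Z], the residual [r] of the
   least-squares solution of [u - S u = b] satisfies t(r, r) = t(r, S r), hence
   vanishes since [S] contracts by 1/2. *)
Lemma perturbed_solution f : L f ->
  exists2 u, D u & forall v, D v -> t u v = ip (Z u + f) v.
Proof.
move=> Lf; have [b Db hb] := represent Lf.
have /choice[S hS] : forall u, exists s, D u ->
    D s /\ forall v, D v -> t s v = ip (Z u) v.
  move=> u; have [Du|nDu] := pselect (D u); last by exists 0.
  by have [s Ds hs] := represent (LZ (DL Du)); exists s.
have DS u : D u -> D (S u) by case/hS.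
have tS u v : D u -> D v -> t (S u) v = ip (Z u) v by case/hS => _; exact.
have tSr u v : D u -> D v -> t v (S u) = ip (Z u) v.
  by move=> Du Dv; rewrite (ipC Ht) ?tS//; exact: DS.
have SS u : D u -> t (S u) (S u) <= 4^-1 * t u u.
  move=> Du; have := ZBt Du (DS _ Du); rewrite -tS//; last exact: DS.
  have := ip_ge0 Ht (DS _ Du); rewrite le_eqVlt => /predU1P[<- _|s0].
    by rewrite mulr_ge0// (ip_ge0 Ht).
  by rewrite mulrA expr2 ler_pM2r.
(* This is t(u - S u, v - S v), written so that [S] is applied to [v] only: [S] comes from choice
   and need not be linear, and linearity in [u] has to follow from that of [Z]. *)
pose a u v := t u v - ip (Z u) v - ip (Z v) u + ip (Z u) (S v).
have aE u v : D u -> D v -> a u v = t (u - S u) (v - S v).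
  move=> Du Dv; have DSu := DS _ Du; have DSv := DS _ Dv.
  rewrite (ipBl Ht)//; last exact: (phB HD).
  by rewrite !(ipBr Ht)// tS// tSr// tS// /a; ring.
have DB u : D u -> D (u - S u) by move=> Du; apply: (phB HD) => //; exact: DS.
have Ha : prehilbert D a.
  split; [exact: (ph0 HD)|exact: (phD HD)|exact: (phZ HD)|..].
  - by move=> u v Du Dv; rewrite !aE// (ipC Ht)//; exact: DB.
  - move=> u v w Du Dv Dw; rewrite /a ZD (ipDl Ht)//.
    have [Lu Lv Lw] := And3 (DL Du) (DL Dv) (DL Dw).
    have [LZu LZv LZw] := And3 (LZ Lu) (LZ Lv) (LZ Lw).
    have LSw := DL (DS _ Dw).
    by rewrite !(ipDl HL)// (ipDr HL)//; ring.
  - move=> c u v Du Dv; rewrite /a ZZ (ipZl Ht)//.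
    have [Lu Lv LSv] := And3 (DL Du) (DL Dv) (DL (DS _ Dv)).
    have [LZu LZv] := conj (LZ Lu) (LZ Lv).
    by rewrite !(ipZl HL)// (ipZr HL)//; ring.
  - by move=> u Du; rewrite aE// (ip_ge0 Ht)//; exact: DB.
(* Since [S] halves lengths, u - S u is comparable with u, so that [a] and [t] are equivalent and
   completeness carries over to [a]. *)
have ta u : D u -> t u u <= 4 * a u u.
  move=> Du; rewrite aE//; have := ip_sqrD_le Ht (DB _ Du) (DS _ Du).
  by rewrite subrK; have := SS _ Du; lra.
have at' u : D u -> a u u <= 4 * t u u.
  move=> Du; rewrite aE//.
  have DSu := DS _ Du; have DNSu := phN HD DSu.
  have := ip_sqrD_le Ht Du DNSu; rewrite (ipNl Ht)// (ipNr Ht)// opprK.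
  by have := SS _ Du; have := ip_ge0 Ht Du; lra.
have ca : complete_in D a.
  apply: (@complete_equiv a ((1 + eps) * 4)
    (4 * (1 + K * \sum_j ip (g j) (g j)))).
  - by rewrite mulr_gt0// addr_gt0.
  - rewrite mulr_gt0// ltr_wpDr// mulr_ge0// sumr_ge0// => j _; exact: (ip_ge0 HL).
  - move=> u Du; apply: (@le_trans _ _ ((1 + eps) * t u u)).
      by rewrite mulrDl mul1r lerD ?t_ge_q ?coercive.
    by rewrite -mulrA ler_wpM2l ?ta// addr_ge0// ltW.
  - by move=> u Du; rewrite (le_trans (at' _ Du))// -mulrA ler_wpM2l// t_le.
have Lb := DL Db.
(* Normal equations of the least-squares problem: the functional is t(b, v - S v), again written
   through [Z] to make its linearity visible. *)
have [] := riesz Ha (l := fun v => t b v - ip (Z v) b) _ _ _ ca.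
- move=> u v Du Dv; have [LZu LZv] := conj (LZ (DL Du)) (LZ (DL Dv)).
  by rewrite (ipDr Ht)// ZD (ipDl HL)//; ring.
- move=> c u Du; have LZu := LZ (DL Du).
  by rewrite (ipZr Ht)// ZZ (ipZl HL)//; ring.
- exists (t b b) => u Du; rewrite -tSr// -(ipBr Ht)//; last exact: DS.
  by rewrite aE// (ip_CS Ht)//; exact: DB.
move=> u Du hu; exists u => // v Dv.
pose r := u - S u - b.
have Dr : D r by apply: (phB HD) => //; exact: DB.
have rS w : D w -> t r (w - S w) = 0.
  move=> Dw; rewrite /r (ipBl Ht)//; try exact: DB.
  rewrite -aE// hu// (ipBr Ht)//; last exact: DS.
  by rewrite tSr//; ring.
have r0 : t r r = 0.
  apply: sqr_le_quarter; first exact: (ip_ge0 Ht).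
  have /eqP := rS _ Dr; rewrite (ipBr Ht)//; last exact: DS.
  rewrite subr_eq0 => /eqP {1}->; rewrite (le_trans (ip_CS Ht _ _))//; first exact: DS.
  by have := SS _ Dr; have := ip_ge0 Ht Dr; nra.
have Lv := DL Dv; have Lu := DL Du.
rewrite (ipDl HL)//; last exact: LZ.
rewrite -hb// -tS// -(ipDl Ht)//; last exact: DS.
apply/eqP; rewrite -subr_eq0 -(ipBl Ht)//; last by apply: (phD HD) => //; exact: DS.
by rewrite opprD addrA -/r (ip_null Ht).
Qed.

(** Test with [u] itself: half of [t u u] absorbs the [Z] term, leaving [t u u <= 2 * ip f u];
    Cauchy-Schwarz and coercivity finish. *)
Lemma perturbed_bound u f : D u -> L f ->
  (forall v, D v -> t u v = ip (Z u + f) v) -> ip u u <= 4 * eps ^+ 2 * ip f f.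
Proof.
move=> Du Lf h; have Lu := DL Du; have T0 := ip_ge0 Ht Du.
have := h _ Du; rewrite (ipDl HL)//; last exact: LZ.
have h1 := ZBt Du Du; have h2 := ip_CS HL Lf Lu; have h3 := coercive Du.
have f0 := ip_ge0 HL Lf.
move=> e.
have hz : ip (Z u) u <= 2^-1 * t u u.
  rewrite (le_trans (ler_norm _))// -ler_sqr ?nnegrE ?mulr_ge0//.
  by rewrite real_normK ?num_real//; lra.
suff h6 : t u u <= 4 * eps * ip f f.
  rewrite (le_trans h3)// [leRHS](_ : _ = eps * (4 * eps * ip f f)); last by ring.
  by rewrite ler_wpM2l// ltW.
have h4 : t u u <= 2 * ip f u by lra.
have h5 : t u u ^+ 2 <= 4 * (ip f f * (eps * t u u)).
  apply: (@le_trans _ _ ((2 * ip f u) ^+ 2)); first by rewrite ler_sqr ?nnegrE//; lra.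
  rewrite exprMn -natrX/= ler_wpM2l// (le_trans h2)// ler_wpM2l//.
move: T0; rewrite le_eqVlt => /predU1P[<-|T0]; first by rewrite !mulr_ge0// ltW.
by rewrite -(ler_pM2r T0) -expr2; lra.
Qed.

(** The added term moves to the right-hand side, where it is a combination of the [g j]; its
    coefficients [K * ip u (g j)] are the unknowns of the finite system. *)
Lemma operator_perturbed u f : L f ->
  operator_of u (Z u + f) <->
  D u /\ forall v, D v ->
    t u v = ip (Z u + (f + \sum_j (K * ip u (g j)) *: g j)) v.
Proof.
move=> Lf; have Ls := ph_sum HL (fun j => K * ip u (g j)) Lg.
have e v : D u -> D v -> ip (Z u + (f + \sum_j (K * ip u (g j)) *: g j)) v =
    ip (Z u + f) v + K * \sum_j ip u (g j) * ip v (g j).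
  move=> Du Dv; have Lv := DL Dv; have Lu := DL Du.
  have LZf : L (Z u + f) by apply: (phD HL) => //; exact: LZ.
  rewrite addrA (ipDl HL LZf)//; congr (_ + _).
  rewrite (ip_suml HL)// mulr_sumr; apply: eq_bigr => j _.
  by rewrite (ipC HL _ Lv)// mulrA.
split=> [[Du Lzf h]|[Du h]].
  by split=> // v Dv; rewrite e// /t h.
split=> //; first by apply: (phD HL) => //; apply: LZ; exact: DL.
by move=> v Dv; apply: (@addIr _ (K * \sum_j ip u (g j) * ip v (g j))); rewrite -e// -h.
Qed.

Let solution (P : 'I_n -> E) (c : 'I_n -> R) (f w : E) :
  (forall j, D (P j)) -> (forall j v, D v -> t (P j) v = ip (Z (P j) + g j) v) ->
  L f -> D w -> (forall v, D v -> t w v = ip (Z w + f) v) ->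
  D (w + \sum_j c j *: P j) /\ forall v, D v -> t (w + \sum_j c j *: P j) v =
    ip (Z (w + \sum_j c j *: P j) + (f + \sum_j c j *: g j)) v.
Proof.
move=> DP hP Lf Dw hw; have DcP := ph_sum HD c DP; split; first exact: (phD HD).
move=> v Dv; have Lv := DL Dv; have Lw := DL Dw; have LcP := DL DcP.
have Lcg := ph_sum HL c Lg.
rewrite ZD addrACA (ipDl Ht)// (ipDl HL)//; last 2 first.
- by apply: (phD HL) => //; exact: LZ.
- by apply: (phD HL) => //; exact: LZ.
rewrite hw//; congr (_ + _).
rewrite (ip_suml Ht)// (ipDl HL)//; last exact: LZ.
rewrite (ip_suml HL)//.
have -> : Z (\sum_j c j *: P j) = \sum_j c j *: Z (P j).
  have Z0 : Z 0 = 0 by rewrite -[X in Z X](scale0r (0 : E)) ZZ scale0r.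
  by rewrite (big_morph Z ZD Z0); apply: eq_bigr => j _; rewrite ZZ.
rewrite (ip_suml HL) => [|j|//]; last by apply: LZ; exact: DL.
rewrite -big_split/=; apply: eq_bigr => j _.
by rewrite hP// (ipDl HL) ?mulrDr//; apply: LZ; exact: DL.
Qed.

Let unique u w f : D u -> D w -> L f ->
  (forall v, D v -> t u v = ip (Z u + f) v) ->
  (forall v, D v -> t w v = ip (Z w + f) v) -> ip (u - w) (u - w) = 0.
Proof.
move=> Du Dw Lf hu hw; have Duw := phB HD Du Dw.
apply/le_anti; rewrite (ip_ge0 HL (DL Duw)) andbT.
rewrite (le_trans (perturbed_bound (f := 0) Duw _ _))//.
- exact: (ph0 HL).
- move=> v Dv; rewrite (ipBl Ht)// hu// hw// -scaleN1r ZD ZZ scaleN1r.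
  have Lv := DL Dv; have LZu := LZ (DL Du); have LZw := LZ (DL Dw).
  rewrite addr0 (ipDl HL)// (ipDl HL LZw)// (ipBl HL)//; ring.
- by rewrite (ip0l HL) ?mulr0//; exact: (ph0 HL).
Qed.

(* [u] solves [A u = Z u + f] iff, up to a null vector, [u = w_f + sum c_j P_j]
   where [c] solves a finite linear system with matrix [Q]. *)
Lemma finite_rank_reduction :
  (exists (k : nat) (e : 'I_k -> E), (forall i, operator_of (e i) (Z (e i))) /\
    forall u, operator_of u (Z u) -> exists a : 'I_k -> R,
      ip (u - \sum_i a i *: e i) (u - \sum_i a i *: e i) = 0) /\
  ((exists2 u, operator_of u (Z u) & ip u u != 0) \/
   ((forall f, L f -> exists u, operator_of u (Z u + f)) /\
    exists C, forall u f, L f -> operator_of u (Z u + f) ->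
      ip u u <= C * ip f f)).
Proof.
have /choice[P hP] : forall j, exists p, D p /\
    forall v, D v -> t p v = ip (Z p + g j) v.
  by move=> j; have [p Dp hp] := perturbed_solution (Lg j); exists p.
have DP j : D (P j) by case: (hP j).
have {}hP j v : D v -> t (P j) v = ip (Z (P j) + g j) v by case: (hP j) => _; exact.
have LP j : L (P j) by exact: DL.
(* The coefficients must be consistent: [c i = K * ip u (g i)] for u = w + sum of the c_j P_j. In
   row-vector form this reads c Q = K (ip w (g i))_i. *)
pose Q : 'M[R]_n := \matrix_(j, i) ((i == j)%:R - K * ip (P j) (g i)).
have cQ (c : 'rV[R]_n) i : (c *m Q) ord0 i =
    c ord0 i - K * ip (\sum_j c ord0 j *: P j) (g i).
  rewrite mxE (ip_suml HL)// mulr_sumr (bigD1 i)//= [Q _ _]mxE eqxx mulr1n mulrBr mulr1.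
  rewrite (eq_bigr (fun j => - (K * (c ord0 j * ip (P j) (g i))))); last first.
    by move=> j ji; rewrite [Q _ _]mxE eq_sym (negbTE ji) sub0r mulrN mulrCA.
  by rewrite sumrN [in RHS](bigD1 i)//= opprD addrA mulrCA.
have sol u f w : L f -> D w -> (forall v, D v -> t w v = ip (Z w + f) v) ->
  operator_of u (Z u + f) ->
  let c : 'rV[R]_n := \row_j (K * ip u (g j)) in
  let x := u - (w + \sum_j c ord0 j *: P j) in
  ip x x = 0 /\ c *m Q = \row_i (K * ip w (g i)).
  move=> Lf Dw hw /(operator_perturbed _ Lf)[Du hu] c x.
  have [Ds hs] := solution (c ord0) DP hP Lf Dw hw.
  have cE : \sum_j c ord0 j *: g j = \sum_j (K * ip u (g j)) *: g j.
    by apply: eq_bigr => j _; rewrite mxE.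
  have x0 : ip x x = 0.
    apply: (@unique _ _ (f + \sum_j c ord0 j *: g j)) => //.
      by apply: (phD HL) => //; exact: (ph_sum HL).
    by move=> v Dv; rewrite hu// cE.
  split=> //; apply/rowP => i; rewrite cQ !mxE.
  have Lx : L x by apply: DL; exact: (phB HD).
  have := ip_null HL Lx (Lg i) x0.
  rewrite /x (ipBl HL) ?(ipDl HL)//; try by apply: DL.
    by move=> e0; rewrite -mulrBr; congr (_ * _); lra.
  exact: (ph_sum HL).
have D0 : D 0 by exact: (ph0 HD).
have L0 : L 0 by exact: (ph0 HL).
have Z0 : Z 0 = 0 by rewrite -[X in Z X](scale0r (0 : E)) ZZ scale0r.
have h0 v : D v -> t 0 v = ip (Z 0 + 0) v.
  by move=> Dv; rewrite Z0 addr0 (ip0l Ht)// (ip0l HL)//; exact: DL.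
have ker (c : 'rV[R]_n) : c *m Q = 0 ->
    operator_of (\sum_j c ord0 j *: P j) (Z (\sum_j c ord0 j *: P j)).
  move=> c0; have [Ds hs] := solution (c ord0) DP hP L0 D0 h0.
  rewrite -[X in operator_of _ X]addr0.
  apply/operator_perturbed => //; rewrite add0r in Ds hs; split=> // v Dv.
  rewrite hs//; congr (ip (_ + (_ + _)) _); apply: eq_bigr => i _; congr (_ *: _).
  have /rowP/(_ i) := c0; rewrite cQ mxE => /eqP; rewrite subr_eq0 => /eqP.
  by [].
split.
  (* The rows of [kermx Q] generate the kernel; they may be linearly dependent, since only a
     spanning family is asked for. *)
  exists n, (fun i => \sum_j (row i (kermx Q)) ord0 j *: P j); split.
    by move=> i; apply: ker; rewrite -row_mul mulmx_ker row0.
  move=> u hu; have := sol u 0 0 L0 D0 h0; rewrite addr0 => /(_ hu)/= [].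
  rewrite add0r; set c : 'rV_n := \row__ _ => x0 cQ0.
  have {}cQ0 : c *m Q = 0.
    by rewrite cQ0; apply/rowP => i; rewrite !mxE (ip0l HL) ?mulr0.
  have /submxP[a ca] : (c <= kermx Q)%MS by apply/sub_kermxP.
  exists (a ord0); rewrite (_ : \sum_i _ = \sum_j c ord0 j *: P j)//.
  rewrite (eq_bigr (fun i => \sum_j (a ord0 i * kermx Q i j) *: P j)).
    rewrite exchange_big/=; apply: eq_bigr => j _.
    by rewrite -scaler_suml ca mxE.
  move=> i _; rewrite scaler_sumr; apply: eq_bigr => j _.
  by rewrite scalerA mxE.
(* For singular [Q], a nonzero kernel vector [c] gives a genuine eigenvector: [c i] equals [K] times
   the product of that vector with [g i], so a null vector would force [c = 0]. *)
have [uQ|nQ] := boolP (Q \in unitmx); last first.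
  left; have : kermx Q != 0 by rewrite kermx_eq0 row_free_unit.
  case/rowV0Pn => c /sub_kermxP c0 cn0; exists (\sum_j c ord0 j *: P j); first exact: ker.
  apply: contra cn0 => /eqP s0; apply/eqP/rowP => i.
  have Ls := ph_sum HL (c ord0) LP.
  have := cQ c i; rewrite c0 (ip_null HL Ls (Lg i) s0) mulr0 subr0 !mxE.
  by move=> <-.
right; split.
  move=> f Lf; have [w Dw hw] := perturbed_solution Lf.
  pose c : 'rV_n := (\row_i (K * ip w (g i))) *m invmx Q.
  have cQ1 : c *m Q = \row_i (K * ip w (g i)) by rewrite mulmxKV.
  have [Ds hs] := solution (c ord0) DP hP Lf Dw hw.
  exists (w + \sum_j c ord0 j *: P j); apply/operator_perturbed => //.
  split=> // v Dv; rewrite hs//; congr (ip (_ + (_ + _)) _).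
  apply: eq_bigr => i _; congr (_ *: _).
  have /rowP/(_ i) := cQ1; rewrite cQ mxE (ipDl HL)//; last first.
  - exact: (ph_sum HL).
  - exact: DL.
  by rewrite mulrDr => <-; ring.
(* [B] is the squared Frobenius norm of the inverse matrix. It bounds [c] in terms of [w], and
   [perturbed_bound] bounds [w] in terms of [f]. *)
pose B := \sum_j \sum_i (invmx Q i j) ^+ 2.
pose GG := \sum_i ip (g i) (g i).
pose PP := \sum_j ip (P j) (P j).
exists (2 * (2 * (4 * eps ^+ 2) + 2 * (K ^+ 2 * (4 * eps ^+ 2) * GG * B * PP))) => u f Lf hu.
have [w Dw hw] := perturbed_solution Lf.
have wb := perturbed_bound Dw Lf hw.
have [/=] := sol u f w Lf Dw hw hu.
set c : 'rV_n := \row__ _; set s := \sum_j _; set x := u - _ => x0 cQ1.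
have Du : D u by case: hu.
have Ds : D s by exact: (ph_sum HD).
have Ls := DL Ds; have Lw := DL Dw; have Lu := DL Du.
have Lx : L x by apply: DL; apply: (phB HD) => //; exact: (phD HD).
have cE : c = (\row_i (K * ip w (g i))) *m invmx Q by rewrite -cQ1 mulmxK.
have f0 := ip_ge0 HL Lf.
have B0 : 0 <= B by do 2 (apply: sumr_ge0 => ? _); exact: sqr_ge0.
have GG0 : 0 <= GG by apply: sumr_ge0 => ? _; exact: (ip_ge0 HL).
have PP0 : 0 <= PP by apply: sumr_ge0 => ? _; exact: (ip_ge0 HL).
have cb : \sum_j c ord0 j ^+ 2 <= K ^+ 2 * (4 * eps ^+ 2) * GG * B * ip f f.
  apply: (@le_trans _ _ (K ^+ 2 * (ip w w * GG) * B)); last first.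
    rewrite [leRHS](_ : _ = K ^+ 2 * (4 * eps ^+ 2 * ip f f * GG) * B); last by ring.
    by rewrite ler_wpM2r// ler_wpM2l ?sqr_ge0// ler_wpM2r.
  rewrite mulr_sumr; apply: ler_sum => j _.
  rewrite cE mxE (le_trans (sum_CS _ _))// ler_wpM2r//.
    by apply: sumr_ge0 => i _; exact: sqr_ge0.
  rewrite /GG !mulr_sumr; apply: ler_sum => i _.
  by rewrite mxE exprMn ler_wpM2l ?sqr_ge0// (ip_CS HL).
have sb : ip s s <= K ^+ 2 * (4 * eps ^+ 2) * GG * B * ip f f * PP.
  by rewrite (le_trans (ip_sqr_sum_le HL _ LP))// ler_wpM2r.
have wsb := ip_sqrD_le HL Lw Ls.
have uE : u = x + (w + s) by rewrite /x subrK.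
rewrite uE (le_trans (ip_sqrD_le HL Lx _))//; first exact: (phD HL).
by rewrite x0; lra.
Qed.

End perturbed.

Lemma fredholm_alternative :
  (exists (k : nat) (e : 'I_k -> E), (forall i, operator_of (e i) (Z (e i))) /\
    forall u, operator_of u (Z u) -> exists a : 'I_k -> R,
      ip (u - \sum_i a i *: e i) (u - \sum_i a i *: e i) = 0) /\
  ((exists2 u, operator_of u (Z u) & ip u u != 0) \/
   ((forall f, L f -> exists u, operator_of u (Z u + f)) /\
    exists C, forall u f, L f -> operator_of u (Z u + f) ->
      ip u u <= C * ip f f)).
Proof.
have [m m0 mZ] := Zb.
(* Chosen so that [4 * m * eps] and [eps] are both at most 1, whence [4 * m * eps ^+ 2 <= 1]. The
   weight [C / eps] below turns the finite-rank inequality into coercivity of the enlarged form. *)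
pose eps := (1 + 4 * m)^-1.
have eps0 : 0 < eps by rewrite invr_gt0 addr_gt0// mulr_gt0.
have eps1 : 4 * m * eps <= 1 by rewrite ler_pdivrMr ?addr_gt0 ?mulr_gt0//; lra.
have eps2 : eps <= 1 by rewrite invf_le1 ?addr_gt0 ?mulr_gt0//; lra.
have [n [g [C [C0 Lg hg]]]] := garding eps0.
apply: (@finite_rank_reduction eps (C / eps) m n g) => //.
- by rewrite divr_ge0// ltW.
- exact: ltW.
- by rewrite expr2 mulrA (le_trans _ eps2)// ler_piMl// ltW.
move=> u Du; rewrite (le_trans (hg u Du))//.
under eq_bigr do rewrite expr2.
by rewrite mulrDr [X in _ <= _ + X]mulrA [X in _ <= _ + X * _]mulrC divfK ?gt_eqF.
Qed.

(* Bessel's inequality bounds the trace of the finite-rank error term. *)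
Lemma orthonormal_bounded (M : R) : 0 <= M -> exists N : nat,
  forall n (u : 'I_n -> E), (forall i, D (u i)) ->
    (forall i j, ip (u i) (u j) = (i == j)%:R) -> (forall i, q (u i) (u i) <= M) ->
    (n <= N)%N.
Proof.
(* With this value each [u i] satisfies eps q(u_i, u_i) <= 1/2; summing over an orthonormal family
   of size n gives n <= n/2 + S, that is n <= 2 S. *)
move=> M0; have eps0 : 0 < (2 * (M + 1))^-1 by rewrite invr_gt0 mulr_gt0// ltr_wpDl.
have [k [g [C [C0 Lg hg]]]] := garding eps0.
pose S := C * \sum_j ip (g j) (g j).
have bessel n (u : 'I_n -> E) v : (forall i, L (u i)) -> L v ->
    (forall i j, ip (u i) (u j) = (i == j)%:R) ->
    \sum_i ip (u i) v ^+ 2 <= ip v v.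
  move=> Lu Lv ou; have Ls := ph_sum HL (fun i => ip (u i) v) Lu.
  have := ip_ge0 HL (phB HL Lv Ls); rewrite (ip_sqrB HL)//.
  have sE w : L w -> ip (\sum_i ip (u i) v *: u i) w = \sum_i ip (u i) v * ip (u i) w.
    by move=> Lw; rewrite (ip_suml HL).
  rewrite (ipC HL Lv)// !sE//.
  rewrite (eq_bigr (fun i => ip (u i) v ^+ 2)) => [|i _]; last by rewrite expr2.
  rewrite [X in _ + X](eq_bigr (fun i => ip (u i) v ^+ 2)); first lra.
  move=> i _; rewrite (ipC HL (Lu i) Ls) sE// (bigD1 i)//=.
  rewrite ou eqxx mulr1 big1 ?addr0 ?expr2// => j /negPf ji.
  by rewrite ou ji mulr0.
exists (Num.trunc (2 * S)) => n u Du ou qu.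
have Lu i : L (u i) by exact: DL.
have h : n%:R <= 2^-1 * n%:R + S.
  have -> : n%:R = \sum_(i < n) (1 : R) by rewrite sumr_const card_ord.
  rewrite mulr_sumr /S mulr_sumr.
  apply: (@le_trans _ _ (\sum_(i < n) (2^-1 * 1 + C * \sum_j ip (u i) (g j) ^+ 2))).
    apply: ler_sum => i _; have := hg _ (Du i); rewrite ou eqxx => h.
    rewrite (le_trans h)// lerD2r.
    rewrite mulr1 -[leRHS](_ : (2 * (M + 1))^-1 * (M + 1) = _); last first.
      by rewrite invfM -mulrA mulVf ?mulr1// gt_eqF// ltr_wpDl.
    by rewrite ler_wpM2l ?(ltW eps0)// (le_trans (qu i))// lerDl.
  rewrite big_split/= lerD2l -mulr_sumr exchange_big/= mulr_sumr.
  by apply: ler_sum => j _; rewrite ler_wpM2l// bessel.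
have S0 : 0 <= S by rewrite mulr_ge0// sumr_ge0// => j _; exact: (ip_ge0 HL).
rewrite truncn_ge_nat; last by rewrite mulr_ge0.
by move: h; move: (n%:R) => x; lra.
Qed.

End fredholm.

(** * Pairs of real vectors *)

Section product.
Context {R : realType} {E : lmodType R}.
Implicit Types (L : set E) (ip : E -> E -> R).

Definition pair_set L : set (E * E) := [set u | L u.1 /\ L u.2].

Definition pair_form ip (u v : E * E) : R := ip u.1 v.1 + ip u.2 v.2.

Lemma prehilbert_pair L ip : prehilbert L ip ->
  prehilbert (pair_set L) (pair_form ip).
Proof.
move=> H; split.
- by split; exact: (ph0 H).
- by move=> u v [? ?] [? ?]; split; apply: (phD H).
- by move=> a u [? ?]; split; apply: (phZ H).
- by move=> u v [? ?] [? ?]; rewrite /pair_form (ipC H)// (ipC H (u := u.2)).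
- move=> u v w [? ?] [? ?] [? ?].
  by rewrite /pair_form !(ipDl H)// addrACA.
- by move=> a u v [? ?] [? ?]; rewrite /pair_form !(ipZl H)// mulrDr.
- by move=> u [? ?]; rewrite addr_ge0// (ip_ge0 H).
Qed.

Lemma complete_pair L ip : prehilbert L ip -> complete_in L ip ->
  complete_in (pair_set L) (pair_form ip).
Proof.
move=> H cL u_ Lu cu.
have Lu1 n : L (u_ n).1 by case: (Lu n).
have Lu2 n : L (u_ n).2 by case: (Lu n).
have [] := cL (fun n => (u_ n).1) Lu1.
  move=> e /cu[N hN]; exists N => m n Nm Nn; apply: le_trans (hN m n Nm Nn).
  by rewrite lerDl (ip_ge0 H)//; exact: (phB H).
move=> v1 Lv1 h1.
have [] := cL (fun n => (u_ n).2) Lu2.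
  move=> e /cu[N hN]; exists N => m n Nm Nn; apply: le_trans (hN m n Nm Nn).
  by rewrite lerDr (ip_ge0 H)//; exact: (phB H).
move=> v2 Lv2 h2; exists (v1, v2) => // e e0.
have e2 : 0 < e / 2 by rewrite divr_gt0.
have [N1 {}h1] := h1 _ e2; have [N2 {}h2] := h2 _ e2.
exists (maxn N1 N2) => n; rewrite geq_max => /andP[/h1 {}h1 /h2 {}h2].
by rewrite (splitr e) lerD.
Qed.

Lemma garding_pair L D ip q : prehilbert L ip -> D `<=` L ->
  finite_rank_garding L D ip q ->
  finite_rank_garding (pair_set L) (pair_set D) (pair_form ip) (pair_form q).
Proof.
move=> H DL h eps /h[n [g [C [C0 Lg {}h]]]].
(* Each [g j] appears once per component; the pair (g j, g j) would control only the sum of the two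
   coefficients. *)
pose G (i : 'I_(n + n)) : E * E :=
  match fintype.split i with inl j => (g j, 0) | inr j => (0, g j) end.
exists (n + n)%N, G, C; split=> //.
  move=> i; rewrite /G; case: (fintype.split i) => j; split; rewrite //=; exact: (ph0 H).
move=> u [D1 D2]; have L1 := DL _ D1; have L2 := DL _ D2.
rewrite big_split_ord/= /G.
rewrite [X in C * (X + _)](eq_bigr (fun j => ip u.1 (g j) ^+ 2)); last first.
  move=> j _; rewrite -[lshift _ _]/(unsplit (inl j)) unsplitK /pair_form/=.
  by rewrite (ipC H L2 (ph0 H)) (ip0l H)// addr0.
rewrite [X in C * (_ + X)](eq_bigr (fun j => ip u.2 (g j) ^+ 2)); last first.
  move=> j _; rewrite -[rshift _ _]/(unsplit (inr j)) unsplitK /pair_form/=.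
  by rewrite (ipC H L1 (ph0 H)) (ip0l H)// add0r.
by rewrite /pair_form !mulrDr addrACA lerD// h.
Qed.

End product.

(** * Boxes, translation invariance and Borel sets in R^d *)

Section euclidean_measure.
Context {R : realType} {d : nat}.
Local Notation mu := (mes R d).
Implicit Types (a b t x y : 'rV[R]_d).

Definition box a b : set 'rV[R]_d :=
  [set x | forall i, a ord0 i < x ord0 i <= b ord0 i].

(** No order between [a] and [b] is required, so that the intersection of two disjoint boxes is
    still a box and boxes form a pi-system. *)
Definition boxes : set (set 'rV[R]_d) := [set A | exists a b, A = box a b].

Lemma measurable_box a b : measurable (box a b).
Proof.
rewrite (_ : box a b = \bigcap_(i : 'I_d)
   ((fun x : 'rV[R]_d => x ord0 i) @^-1` `]a ord0 i, b ord0 i]%classic)).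
  apply: fin_bigcap_measurable => // i _.
  by rewrite -[X in measurable X]setTI; exact: measurable_coord.
apply/seteqP; split=> x /= h i; first by move=> _; rewrite /= in_itv; exact: h.
by have := h i I; rewrite /= in_itv.
Qed.

Lemma box_set0 a b : ~ (forall i, a ord0 i <= b ord0 i) -> box a b = set0.
Proof.
move=> ab; apply/seteqP; split=> // x /= h; apply: ab => i.
by have /andP[/ltW h1 h2] := h i; exact: le_trans h1 h2.
Qed.

Lemma setI_closed_boxes : setI_closed boxes.
Proof.
move=> _ _ [a [b ->]] [a' [b' ->]].
exists (\row_i Num.max (a ord0 i) (a' ord0 i)), (\row_i Num.min (b ord0 i) (b' ord0 i)).
apply/seteqP; split=> [x [h h'] i|x h]; rewrite /= ?mxE.
  have /andP[h1 h2] := h i; have /andP[h1' h2'] := h' i.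
  by rewrite gt_max le_min h1 h2 h1' h2'.
by split=> i; have := h i; rewrite !mxE gt_max le_min => /andP[/andP[? ?] /andP[? ?]]; apply/andP.
Qed.

Lemma measurable_boxesE : @measurable _ 'rV[R]_d = <<s boxes >>.
Proof.
apply/seteqP; split; last first.
  apply: smallest_sub; first exact: sigma_algebra_measurable.
  by move=> _ [a [b ->]]; exact: measurable_box.
apply: smallest_sub; first exact: smallest_sigma_algebra.
rewrite -bigcup_seq; apply: bigcup_sub => i _ B [C mC <-].
suff h : @measurable_fun _ _ (g_sigma_algebraType boxes) R setT
    (fun x : 'rV[R]_d => x ord0 i) by exact: h.
apply: (measurability _ (RGenOInfty.measurableE R)) => _ [_ [c ->] <-].
rewrite setTI.
rewrite (_ : _ @^-1` _ = \bigcup_n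
  box (\row_j if j == i then c else - n%:R) (\row_j n%:R)).
  apply: bigcup_measurable => n _; apply: sub_sigma_algebra.
  by eexists; eexists; reflexivity.
apply/seteqP; split=> [x /=|x [n _ /(_ i)]]; last first.
  by rewrite !mxE eqxx /= in_itv/= andbT => /andP[].
rewrite in_itv/= andbT => cx.
pose M := \sum_j `|x ord0 j|.
have xM j : `|x ord0 j| <= M by rewrite /M (bigD1 j)//= lerDl sumr_ge0.
exists (Num.trunc M).+1 => // j; rewrite !mxE.
have hM : M < (Num.trunc M).+1%:R by exact: truncnS_gt.
have := xM j; rewrite ler_norml => /andP[h1 h2].
apply/andP; split; last by rewrite ltW// (le_lt_trans h2).
case: eqP => [->//|_].
by rewrite (lt_le_trans _ h1)// ltrN2.
Qed.

Lemma boxes_cover : \bigcup_n box (const_mx (- n%:R)) (const_mx n%:R) = setT.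
Proof.
apply/seteqP; split=> // x _.
pose M := \sum_j `|x ord0 j|.
have xM j : `|x ord0 j| <= M by rewrite /M (bigD1 j)//= lerDl sumr_ge0.
exists (Num.trunc M).+1 => // j; rewrite !mxE.
have hM : M < (Num.trunc M).+1%:R by exact: truncnS_gt.
have := xM j; rewrite ler_norml => /andP[h1 h2].
by rewrite (lt_le_trans _ h1) ?ltrN2//= ltW// (le_lt_trans h2).
Qed.

Lemma mes_box_lty a b : (mu (box a b) < +oo)%E.
Proof.
have [ab|ab] := pselect (forall i, a ord0 i <= b ord0 i).
  by rewrite [X in (X < _)%E](mes_box ab) ltry.
by rewrite box_set0// measure0.
Qed.

(** Boxes are a generating pi-system, exhausted by cubes of finite measure, so the uniqueness
    theorem for measures applies. *)
Lemma eq_mes_of_boxes (m : {measure set 'rV[R]_d -> \bar R}) :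
  (forall a b, m (box a b) = mu (box a b)) ->
  forall A, measurable A -> m A = mu A.
Proof.
move=> h A mA.
apply: (measure_unique boxes (fun n => box (const_mx (- n%:R)) (const_mx n%:R))) => //.
- exact: measurable_boxesE.
- exact: setI_closed_boxes.
- by move=> i; eexists; eexists; reflexivity.
- exact: boxes_cover.
- by move=> _ [a [b ->]].
- by move=> k; rewrite h mes_box_lty.
Qed.

Lemma measurable_addr t : measurable_fun setT (fun x => x + t).
Proof.
apply: measurable_rV => i.
under eq_fun do rewrite mxE.
by apply: measurable_funD => //; exact: measurable_coord.
Qed.

Lemma measurable_add2 d' (T : measurableType d') (f g : T -> 'rV[R]_d) :
  measurable_fun setT f -> measurable_fun setT g ->
  measurable_fun setT (fun x : T => f x + g x).
Proof.
move=> mf mg; apply: measurable_rV => i.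
under eq_fun do rewrite mxE.
by apply: measurable_funD; [exact: (measurableT_comp (measurable_coord i) mf)|
  exact: (measurableT_comp (measurable_coord i) mg)].
Qed.

Lemma mes_translate t A : measurable A ->
  mu ((fun x => x + t) @^-1` A) = mu A.
Proof.
move=> mA; rewrite -[LHS]/(pushforward mu (fun x => x + t) A).
have mt := measurable_addr t.
pose f : {mfun 'rV[R]_d >-> 'rV[R]_d} := mfun_Sub (mem_set mt).
apply: (@eq_mes_of_boxes (pushforward mu f)) => // a b.
change (mu ((fun x => x + t) @^-1` box a b) = mu (box a b)).
have -> : (fun x => x + t) @^-1` box a b = box (a - t) (b - t).
  apply/seteqP; split=> x /= h i; have := h i; rewrite !mxE.
    by rewrite ltrBlDr lerBrDr.
  by rewrite ltrBlDr lerBrDr.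
have [ab|ab] := pselect (forall i, a ord0 i <= b ord0 i); last first.
  rewrite !box_set0// => h; apply: ab => i; have := h i.
  by rewrite !mxE lerD2r.
rewrite [LHS]mes_box ?[RHS]mes_box//; last by move=> i; rewrite !mxE lerD2r.
congr EFin; apply: eq_bigr => i _; rewrite !mxE; ring.
Qed.

Lemma ge0_integral_translate t (f : 'rV[R]_d -> \bar R) :
  measurable_fun setT f -> (forall x, (0 <= f x)%E) ->
  (\int[mu]_x f (x + t)%R = \int[mu]_x f x)%E.
Proof.
move=> mf f0; have mt := measurable_addr t.
transitivity (\int[pushforward mu (fun x => (x + t)%R)]_x f x)%E.
  by rewrite ge0_integral_pushforward.
by apply: eq_measure_integral => A mA _; exact: mes_translate.
Qed.

Lemma integral_translate t (f : 'rV[R]_d -> \bar R) :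
  measurable_fun setT f ->
  (\int[mu]_x f (x + t)%R = \int[mu]_x f x)%E.
Proof.
move=> mf; rewrite integralE [RHS]integralE; congr (_ - _)%E.
  rewrite -[RHS](ge0_integral_translate t)//; last exact: measurable_funepos.
  by apply: eq_integral => x _; rewrite !funeposE.
rewrite -[RHS](ge0_integral_translate t)//; last exact: measurable_funeneg.
by apply: eq_integral => x _; rewrite !funenegE.
Qed.

(** The sigma-algebra is generated by the coordinates rather than by the topology; an open set is
    the union of the countably many rational boxes that it contains. *)
Lemma measurable_open_rV (A : set 'rV[R]_d) : open A -> measurable A.
Proof.
move=> oA.
pose B (p : 'rV[rat]_d * 'rV[rat]_d) : set 'rV[R]_d :=
  [set x | forall i, ratr (p.1 ord0 i) < x ord0 i <= ratr (p.2 ord0 i)].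
pose F p := if `[< B p `<=` A >] then B p else set0.
have -> : A = \bigcup_p F p.
  apply/seteqP; split=> [x Ax|x [p _]]; last first.
    by rewrite /F; case: asboolP => // h /h.
  have /nbhs_ballP[e /= e0 eA] : nbhs x A by exact: open_nbhs_nbhs.
  have h i : exists q : rat * rat, (x ord0 i - e < ratr q.1 < x ord0 i) /\
      (x ord0 i < ratr q.2 < x ord0 i + e).
    have [|q1] := @rat_in_itvoo R (x ord0 i - e) (x ord0 i); first by rewrite ltrBlDr ltrDl.
    have [|q2] := @rat_in_itvoo R (x ord0 i) (x ord0 i + e); first by rewrite ltrDl.
    by rewrite !in_itv/= => h2 h1; exists (q1, q2).
  have [q hq] := choice h.
  exists (\row_i (q i).1, \row_i (q i).2) => //.
  rewrite /F asboolT.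
    move=> i; rewrite /= !mxE; have [/andP[_ ->] /andP[h2 _]] := hq i.
    exact: ltW.
  move=> y hy; apply: eA; split=> // i j; rewrite ord1.
  have := hy j; rewrite /= !mxE => /andP[h1 h2].
  have [/andP[h3 _] /andP[_ h4]] := hq j.
  rewrite /ball/= ltr_norml; apply/andP; split; lra.
apply: countable_bigcupT_measurable; first exact: countableP.
move=> p; rewrite /F; case: asboolP => // _.
rewrite (_ : B p = box (\row_i ratr (p.1 ord0 i)) (\row_i ratr (p.2 ord0 i))).
  exact: measurable_box.
by apply/seteqP; split=> x h i; have := h i; rewrite !mxE.
Qed.

Lemma measurable_closed_rV (A : set 'rV[R]_d) : closed A -> measurable A.
Proof.
move=> cA; rewrite -[A]setCK; apply: measurableC; apply: measurable_open_rV.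
exact: closed_openC.
Qed.

Lemma continuous_measurable_rV (f : 'rV[R]_d -> R) : continuous f ->
  measurable_fun setT f.
Proof.
move=> /continuousP cf.
apply: (measurability _ (RGenOInfty.measurableE R)) => _ [_ [c ->] <-].
by rewrite setTI; apply: measurable_open_rV; apply: cf; exact: interval_open.
Qed.

End euclidean_measure.

(** * The real space L_2: almost everywhere convergence and completeness *)

Section real_L2.
Context d (T : measurableType d) {R : realType}.
Variable mu : {measure set T -> \bar R}.
Implicit Types f g : T -> R.

Definition L2r : set (T -> R) :=
  [set f : T -> R | measurable_fun setT f /\ (\int[mu]_x (f x ^+ 2)%:E < +oo)%E].

Definition ipr f g : R := \int[mu]_x (f x * g x).

Lemma L2rP f : f \in Lfun mu 2%:E <-> L2r f.
Proof.
split=> [f2|[mf f2]].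
  have /integrableP[_] := Lfun2_integrable_sqr f2.
  move: f2; rewrite inE => /andP[/[!inE]/= mf _] h; split=> //.
  by apply: le_lt_trans h; apply: ge0_le_integral => //= [x _|||x _];
    rewrite ?lee_fin ?sqr_ge0//; [apply/measurable_EFinP; exact: measurable_funX|
    apply/measurable_EFinP; apply: measurableT_comp => //; exact: measurable_funX|
    exact: ler_norm].
rewrite inE; apply/andP; split; rewrite inE//=.
rewrite /finite_norm unlock poweR_lty//.
rewrite (le_lt_trans _ f2)//; apply: ge0_le_integral => //=.
- apply/measurable_EFinP; apply: (measurableT_comp (measurable_powR _)).
  exact: measurableT_comp.
- by apply/measurable_EFinP; exact: measurable_funX.
- by move=> x _; rewrite lee_fin powR_mulrn// real_normK// num_real.
Qed.

Lemma L2r_mul_integrable f g : L2r f -> L2r g ->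
  mu.-integrable setT (EFin \o (fun x => f x * g x)).
Proof.
move=> /L2rP f2 /L2rP g2; apply/Lfun1_integrable.
exact: Lfun2_mul_Lfun1.
Qed.

Lemma L2r0 : L2r 0.
Proof.
split; first exact: measurable_cst.
by under eq_integral do rewrite expr0n/=; rewrite integral0 ltry.
Qed.

Lemma L2rZ a f : L2r f -> L2r (a *: f).
Proof.
move=> [mf f2]; split; first exact: measurable_funM.
under eq_integral do rewrite exprMn EFinM.
rewrite ge0_integralZl_EFin ?sqr_ge0//; last 2 first.
- by move=> x _; rewrite lee_fin sqr_ge0.
- by apply/measurable_EFinP; exact: measurable_funX.
by rewrite lte_mul_pinfty ?lee_fin ?sqr_ge0.
Qed.

Lemma L2rD f g : L2r f -> L2r g -> L2r (f + g).
Proof.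
move=> [mf f2] [mg g2]; split; first exact: measurable_funD.
apply: (@le_lt_trans _ _ (\int[mu]_x (2%:E * (f x ^+ 2)%:E + 2%:E * (g x ^+ 2)%:E))%E).
  apply: ge0_le_integral => //=.
  - by move=> x _; rewrite lee_fin sqr_ge0.
  - by apply/measurable_EFinP; apply: measurable_funX; exact: measurable_funD.
  - by apply: emeasurable_funD; apply: measurable_funeM;
      apply/measurable_EFinP; exact: measurable_funX.
  - move=> x _; rewrite -!EFinM -EFinD lee_fin.
    by have -> : (f + g) x = f x + g x by []; have := sqr_ge0 (f x - g x); nra.
rewrite ge0_integralD//; last 4 first.
- by move=> x _; rewrite mule_ge0// lee_fin sqr_ge0.
- by apply: measurable_funeM; apply/measurable_EFinP; exact: measurable_funX.
- by move=> x _; rewrite mule_ge0// lee_fin sqr_ge0.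
- by apply: measurable_funeM; apply/measurable_EFinP; exact: measurable_funX.
rewrite !ge0_integralZl_EFin//; try by [move=> x _; rewrite lee_fin sqr_ge0|
  apply/measurable_EFinP; exact: measurable_funX].
by rewrite lte_add_pinfty// lte_mul_pinfty.
Qed.

Lemma ipr_sqr f : L2r f -> (ipr f f)%:E = (\int[mu]_x (f x ^+ 2)%:E)%E.
Proof.
move=> f2; rewrite /ipr /Rintegral fineK; first by apply: eq_integral => x _; rewrite expr2.
exact: (integrable_fin_num measurableT (L2r_mul_integrable f2 f2)).
Qed.

Lemma prehilbert_L2r : prehilbert L2r ipr.
Proof.
split.
- exact: L2r0.
- exact: L2rD.
- by move=> a f; exact: L2rZ.
- by move=> f g _ _; apply: eq_Rintegral => x _; rewrite mulrC.
- move=> f g h f2 g2 h2; rewrite /ipr -RintegralD//; last 2 first.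
  + exact: L2r_mul_integrable.
  + exact: L2r_mul_integrable.
  by apply: eq_Rintegral => x _; rewrite mulrDl.
- move=> a f g f2 g2; rewrite /ipr -RintegralZl//; last exact: L2r_mul_integrable.
  by apply: eq_Rintegral => x _; rewrite -[(a *: f) x]/(a * f x) mulrA.
- by move=> f f2; apply: Rintegral_ge0 => x _; rewrite -expr2 sqr_ge0.
Qed.

Lemma ipr_eq0 f : L2r f -> ipr f f = 0 -> {ae mu, forall x, f x = 0}.
Proof.
move=> f2 f0; have [mf _] := f2.
have : (\int[mu]_x `|(f x ^+ 2)%:E|)%E = 0%E.
  transitivity (\int[mu]_x (f x ^+ 2)%:E)%E.
    by apply: eq_integral => x _; rewrite gee0_abs// lee_fin sqr_ge0.
  by rewrite -ipr_sqr// f0.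
move/ae_eq_integral_abs => -[//||N [mN N0 hN]].
  by apply/measurable_EFinP; exact: measurable_funX.
exists N; split=> //; apply: subset_trans hN => x /= h1 h2; apply: h1.
by have /(_ I)[] := h2 => /eqP; rewrite sqrf_eq0 => /eqP.
Qed.

Lemma ae_eq0_ipr f g : L2r f -> {ae mu, forall x, f x = 0} -> L2r g -> ipr f g = 0.
Proof.
move=> f2 f0 g2; rewrite /ipr /Rintegral.
rewrite (ae_eq_integral (cst 0%E))//.
- by rewrite integral0.
- by case: f2 g2 => mf _ [mg _]; apply/measurable_EFinP; exact: measurable_funM.
- by apply: filterS f0 => x /= -> _; rewrite mul0r.
Qed.

(* The weights 4^k make the bound summable against the rate 8^-k while still
   forcing [h k x = O(2^-k)] pointwise. *)
Lemma ae_fast_decay (h : nat -> T -> R) : (forall k, measurable_fun setT (h k)) ->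
  (forall k, (\int[mu]_x (h k x ^+ 2)%:E <= (8^-1 ^+ k)%:E)%E) ->
  {ae mu, forall x, exists S : R, forall k, 4 ^+ k * h k x ^+ 2 <= S}.
Proof.
move=> mh hb.
pose F k x := (4 ^+ k * h k x ^+ 2)%:E.
have F0 k x : (0 <= F k x)%E by rewrite lee_fin mulr_ge0 ?sqr_ge0 ?exprn_ge0//.
have mF k : measurable_fun setT (F k).
  apply/measurable_EFinP; apply: measurable_funM => //; exact: measurable_funX.
have iF k : (\int[mu]_x F k x <= (2^-1 ^+ k)%:E)%E.
  under eq_integral do rewrite /F EFinM.
  rewrite ge0_integralZl_EFin ?exprn_ge0//; last 2 first.
  - by move=> x _; rewrite lee_fin sqr_ge0.
  - by apply/measurable_EFinP; exact: measurable_funX.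
  apply: (@le_trans _ _ ((4 ^+ k)%:E * (8^-1 ^+ k)%:E)%E).
    by rewrite lee_wpmul2l// lee_fin exprn_ge0.
  rewrite -EFinM -exprMn lee_fin.
  by rewrite (_ : 4 * 8^-1 = 2^-1) //; lra.
have sumF : (\int[mu]_x (\sum_(k <oo) F k x) < +oo)%E.
  rewrite integral_nneseries//.
  apply: (@le_lt_trans _ _ 2%:E); last exact: ltry.
  apply: lime_le; first by apply: is_cvg_ereal_nneg_natsum => k _; exact: integral_ge0.
  apply: nearW => n /=.
  apply: (@le_trans _ _ (\sum_(0 <= k < n) (2^-1 ^+ k)%:E)%E); first exact: lee_sum.
  rewrite sumEFin lee_fin.
  suff -> : \sum_(0 <= k < n) 2^-1 ^+ k = 2 - 2 * 2^-1 ^+ n :> R.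
    by rewrite gerBl mulr_ge0// exprn_ge0// invr_ge0.
  elim: n => [|n ih]; first by rewrite big_nil expr0 mulr1 subrr.
  by rewrite big_nat_recr//= ih exprS; lra.
have : mu.-integrable setT (fun x => \sum_(k <oo) F k x)%E.
  apply/integrableP; split.
    by apply: ge0_emeasurable_sum => //.
  apply: le_lt_trans sumF; rewrite le_eqVlt; apply/orP; left; apply/eqP.
  by apply: eq_integral => x _; rewrite gee0_abs// nneseries_ge0.
move/(integrable_ae measurableT); apply: filterS => x /(_ I) Sx.
exists (fine (\sum_(k <oo) F k x)%E) => k.
rewrite -lee_fin fineK//.
apply: le_trans (nneseries_lim_ge k.+1 _); last by move=> n _ _; exact: F0.
by rewrite big_nat_recr//= leeDr// sume_ge0.
Qed.

(** Carries Cauchy bounds over to almost everywhere limits: with weight 1 for the completeness of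
    L_2, with weight W^2 for the completeness of the form domain. *)
Lemma fatou_weighted (W : T -> R) (w : nat -> T -> R) (w0 : T -> R) (c : \bar R) :
  measurable_fun setT W -> (forall x, 0 <= W x) ->
  (forall k, measurable_fun setT (w k)) -> measurable_fun setT w0 ->
  {ae mu, forall x, w ^~ x @ \oo --> w0 x} ->
  (exists N, forall k, (N <= k)%N -> (\int[mu]_x (W x * w k x ^+ 2)%:E <= c)%E) ->
  (\int[mu]_x (W x * w0 x ^+ 2)%:E <= c)%E.
Proof.
move=> mW W0 mw mw0 cw [N hN].
pose F k x := (W x * w k x ^+ 2)%:E.
have mF k : measurable_fun setT (F k).
  by apply/measurable_EFinP; apply: measurable_funM => //; exact: measurable_funX.
have F0 k x : (0 <= F k x)%E by rewrite lee_fin mulr_ge0// sqr_ge0.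
have ml : measurable_fun setT (fun x => limn_einf (F ^~ x)).
  have : measurable_fun setT (fun x => limn_esup (fun k => - F k x)%E).
    by apply: measurable_fun_limn_esup => k; exact: measurableT_comp.
  move=> h; rewrite (_ : (fun _ => _) = (fun x => - limn_esup (fun k => - F k x))%E)//.
  exact: measurableT_comp.
apply: (@le_trans _ _ (\int[mu]_x limn_einf (F ^~ x))%E).
  rewrite (ae_eq_integral (fun x => limn_einf (F ^~ x)))//.
    by apply/measurable_EFinP; apply: measurable_funM => //; exact: measurable_funX.
  apply: filterS cw => x /= cx _.
  have /cvg_limn_einf_sup[-> _]// : F ^~ x @ \oo --> (W x * w0 x ^+ 2)%:E.
  apply: cvg_EFin; first exact: nearW.
  by apply: cvgM; [exact: cvg_cst|under eq_fun do rewrite expr2; rewrite expr2; exact: cvgM].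
apply: (le_trans (fatou mu measurableT mF (fun k x _ => F0 k x))).
rewrite limn_einf_lim; apply: lime_le; first exact: is_cvg_einfs.
apply: nearW => n; apply: le_trans (hN (maxn N n) (leq_maxl _ _)).
by apply: ereal_inf_lbound; exists (maxn N n) => //=; exact: leq_maxr.
Qed.

Lemma cvg_of_fast (u : nat -> R) (S l : R) :
  (forall k, 4 ^+ k * (u k - l) ^+ 2 <= S) -> u @ \oo --> l.
Proof.
move=> h; apply/cvgrPdist_le => e e0.
have S0 : 0 <= S by apply: le_trans (h 0%N); rewrite expr0 mul1r sqr_ge0.
near=> k.
rewrite distrC -ler_sqr ?nnegrE ?(ltW e0)// real_normK ?num_real//.
have k4 : 0 < 4 ^+ k :> R by rewrite exprn_gt0.
rewrite -(ler_pM2l k4) (le_trans (h k))// -ler_pdivrMr ?exprn_gt0//.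
have : S / e ^+ 2 <= k%:R by near: k; exact: nbhs_infty_ger.
move/le_trans; apply.
rewrite -natrX ler_nat ltnW//; exact: ltn_expl.
Unshelve. all: by end_near. Qed.

Lemma L2r_cvg_subseq (u_ : nat -> T -> R) (u : T -> R) :
  (forall n, L2r (u_ n)) -> L2r u -> cvg_in ipr u_ u ->
  exists2 phi : nat -> nat, (forall k, (k <= phi k)%N) &
    {ae mu, forall x, (fun k => u_ (phi k) x) @ \oo --> u x}.
Proof.
move=> Lu_ Lu uu; have H := prehilbert_L2r.
have /choice[phi hphi] : forall k : nat, exists n, (k <= n)%N /\
    (\int[mu]_x ((u_ n - u) x ^+ 2)%:E <= (8^-1 ^+ k)%:E)%E.
  move=> k; have [|N hN] := uu (8^-1 ^+ k); first by rewrite exprn_gt0.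
  exists (maxn k N); split; first exact: leq_maxl.
  by rewrite -ipr_sqr ?lee_fin ?hN ?leq_maxr//; exact: (phB H).
exists phi => [k|]; first by case: (hphi k).
have := @ae_fast_decay (fun k => u_ (phi k) - u).
case=> [k|k|N [mN N0 hN]].
- by have [] := phB H (Lu_ (phi k)) Lu.
- by case: (hphi k).
exists N; split=> //; apply: subset_trans hN => x /= h1 [S hS]; apply: h1.
exact: (cvg_of_fast hS).
Qed.

Lemma complete_L2r : complete_in L2r ipr.
Proof.
move=> u_ Lu_ cu; have H := prehilbert_L2r.
have /choice[N hN] : forall k : nat, exists N, forall m n, (N <= m)%N -> (N <= n)%N ->
    ipr (u_ m - u_ n) (u_ m - u_ n) <= 8^-1 ^+ k.
  by move=> k; apply: cu; rewrite exprn_gt0.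
(* [phi] dominates [N], so consecutive terms are 8^-k close, and [phi k] is at least k - 1, so the
   subsequence eventually passes every index. *)
pose phi := fix f k := match k with 0 => N 0%N | k'.+1 => maxn (maxn (f k').+1 (N k'.+1)) k' end.
have Nphi k : (N k <= phi k)%N.
  by case: k => //= k; rewrite leq_max leq_max leqnn orbT.
have phiS k : (phi k <= phi k.+1)%N by rewrite /= leq_max leq_max leqnSn.
have phik k : (k <= (phi k).+1)%N.
  by case: k => //= k; rewrite ltnS leq_max leqnn orbT.
pose v k := u_ (phi k).
have Lv k : L2r (v k) := Lu_ (phi k).
have mv k : measurable_fun setT (v k) by case: (Lv k).
have vb k : (\int[mu]_x ((v k.+1 - v k) x ^+ 2)%:E <= (8^-1 ^+ k)%:E)%E.
  rewrite -ipr_sqr; last exact: (phB H).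
  by rewrite lee_fin hN// (leq_trans (Nphi k)).
(* The limsup is defined and measurable everywhere, even where the sequence diverges; [fine]
   replaces infinite values by 0. *)
pose u x := fine (limn_esup (fun n => (v n x)%:E)).
have mu_ : measurable_fun setT u.
  apply: measurableT_comp => //; apply: measurable_fun_limn_esup => n.
  exact/measurable_EFinP.
have vu : {ae mu, forall x, v ^~ x @ \oo --> u x}.
  have := @ae_fast_decay (fun k => v k.+1 - v k).
  case=> [k|k|M [mM M0 hM]].
  - by have [] := phB H (Lv k.+1) (Lv k).
  - exact: vb.
  exists M; split=> //; apply: subset_trans hM => x /= h1 [S hS]; apply: h1.
  suff /cvg_ex[l vl] : cvgn (v ^~ x).
    rewrite (_ : u x = l)// /u.
    have /cvg_limn_einf_sup[_ ->]// : (fun n => (v n x)%:E) @ \oo --> l%:E.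
    by apply: cvg_EFin => //; exact: nearW.
  have S0 : 0 <= S by apply: le_trans (hS 0%N); rewrite expr0 mul1r sqr_ge0.
  have vE : v ^~ x = fun n => v 0%N x + series (fun k => v k.+1 x - v k x) n.
    apply/funext => n; rewrite /series/=; elim: n => [|n ih].
      by rewrite big_nil addr0.
    by rewrite big_nat_recr//= addrA -ih; ring.
  rewrite vE; apply: is_cvgD; first exact: is_cvg_cst.
  apply: normed_cvg.
  apply: (@series_le_cvg _ _ (geometric (Num.sqrt S) 2^-1)) => [n|n|n|].
  - exact: normr_ge0.
  - by rewrite /= mulr_ge0// ?sqrtr_ge0// exprn_ge0// invr_ge0.
  - rewrite /= -ler_sqr ?nnegrE ?mulr_ge0 ?sqrtr_ge0 ?exprn_ge0 ?invr_ge0//.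
    rewrite real_normK ?num_real// exprMn sqr_sqrtr// -exprM mulnC exprM.
    rewrite exprVn (_ : 2 ^+ 2 = 4 :> R); last by ring.
    rewrite exprVn ler_pdivlMr ?exprn_gt0// mulrC; exact: hS.
  - apply: is_cvg_geometric_series; rewrite ger0_norm ?invr_ge0//.
    by rewrite invf_lt1// ltr1n.
have key e : 0 < e -> exists M, forall n, (M <= n)%N ->
    (\int[mu]_x ((u_ n - u) x ^+ 2)%:E <= e%:E)%E.
  move=> /cu[M hM]; exists M => n Mn.
  under eq_integral do rewrite -[_ ^+ 2]mul1r.
  apply: (@fatou_weighted (cst 1) (fun k => u_ n - v k)) => //.
  - by move=> k; have [] := phB H (Lu_ n) (Lv k).
  - by apply: measurable_funB => //; case: (Lu_ n).
  - by apply: filterS vu => x vx; apply: cvgB => //; exact: cvg_cst.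
  - exists M.+1 => k Mk; under eq_integral do rewrite mul1r.
    rewrite -ipr_sqr; last exact: (phB H).
    by rewrite lee_fin hM// -ltnS (leq_trans Mk).
have Lu : L2r u.
  have [M hM] := key 1 ltr01.
  have : L2r (u_ M - u).
    split; first by apply: measurable_funB => //; case: (Lu_ M).
    by rewrite (le_lt_trans (hM M (leqnn M)))// ltry.
  by move=> h; have := phB H (Lu_ M) h; rewrite opprB addrC subrK.
exists u => // e /key[M hM]; exists M => n /hM.
by rewrite -ipr_sqr ?lee_fin//; exact: (phB H).
Qed.

End real_L2.

(** * Smooth bump functions *)

Section flat.
Context {R : realType}.

(** The functions x^-k exp(-1/x), extended by 0. The derivative of each is a combination of two
    others, so smoothness needs no formula for higher derivatives. *)
Definition flat (k : nat) (x : R) : R :=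
  if 0 < x then x ^- k * expR (- x^-1) else 0.

Lemma flat_ge0 k x : 0 <= flat k x.
Proof.
rewrite /flat; case: ifP => // x0.
by rewrite mulr_ge0 ?expR_ge0// invr_ge0 exprn_ge0 ?ltW.
Qed.

Lemma flat_eq0 k x : x <= 0 -> flat k x = 0.
Proof. by rewrite /flat leNgt => /negbTE ->. Qed.

Lemma flat0_le1 x : flat 0 x <= 1.
Proof.
rewrite /flat; case: ifP => // x0; rewrite expr0 invr1 mul1r.
by rewrite expR_le1 oppr_le0 invr_ge0 ltW.
Qed.

Lemma flat0_gt x : 0 < x -> 1 - x^-1 <= flat 0 x.
Proof. by move=> x0; rewrite /flat x0 expr0 invr1 mul1r expR_ge1Dx. Qed.

(** The difference quotient at 0 tends to 0 because exp(1/h) exceeds the term of order k + 2 of its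
    series. *)
Lemma flat_quotient_bound k (h : R) : 0 < h ->
  `|h^-1 * flat k h| <= (k.+2)`!%:R * h.
Proof.
move=> h0; rewrite ger0_norm; last by rewrite mulr_ge0 ?flat_ge0// invr_ge0 ltW.
rewrite /flat h0 expRN.
have hV0 : 0 <= h^-1 by rewrite invr_ge0 ltW.
have := expR_ge1Dxn k.+1 hV0.
have f0 : 0 < (k.+2)`!%:R :> R by rewrite ltr0n fact_gt0.
have e0 : 0 < expR h^-1 by exact: expR_gt0.
move=> h1; have {h1} : h^-1 ^+ k.+2 <= (k.+2)`!%:R * expR h^-1.
  by rewrite mulrC -ler_pdivrMr// (le_trans _ h1)// lerDr.
move=> h1; rewrite mulrA ler_pdivrMr// mulrAC.
apply: (@le_trans _ _ (h^-1 ^+ k.+2 * h)).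
  rewrite -exprVn !exprS; move: (h^-1 ^+ k) => p.
  by rewrite le_eqVlt; apply/orP; left; apply/eqP; field; rewrite gt_eqF.
by rewrite ler_wpM2r// ltW.
Qed.

Lemma is_derive_flat k (x : R) :
  is_derive x (1 : R) (flat k) (- k%:R * flat k.+1 x + flat k.+2 x).
Proof.
have [x0|x0|->] := ltgtP x 0.
- rewrite !flat_eq0 ?(ltW x0)// mulr0 addr0.
  apply: near_eq_is_derive (is_derive_cst (0 : R) x (1 : R)).
  near=> y; rewrite flat_eq0// ltW//.
  by near: y; exact: lt_nbhsl.
- apply: (@near_eq_is_derive _ _ _ (fun x : R => x ^- k * expR (- x^-1) : R)).
    near=> y; rewrite /flat ifT//.
    by near: y; exact: lt_nbhsr.
  have dV : is_derive x (1 : R) (fun y : R => y^-1) (- x ^- 2).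
    have := @is_deriveV R id x 1 1 _ (is_derive_id x 1).
    by move=> /(_ (lt0r_neq0 x0)) h; apply: is_derive_eq h _; rewrite scaler1.
  have dk : is_derive x (1 : R) (fun y : R => y ^- k) (- k%:R * x ^- k.+1).
    rewrite (_ : (fun y : R => y ^- k) = (fun y : R => (y^-1) ^+ k)); last first.
      by apply/funext => y; rewrite exprVn.
    case: k => [|k].
      rewrite oppr0 mul0r (_ : (fun _ => _) = cst 1)//; exact: is_derive_cst.
    rewrite (_ : (fun y : R => _) = (fun y : R => y^-1) ^+ k.+1); last first.
      by rewrite exprfctE.
    apply: is_derive_eq (is_deriveX _ dV) _.
    rewrite -[LHS]/(k.+1%:R * x^-1 ^+ k * (- x ^- 2)) -!exprVn !exprS.
    by ring.
  have dE : is_derive x (1 : R) (fun y : R => expR (- y^-1)) (x ^- 2 * expR (- x^-1)).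
    have dN : is_derive x (1 : R) (fun y : R => - y^-1) (x ^- 2).
      by apply: is_derive_eq (is_deriveN dV) _; rewrite opprK.
    by apply: is_derive_eq; rewrite mulrC.
  apply: is_derive_eq (is_deriveM dk dE) _.
  rewrite /flat x0 /GRing.scale/= -!exprVn !exprS; ring.
- rewrite !flat_eq0// mulr0 addr0.
  suff h : (fun h : R => h^-1 *: ((flat k \o shift 0) (h *: 1) - flat k 0)) @ 0^' --> 0.
    by split; [apply/cvg_ex; exists 0|exact/cvg_lim].
  apply/cvgrPdist_le => e e0; near=> h.
  rewrite sub0r normrN /= addr0 [flat k 0]flat_eq0// subr0 /GRing.scale/= mulr1.
  have [h0|h0] := ltP 0 h; last by rewrite flat_eq0// mulr0 normr0 ltW.
  apply: le_trans (flat_quotient_bound k h0) _.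
  have f0 : 0 < (k.+2)`!%:R :> R by rewrite ltr0n fact_gt0.
  rewrite mulrC -ler_pdivlMr//.
  rewrite (le_trans (ler_norm _))//.
  near: h; apply: dnbhs0_le; exact: divr_gt0.
Unshelve. all: by end_near. Qed.

Lemma continuous_flat k : continuous (flat k).
Proof.
move=> x; apply: differentiable_continuous; apply/derivable1_diffP.
by have [] := is_derive_flat k x.
Qed.

End flat.

Section lines.
Context {R : realType} {V : normedModType R}.

Lemma is_derive_line (f : V -> R) (x v : V) (s df : R) :
  is_derive s (1 : R) (fun h : R => f (h *: v + x)) df <-> is_derive (s *: v + x) v f df.
Proof.
have e : (fun h : R => h^-1 *: (((fun h : R => f (h *: v + x)) \o shift s) (h *: (1 : R)) -
      f (s *: v + x))) =
    (fun h : R => h^-1 *: ((f \o shift (s *: v + x)) (h *: v) - f (s *: v + x))).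
  apply/funext => h /=; congr (_ *: (f _ - _)).
  by rewrite (_ : h *: (1 : R) = h) ?scalerDl ?addrA//; exact: mulr1.
split=> -[h1 h2]; split; [rewrite /derivable -e|rewrite /derive -e|
  rewrite /derivable e|rewrite /derive e] => //.
Qed.

End lines.

Section bumps.
Context {R : realType} {d : nat}.
Local Notation mu := (mes R d).
Local Notation delta i := (delta_mx ord0 i : 'rV[R]_d).

(* An algebra generated by [flat] in affine coordinates: it is stable under
   partial derivatives, so its members are smooth. *)
Inductive flat_alg : ('rV[R]_d -> R) -> Prop :=
| flat_alg_flat k (a b : R) (i : 'I_d) :
    flat_alg (fun x : 'rV[R]_d => flat k (a * x ord0 i + b))
| flat_alg_cst (c : R) : flat_alg (cst c)
| flat_alg_add f g : flat_alg f -> flat_alg g -> flat_alg (f \+ g)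
| flat_alg_mul f g : flat_alg f -> flat_alg g -> flat_alg (f \* g).

Lemma flat_alg_continuous f : flat_alg f -> continuous f.
Proof.
elim=> [k a b i|c|{}f g _ cf _ cg|{}f g _ cf _ cg] x.
- apply: (@continuous_comp _ _ _ (fun x : 'rV[R]_d => a * x ord0 i + b) (flat k));
    last exact: continuous_flat.
  apply: continuousD; last exact: cst_continuous.
  by apply: continuousM; [exact: cst_continuous|exact: coord_continuous].
- exact: cst_continuous.
- by apply: continuousD; [exact: cf|exact: cg].
- by apply: continuousM; [exact: cf|exact: cg].
Qed.

Lemma flat_alg_derive f j : flat_alg f ->
  exists2 g, flat_alg g & forall x, is_derive x (delta j) f (g x).
Proof.
elim=> [k a b i|c|{}f g Sf [f' Sf' hf] Sg [g' Sg' hg]|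
    {}f g Sf [f' Sf' hf] Sg [g' Sg' hg]].
- exists (cst (a * (i == j)%:R) \* (cst (- k%:R) \* (fun x => flat k.+1 (a * x ord0 i + b))
      \+ (fun x => flat k.+2 (a * x ord0 i + b)))).
    by do !constructor.
  move=> x; rewrite -[X in is_derive X]addr0.
  rewrite -[X in is_derive X](_ : 0 *: delta j + x = _); last by rewrite scale0r add0r addr0.
  apply/is_derive_line.
  have -> : (fun h : R => flat k (a * (h *: delta j + x) ord0 i + b)) =
     flat k \o (fun h : R => h * (a * (i == j)%:R) + (a * x ord0 i + b)).
    by apply/funext => h /=; rewrite !mxE eqxx/=; congr flat; ring.
  set c := a * _; set e := _ + b.
  have dl : is_derive (0 : R) (1 : R) (fun h : R => h * c + e) c.
    have h1 : is_derive (0 : R) (1 : R) (fun h : R => h * c) c.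
      apply: is_derive_eq (is_deriveM (is_derive_id _ _) (is_derive_cst _ _ _)) _.
      by rewrite scaler0 add0r /GRing.scale/= mulr1.
    by apply: is_derive_eq (is_deriveD h1 (is_derive_cst _ _ _)) _; rewrite addr0.
  apply: is_derive_eq.
    apply: (is_derive1_comp (f := flat k)); exact: is_derive_flat.
  by rewrite mul0r add0r mulrC.
- exists (cst 0); first by constructor.
  by move=> x; exact: is_derive_cst.
- exists (f' \+ g'); first by constructor.
  by move=> x; exact: is_deriveD.
- exists (f \* g' \+ g \* f'); first by do !constructor.
  by move=> x; exact: is_deriveM.
Qed.

Lemma flat_alg_partial f i : flat_alg f -> flat_alg (partial i f).
Proof.
move=> /(flat_alg_derive i)[g Sg h]; rewrite (_ : partial i f = g)//.
by apply/funext => x; rewrite /partial; apply: derive_val.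
Qed.

Lemma flat_alg_smooth f : flat_alg f -> smooth f.
Proof.
move=> Sf s /=; have S : flat_alg (foldr partial f s).
  by elim: s => //= i s; exact: flat_alg_partial.
split; first exact: flat_alg_continuous.
by move=> x i; have [g _ /(_ x)[]] := flat_alg_derive i S.
Qed.

(* Converges to the indicator of [box a b], the upper endpoint included because
   [n^2 (b - x) + n] tends to infinity at [x = b]. *)
Definition bump (a b : 'rV[R]_d) (n : nat) (x : 'rV[R]_d) : R :=
  \prod_i (flat 0 (n.+1%:R * x ord0 i + - (n.+1%:R * a ord0 i)) *
    flat 0 (- n.+1%:R ^+ 2 * x ord0 i + (n.+1%:R ^+ 2 * b ord0 i + n.+1%:R))).

Lemma bump_ge0 a b n x : 0 <= bump a b n x.
Proof. by apply: prodr_ge0 => i _; rewrite mulr_ge0 ?flat_ge0. Qed.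

Lemma bump_le1 a b n x : bump a b n x <= 1.
Proof.
rewrite -[leRHS](_ : \prod_(i < d) 1 = 1); last by rewrite big1.
apply: ler_prod => i _; rewrite mulr_ge0 ?flat_ge0//=.
by rewrite mulr_ile1 ?flat_ge0 ?flat0_le1.
Qed.

Lemma bump_neq0 a b n x : bump a b n x != 0 ->
  forall i, a ord0 i < x ord0 i < b ord0 i + 1.
Proof.
have n0 : 0 < n.+1%:R :> R by rewrite ltr0n.
have n1 : 1 <= n.+1%:R :> R by rewrite ler1n.
move=> bn i; move: bn; rewrite /bump (bigD1 i)//= !mulf_eq0 !negb_or => /andP[/andP[h1 h2] _].
apply/andP; split; rewrite ltNge; apply/negP => h.
  by move/negP: h1; apply; apply/eqP/flat_eq0; rewrite -mulrBr pmulr_rle0// subr_le0.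
move/negP: h2; apply; apply/eqP/flat_eq0; nra.
Qed.

Lemma test_function_bump a b n : test_function (bump a b n).
Proof.
split.
  apply: flat_alg_smooth; rewrite /bump.
  rewrite (_ : (fun _ => _) = (fun x : 'rV[R]_d => \prod_(i <- index_enum 'I_d)
     (flat 0 (n.+1%:R * x ord0 i + - (n.+1%:R * a ord0 i)) *
    flat 0 (- n.+1%:R ^+ 2 * x ord0 i + (n.+1%:R ^+ 2 * b ord0 i + n.+1%:R)))))//.
  elim: (index_enum _) => [|i s ih].
    rewrite (_ : (fun _ => _) = cst 1); first by constructor.
    by apply/funext => x; rewrite big_nil.
  under eq_fun do rewrite big_cons.
  by apply: flat_alg_mul => //; apply: flat_alg_mul; constructor.
apply: (@subclosed_compact _ _
  [set x : 'rV[R]_d | forall i, `[a ord0 i, b ord0 i + 1]%classic (x ord0 i)]).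
- exact: closed_closure.
- apply: (@rV_compact _ _ (fun i => `[a ord0 i, b ord0 i + 1]%classic)) => i.
  exact: segment_compact.
- set K := [set x : 'rV[R]_d | forall i, `[a ord0 i, b ord0 i + 1]%classic (x ord0 i)].
  suff cK : closed K.
    rewrite [X in _ `<=` X]((closure_id K).1 cK); apply: closure_subset.
    move=> x /= /bump_neq0 h i; rewrite /= in_itv/=.
    by have /andP[/ltW -> /ltW ->] := h i.
  apply: compact_closed; first exact: norm_hausdorff.
  apply: (@rV_compact _ _ (fun i => `[a ord0 i, b ord0 i + 1]%classic)) => i.
  exact: segment_compact.
Qed.

Lemma bump_cvg a b x : (fun n => bump a b n x) @ \oo --> (\1_(box a b) x : R).
Proof.
have [bx|] := pselect (box a b x).
  rewrite indicE mem_set//=.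
  have -> : 1%:R = \prod_(i < d) (1 * 1) :> R.
    by rewrite big1// => i _; rewrite mul1r.
  rewrite /bump; apply: (@cvg_big R 'I_d *%R 1 xpredT (@mul_continuous R) nat \oo
    (index_enum _) (fun i n =>
    flat 0 (n.+1%:R * x ord0 i + - (n.+1%:R * a ord0 i)) *
    flat 0 (- n.+1%:R ^+ 2 * x ord0 i + (n.+1%:R ^+ 2 * b ord0 i + n.+1%:R)))
    (fun=> 1 * 1)) => i _.
  have flat_cvg (u : nat -> R) : (forall n, 0 < u n) -> (u n)^-1 @[n --> \oo] --> (0 : R) ->
      flat 0 (u n) @[n --> \oo] --> (1 : R).
    move=> u0 uc; apply: (@squeeze_cvgr _ _ _ _ (fun n => 1 - (u n)^-1) (cst 1)).
    - by apply: nearW => n; rewrite flat0_gt//= flat0_le1.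
    - by rewrite -[X in _ --> X]subr0; apply: cvgB => //; exact: cvg_cst.
    - exact: cvg_cst.
  have /andP[ax xb] := bx i.
  apply: cvgM; apply: flat_cvg.
  - by move=> n; rewrite -mulrBr mulr_gt0// subr_gt0.
  - have : n.+1%:R^-1 * (x ord0 i - a ord0 i)^-1 @[n --> \oo] -->
        (0 : R) * (x ord0 i - a ord0 i)^-1.
      by apply: cvgM; [exact: cvg_harmonic|exact: cvg_cst].
    rewrite mul0r (_ : (fun n : nat => _ / _) =
      (fun n => (n.+1%:R * x ord0 i + - (n.+1%:R * a ord0 i))^-1))//.
    by apply/funext => n; rewrite -mulrBr invfM.
  - by move=> n; rewrite mulNr addrA (addrC (- _)) -mulrBr ltr_wpDl// mulr_ge0 ?sqr_ge0// subr_ge0.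
  - apply: (@squeeze_cvgr _ _ _ _ (cst 0) harmonic); last 2 first.
    + exact: cvg_cst.
    + exact: cvg_harmonic.
    apply: nearW => n.
    have n0 : 0 < n.+1%:R :> R by [].
    have h : n.+1%:R <= - n.+1%:R ^+ 2 * x ord0 i + (n.+1%:R ^+ 2 * b ord0 i + n.+1%:R).
      by rewrite mulNr addrA (addrC (- _)) -mulrBr lerDr mulr_ge0 ?sqr_ge0// subr_ge0.
    have h' := lt_le_trans n0 h.
    by rewrite /= invr_ge0 (ltW h')/= lef_pV2 ?posrE.
move=> bx; rewrite indicE memNset//=.
have [i h] : exists i, ~ (a ord0 i < x ord0 i <= b ord0 i) by exact/existsNP.
move/negP: h; rewrite negb_and -leNgt -ltNge => /orP h.
suff hn : \forall n \near \oo, bump a b n x = 0.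
  by apply: cvg_near_cst.
have i0 n : flat 0 (n.+1%:R * x ord0 i + - (n.+1%:R * a ord0 i)) *
    flat 0 (- n.+1%:R ^+ 2 * x ord0 i + (n.+1%:R ^+ 2 * b ord0 i + n.+1%:R)) = 0 :> R ->
    bump a b n x = 0.
  by move=> h0; rewrite /bump (bigD1 i)//= h0 mul0r.
case: h => h.
  near=> n; apply: i0; rewrite flat_eq0 ?mul0r// -mulrBr pmulr_rle0 ?subr_le0//.
near=> n; apply: i0; rewrite [X in _ * X]flat_eq0 ?mulr0//.
have n0 : 0 < n.+1%:R :> R by [].
have : (x ord0 i - b ord0 i)^-1 <= n.+1%:R.
  rewrite -natr1 (@le_trans _ _ n%:R) ?lerDl//; near: n; exact: nbhs_infty_ger.
have xb : 0 < x ord0 i - b ord0 i by rewrite subr_gt0.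
rewrite -[_^-1]mul1r ler_pdivrMr//; nra.
Unshelve. all: by end_near. Qed.

End bumps.

(** * Test functions determine L_2 functions *)

Section fundamental_lemma.
Context {R : realType} {d : nat}.
Local Notation mu := (mes R d).
Implicit Types (w : 'rV[R]_d -> R).

Lemma L2r_bounded_support (f : 'rV[R]_d -> R) a b c : measurable_fun setT f ->
  (forall x, `|f x| <= c * \1_(box a b) x) -> L2r mu f.
Proof.
move=> mf fb; split=> //.
apply: (@le_lt_trans _ _ (\int[mu]_x ((c ^+ 2)%:E * (\1_(box a b) x)%:E))%E).
  apply: ge0_le_integral => //=.
  - by move=> x _; rewrite lee_fin sqr_ge0.
  - by apply/measurable_EFinP; exact: measurable_funX.
  - apply/measurable_EFinP; apply: measurable_funM => //.
    exact: measurable_indic (measurable_box a b).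
  - move=> x _; rewrite -EFinM lee_fin -[leLHS]real_normK ?num_real//.
    have h := fb x.
    apply: (@le_trans _ _ ((c * \1_(box a b) x) ^+ 2)).
      by rewrite ler_sqr ?nnegrE// (le_trans _ h).
    by rewrite exprMn indicE; case: (x \in _); rewrite ?expr1n ?expr0n.
rewrite ge0_integralZl_EFin ?sqr_ge0//; last first.
  by apply/measurable_EFinP; exact: measurable_indic (measurable_box a b).
rewrite integral_indic//; last exact: measurable_box.
by rewrite setIT lte_mul_pinfty ?lee_fin ?sqr_ge0// mes_box_lty.
Qed.

Lemma L2r_indic_box a b : L2r mu (\1_(box a b) : 'rV[R]_d -> R).
Proof.
apply: (@L2r_bounded_support _ a b 1); first exact: measurable_indic (measurable_box a b).
by move=> x; rewrite mul1r ger0_norm.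
Qed.

Lemma coord_le_norm (x : 'rV[R]_d) i : `|x ord0 i| <= `|x|.
Proof.
rewrite [leRHS]mx_normrE.
exact: (le_bigmax _ (fun ij : 'I_1 * 'I_d => `|x ij.1 ij.2|) (ord0, i)).
Qed.

Lemma compact_support_bound (phi : 'rV[R]_d -> R) : continuous phi ->
  compact (closure [set x | phi x != 0]) ->
  exists (a b : 'rV[R]_d) (c : R), forall x, `|phi x| <= c * \1_(box a b) x.
Proof.
move=> cphi cK; set K := closure _ in cK.
have [M [Mr hM]] := compact_bounded cK.
have [C [Cr hC]] := compact_bounded (continuous_compact (continuous_subspaceT cphi) cK).
pose N := (Num.trunc `|M|).+2.
have MN : M < N%:R - 1.
  by rewrite /N -natr1 addrK (le_lt_trans (ler_norm _))// truncnS_gt.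
exists (const_mx (- N%:R)), (const_mx N%:R), (`|C| + 1) => x.
have [Kx|nKx] := pselect (K x); last first.
  rewrite (_ : phi x = 0) ?normr0 ?mulr_ge0 ?addr_ge0//.
  by apply/eqP/negPn/negP => h; apply: nKx; exact: subset_closure.
rewrite indicE mem_set ?mulr1.
  apply: hC; last by exists x.
  by rewrite (le_lt_trans (ler_norm _))// ltrDl.
move=> i; rewrite !mxE.
have := le_trans (coord_le_norm x i) (hM _ MN x Kx).
rewrite ler_norml => /andP[h1 h2]; apply/andP; split; last by lra.
by apply: lt_le_trans h1; lra.
Qed.

Lemma L2r_test_function (phi : 'rV[R]_d -> R) : test_function phi -> L2r mu phi.
Proof.
move=> [sphi cK]; have [cphi _] := sphi [::].
have [a [b [c h]]] := compact_support_bound cphi cK.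
exact: L2r_bounded_support (continuous_measurable_rV cphi) h.
Qed.

Lemma ipr_EFin d' (T : measurableType d') (m : {measure set T -> \bar R}) (f g : T -> R) :
  L2r m f -> L2r m g -> (ipr m f g)%:E = (\int[m]_x (f x * g x)%:E)%E.
Proof.
move=> f2 g2; rewrite /ipr /Rintegral fineK//.
exact: (integrable_fin_num measurableT (L2r_mul_integrable f2 g2)).
Qed.

Lemma ortho_test_functions_box w : L2r mu w ->
  (forall phi, test_function phi -> ipr mu w phi = 0) ->
  forall a b, ipr mu w (\1_(box a b)) = 0.
Proof.
move=> w2 hw a b; have [mw _] := w2.
(* For every [n] the bump vanishes outside the box whose upper corner is moved by 1; [w] restricted
   to that box is the dominating function. *)
pose b1 : 'rV[R]_d := \row_i (b ord0 i + 1).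
pose g x := (`|(w x * \1_(box a b1) x)%:E|)%E.
have ig : mu.-integrable setT g.
  by apply: integrable_abse; exact: L2r_mul_integrable (L2r_indic_box a b1).
have mb n : measurable_fun setT (bump a b n).
  by case: (L2r_test_function (test_function_bump a b n)).
have [_ _] := @dominated_convergence _ _ R mu setT measurableT
  (fun n x => (w x * bump a b n x)%:E) (fun x => (w x * \1_(box a b) x)%:E) g
  (fun n => ltac:(by apply/measurable_EFinP; exact: measurable_funM))
  ltac:(by apply/measurable_EFinP; apply: measurable_funM => //;
    exact: measurable_indic (measurable_box a b))
  ltac:(apply: aeW => x _; apply: cvg_EFin;
    [exact: nearW|by apply: cvgM; [exact: cvg_cst|exact: bump_cvg]])
  ig
  ltac:(apply: aeW => x n _; rewrite /g /= lee_fin !normrM ler_wpM2l//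
    (ger0_norm (bump_ge0 a b n x)) ger0_norm// indicE;
    have [h|h] := eqVneq (bump a b n x) 0; [by rewrite h|
    rewrite mem_set ?bump_le1//; move=> i; have /andP[-> /ltW] := bump_neq0 h i; by rewrite mxE]).
rewrite (_ : (fun n : nat => _) = cst 0%E); last first.
  apply/funext => n /=; rewrite -ipr_EFin//;
    last exact: (L2r_test_function (test_function_bump a b n)).
  by rewrite hw//; exact: test_function_bump.
rewrite -(ipr_EFin w2 (L2r_indic_box a b)) => h.
have /cvg_lim := h; rewrite lim_cst// => /(_ (@ereal_hausdorff R)) [] <-.
by [].
Qed.

(** Cut off to a cube, [w] is integrable, and the sets over which its integral vanishes form a
    Dynkin system containing the boxes; hence it vanishes almost everywhere on each of countably
    many cubes. *)
Lemma fundamental_lemma w : L2r mu w ->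
  (forall phi, test_function phi -> ipr mu w phi = 0) ->
  {ae mu, forall x, w x = 0}.
Proof.
move=> w2 hw; have [mw _] := w2.
pose B (N : nat) := box (const_mx (- N%:R)) (const_mx N%:R) : set 'rV[R]_d.
pose v N x := (w x * \1_(B N) x)%:E.
have iv N : mu.-integrable setT (v N).
  exact: (L2r_mul_integrable w2 (L2r_indic_box _ _)).
have vS N S : measurable S -> (\int[mu]_(x in S) v N x = 0)%E.
  move=> mS; apply: (@dynkin_induction _ _ boxes
    (fun S => \int[mu]_(x in S) v N x = 0)%E measurable_boxesE setI_closed_boxes).
  - rewrite /v -(ipr_EFin w2 (L2r_indic_box _ _)).
    by rewrite ortho_test_functions_box.
  - move=> _ [a [b ->]].
    rewrite integral_mkcond; transitivity (\int[mu]_x (w x * \1_(box a b `&` B N) x)%:E)%E.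
      apply: eq_integral => x _; rewrite patchE /v indicI/= !indicE.
      by case: (x \in box a b); rewrite ?mul1r// mul0r mulr0.
    have [a' [b' ->]] : boxes (box a b `&` B N).
      by apply: setI_closed_boxes; do 2 eexists; reflexivity.
    by rewrite -(ipr_EFin w2 (L2r_indic_box _ _)) ortho_test_functions_box.
  - move=> A mA A0.
    have := @integral_setU _ _ _ mu A (~` A) (v N) mA (measurableC mA).
    rewrite setUv A0 add0e => <-.
    - by rewrite /v -(ipr_EFin w2 (L2r_indic_box _ _)) ortho_test_functions_box.
    - exact: measurable_int (iv N).
    - by apply/disj_setPS; rewrite setICr.
  - move=> F mF tF F0; rewrite integral_bigcup//.
      by rewrite eseries0// => i _ _; exact: F0.
    by apply: integrableS (iv N) => //; exact: bigcup_measurable.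
  - by rewrite -measurable_boxesE.
have vae N : {ae mu, forall x, v N x = 0%E}.
  have := @integral_ae_eq _ _ _ mu setT measurableT (cst 0%E) (v N) (iv N) (measurable_cst _).
  case=> [E _ mE|M [mM M0 hM]]; first by rewrite vS// integral0.
  by exists M; split=> //; apply: subset_trans hM => x /= h1 h2; apply: h1; exact: h2.
have : {ae mu, forall x, forall N, v N x = 0%E} by exact/ae_foralln.
apply: filterS => x hx.
have [N _ BN] : (\bigcup_n B n) x by rewrite boxes_cover.
by have := hx N; rewrite /v indicE mem_set// mulr1 => -[].
Qed.

End fundamental_lemma.

(** * Weak derivatives and the translation estimate *)

Section weak_derivatives.
Context {R : realType} {d : nat}.
Local Notation mu := (mes R d).
Local Notation delta i := (delta_mx ord0 i : 'rV[R]_d).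
Implicit Types (u v g w phi : 'rV[R]_d -> R) (i : 'I_d).

Lemma smooth_partial phi i : smooth phi -> smooth (partial i phi).
Proof. by move=> sphi s; have := sphi (rcons s i); rewrite -cats1 foldr_cat. Qed.

Lemma test_function_partial phi i : test_function phi -> test_function (partial i phi).
Proof.
move=> [sphi cK]; split; first exact: smooth_partial.
apply: (@subclosed_compact _ _ (closure [set x | phi x != 0])) => //.
  exact: closed_closure.
set K := closure [set x | phi x != 0] in cK *.
have clK : closed K by exact: closed_closure.
rewrite [X in _ `<=` X]((closure_id K).1 clK); apply: closure_subset => x /= px.
apply: contrapT => nK; move/eqP: px; apply.
have nx : \forall y \near x, phi y = cst 0 y.
  have : nbhs x (~` K) by apply: open_nbhs_nbhs; split=> //; exact: closed_openC.
  apply: filterS => y nKy; apply/eqP/negPn/negP => h; apply: nKy.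
  exact: subset_closure.
rewrite /partial (near_eq_derive _ nx).
exact: (@derive_val _ _ _ _ _ _ _ (is_derive_cst (0 : R) x (delta i))).
Qed.

Lemma partial_translate phi i (t : 'rV[R]_d) :
  partial i (fun x => phi (t + x)) = (fun x => partial i phi (t + x)).
Proof.
apply/funext => x; rewrite /partial /derive.
set f := (X in lim (X @ _) = _); set g := (X in _ = lim (X @ _)).
by rewrite (_ : f = g)//; apply/funext => h; rewrite /f /g /= addrCA.
Qed.

Lemma test_function_translate phi (t : 'rV[R]_d) : test_function phi ->
  test_function (fun x => phi (t + x)).
Proof.
move=> [sphi cK]; split.
  move=> s; have -> : foldr partial (fun x => phi (t + x)) s =
      (fun x => foldr partial phi s (t + x)).
    by elim: s => //= i s ->; rewrite partial_translate.
  have [cs ds] := sphi s; split.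
    move=> x; apply: continuous_comp; last exact: cs.
    by apply: continuousD; [exact: cst_continuous|exact: cvg_id].
  move=> x i; have := ds (t + x) i; rewrite /derivable.
  set f := (X in cvg (X @ _)); set g := (X in _ -> cvg (X @ _)).
  by rewrite (_ : g = f)//; apply/funext => h; rewrite /f /g /= addrCA.
have [a [b [c h]]] := compact_support_bound (sphi [::]).1 cK.
pose K : set 'rV[R]_d := [set x | forall i, `[(a - t) ord0 i, (b - t) ord0 i]%classic (x ord0 i)].
have cptK : compact K.
  apply: (@rV_compact _ _ (fun i => `[(a - t) ord0 i, (b - t) ord0 i]%classic)) => i.
  exact: segment_compact.
apply: (@subclosed_compact _ _ K) => //; first exact: closed_closure.
have clK : closed K by apply: compact_closed => //; exact: norm_hausdorff.
rewrite [X in _ `<=` X]((closure_id K).1 clK); apply: closure_subset => x /= px i.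
have : box a b (t + x).
  apply: contrapT => nb; have := h (t + x); rewrite indicE memNset// mulr0.
  by rewrite normr_le0 (negbTE px).
move=> /(_ i); rewrite !mxE /= in_itv/= => /andP[/ltW h1 h2].
by rewrite lerBlDl h1 lerBrDl h2.
Qed.

Lemma prehilbert_test_function : prehilbert (@test_function R d) (ipr mu).
Proof.
have H := @prehilbert_L2r _ _ R mu.
have L2t := @L2r_test_function R d.
split.
- have := test_function_translate; split.
    rewrite (_ : 0 = cst 0)//; apply: flat_alg_smooth; constructor.
  rewrite (_ : [set x | _] = set0) ?closure0; first exact: compact0.
  by apply/seteqP; split=> // x /=; rewrite eqxx.
- move=> f g [sf cf] [sg cg]; split.
    move=> s; have [-> h1 h2] : [/\ foldr partial (f + g) s =
        foldr partial f s \+ foldr partial g s,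
        smooth (foldr partial f s) & smooth (foldr partial g s)].
      elim: s => [|i s [ih sfs sgs]]/=; first by split.
      split; [|exact: smooth_partial|exact: smooth_partial].
      rewrite ih; apply/funext => x; rewrite /partial /=.
      have [_ dfs] := sfs [::]; have [_ dgs] := sgs [::].
      by rewrite deriveD.
    have [cfs dfs] := h1 [::]; have [cgs dgs] := h2 [::]; split.
      by move=> x; apply: continuousD; [exact: cfs|exact: cgs].
    by move=> x i; apply: derivableD; [exact: dfs|exact: dgs].
  apply: (@subclosed_compact _ _ (closure [set x | f x != 0] `|` closure [set x | g x != 0])).
  + exact: closed_closure.
  + exact: compactU.
  + rewrite -closureU; apply: closure_subset => x /= fg.
    have [f0|] := eqVneq (f x) 0; [right|by left].
    apply: contra fg => /eqP g0; apply/eqP.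
    by rewrite -[LHS]/(f x + g x) f0 g0 addr0.
- move=> c f [sf cf]; split.
    move=> s; have [-> h1] : foldr partial (c *: f) s = c *: foldr partial f s /\
        smooth (foldr partial f s).
      elim: s => [|i s [ih sfs]]/=; first by split.
      split; last exact: smooth_partial.
      rewrite ih; apply/funext => x; rewrite /partial /=.
      by have [_ dfs] := sfs [::]; rewrite deriveZ.
    have [cfs dfs] := h1 [::]; split.
      by move=> x; apply: continuousZr; exact: cfs.
    by move=> x i; apply: derivableZ; exact: dfs.
  apply: (@subclosed_compact _ _ (closure [set x | f x != 0])) => //.
    exact: closed_closure.
  apply: closure_subset => x /=; apply: contra => /eqP f0; apply/eqP.
  by rewrite -[LHS]/(c * f x) f0 mulr0.
- by move=> f g /L2t f2 /L2t g2; exact: (ipC H).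
- by move=> f g h /L2t f2 /L2t g2 /L2t h2; exact: (ipDl H).
- by move=> a f g /L2t f2 /L2t g2; exact: (ipZl H).
- by move=> f /L2t f2; exact: (ip_ge0 H).
Qed.

(* Riesz approximation inside the test functions converges in L2 to the
   projection of [w], which is [w] itself by the fundamental lemma. *)
Lemma norm_le_test_functions w (M : R) : L2r mu w -> 0 <= M ->
  (forall phi, test_function phi -> ipr mu w phi ^+ 2 <= M * ipr mu phi phi) ->
  ipr mu w w <= M.
Proof.
move=> w2 M0 hM; have H := @prehilbert_L2r _ _ R mu.
have L2t := @L2r_test_function R d.
have lD f g : test_function f -> test_function g ->
    ipr mu w (f + g) = ipr mu w f + ipr mu w g.
  by move=> /L2t f2 /L2t g2; exact: (ipDr H).
have lZ a f : test_function f -> ipr mu w (a *: f) = a * ipr mu w f.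
  by move=> /L2t f2; exact: (ipZr H).
have lb : exists C, forall f, test_function f -> ipr mu w f ^+ 2 <= C * ipr mu f f.
  by exists M.
have [u_ [Tu cu hu]] := riesz_seq prehilbert_test_function lD lZ lb.
have Lu n : L2r mu (u_ n) by exact: L2t.
have [p p2 up] := complete_L2r Lu cu.
have pw phi : test_function phi -> ipr mu (w - p) phi = 0.
  move=> tphi; have phi2 := L2t _ tphi.
  rewrite (ipBl H)//; apply/eqP; rewrite -normr_le0.
  apply/ler_addgt0Pl => e e0; rewrite addr0.
  have e2 : 0 < e / 2 by rewrite divr_gt0.
  have [N1 h1] := hu _ tphi _ e2.
  have [N2 h2] := ip_cvg H Lu p2 phi2 up e2.
  have := h1 _ (leq_maxl N1 N2); have := h2 _ (leq_maxr N1 N2).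
  set a := ipr mu (u_ _) phi => ha hb.
  rewrite (_ : _ - _ = (ipr mu w phi - a) + (a - ipr mu p phi)); last by ring.
  by rewrite (le_trans (ler_normD _ _))// [e]splitr lerD// distrC.
have wp2 := phB H w2 p2.
have wp0 := fundamental_lemma wp2 pw.
have wpE v : L2r mu v -> ipr mu w v = ipr mu p v.
  by move=> v2; apply/eqP; rewrite -subr_eq0 -(ipBl H)// (ae_eq0_ipr wp2 wp0).
have ppE : ipr mu p p = ipr mu w w by rewrite -wpE// (ipC H w2 p2) -wpE.
set X := ipr mu w w in ppE *.
have X0 : 0 <= X by exact: (ip_ge0 H).
rewrite leNgt; apply/negP => MX.
(* With [e] a tenth of the excess, closeness of u_n to p gives (X - e)^2 <= M (X + 3 e), which is
   impossible for M = X - 10 e >= 0. *)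
have e0 : 0 < (X - M) / 10 by rewrite divr_gt0 ?subr_gt0.
set e := (X - M) / 10 in e0.
have eE : X - M = 10 * e by rewrite /e; field.
have [N1 h1] := ip_cvg H Lu p2 p2 up e0.
have [N2 h2] := up _ e0.
set n := maxn N1 N2.
have {}h1 := h1 n (leq_maxl _ _); have {}h2 := h2 n (leq_maxr _ _).
have := hM _ (Tu n); rewrite wpE// (ipC H p2 (Lu n)).
move: h2; rewrite (ip_sqrB H)//.
move: h1; rewrite ppE.
move: (ipr mu (u_ n) p) (ipr mu (u_ n) (u_ n)) => a b.
by rewrite ler_norml => /andP[h1 h2] h3 h4; nra.
Qed.

Definition is_wp i u g := forall phi, test_function phi ->
  ipr mu u (partial i phi) = - ipr mu g phi.

Lemma is_wp_unique i u g g' : L2r mu g -> L2r mu g' ->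
  is_wp i u g -> is_wp i u g' -> {ae mu, forall x, (g - g') x = 0}.
Proof.
move=> g2 g2' h h'; have H := @prehilbert_L2r _ _ R mu.
apply: fundamental_lemma; first exact: (phB H).
move=> phi tphi; rewrite (ipBl H)//; last exact: L2r_test_function.
by apply/eqP; rewrite subr_eq0 -eqr_opp -h// -h'.
Qed.

Lemma is_wpD i u v g h : L2r mu u -> L2r mu v -> L2r mu g -> L2r mu h ->
  is_wp i u g -> is_wp i v h -> is_wp i (u + v) (g + h).
Proof.
move=> u2 v2 g2 h2 wu wv phi tphi; have H := @prehilbert_L2r _ _ R mu.
have p2 := L2r_test_function tphi.
have dp2 := L2r_test_function (test_function_partial i tphi).
by rewrite !(ipDl H)// wu// wv// opprD.
Qed.

Lemma is_wpZ i a u g : L2r mu u -> L2r mu g -> is_wp i u g -> is_wp i (a *: u) (a *: g).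
Proof.
move=> u2 g2 wu phi tphi; have H := @prehilbert_L2r _ _ R mu.
have p2 := L2r_test_function tphi.
have dp2 := L2r_test_function (test_function_partial i tphi).
by rewrite !(ipZl H)// wu// mulrN.
Qed.

Lemma is_wpB i u v g h : L2r mu u -> L2r mu v -> L2r mu g -> L2r mu h ->
  is_wp i u g -> is_wp i v h -> is_wp i (u - v) (g - h).
Proof.
move=> u2 v2 g2 h2 wu wv phi tphi; have H := @prehilbert_L2r _ _ R mu.
have p2 := L2r_test_function tphi.
have dp2 := L2r_test_function (test_function_partial i tphi).
by rewrite !(ipBl H)// wu// wv// opprB opprK addrC.
Qed.

Lemma is_wp_cvg i (u_ g_ : nat -> 'rV[R]_d -> R) u g :
  (forall n, L2r mu (u_ n)) -> (forall n, L2r mu (g_ n)) -> L2r mu u -> L2r mu g ->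
  (forall n, is_wp i (u_ n) (g_ n)) -> cvg_in (ipr mu) u_ u -> cvg_in (ipr mu) g_ g ->
  is_wp i u g.
Proof.
move=> Lu Lg u2 g2 wu uu gg phi tphi; have H := @prehilbert_L2r _ _ R mu.
have p2 := L2r_test_function tphi.
have dp2 := L2r_test_function (test_function_partial i tphi).
apply/eqP; rewrite -subr_eq0 opprK -normr_le0.
apply/ler_addgt0Pl => e e0; rewrite addr0.
have e2 : 0 < e / 2 by rewrite divr_gt0.
have [N1 h1] := ip_cvg H Lu u2 dp2 uu e2.
have [N2 h2] := ip_cvg H Lg g2 p2 gg e2.
have := h1 _ (leq_maxl N1 N2); have := h2 _ (leq_maxr N1 N2).
rewrite wu// => ha hb.
set n := maxn N1 N2 in ha hb.
rewrite (_ : _ + _ = - (- ipr mu (g_ n) phi - ipr mu u (partial i phi)) -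
  (ipr mu (g_ n) phi - ipr mu g phi)); last by ring.
by rewrite (le_trans (ler_normB _ _))// normrN [e]splitr lerD.
Qed.

Lemma L2r_translate u (t : 'rV[R]_d) : L2r mu u -> L2r mu (fun x => u (x + t)).
Proof.
move=> [mu_ u2]; split.
  exact: (measurableT_comp mu_ (measurable_addr t)).
rewrite (ge0_integral_translate t (f := fun x => (u x ^+ 2)%:E))//.
  by apply/measurable_EFinP; exact: measurable_funX.
by move=> x; rewrite lee_fin sqr_ge0.
Qed.

Lemma ipr_translate u v (t : 'rV[R]_d) : L2r mu u -> L2r mu v ->
  ipr mu (fun x => u (x + t)) (fun x => v (x + t)) = ipr mu u v.
Proof.
move=> [mu_ _] [mv _]; rewrite /ipr /Rintegral.
rewrite (integral_translate t (f := fun x => (u x * v x)%:E))//.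
by apply/measurable_EFinP; exact: measurable_funM.
Qed.

Lemma is_derive_ipr_translate u phi i (s : R) : L2r mu u -> test_function phi ->
  is_derive s (1 : R) (fun s : R => ipr mu u (fun x => phi (s *: delta i + x)))
    (ipr mu u (partial i (fun x => phi (s *: delta i + x)))).
Proof.
move=> u2 tphi; rewrite partial_translate.
have dphi := test_function_partial i tphi.
have [sd cd] := dphi; have [cdphi _] := sd [::].
have [a [b [c0 hc]]] := compact_support_bound cdphi cd.
pose c := `|c0|.
(* For [s'] within distance 1 of [s], the shifted supports all stay in the box enlarged by
   [|s| + 1]; this gives one dominating function for the whole interval. *)
pose k : 'rV[R]_d := const_mx (`|s| + 1).
pose f (s : R) (x : 'rV[R]_d) := u x * phi (s *: delta i + x).
have Df (s' : R) x : is_derive s' (1 : R) (f ^~ x) (u x * partial i phi (s' *: delta i + x)).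
  have [_ dd] := tphi.1 [::].
  have h : is_derive s' (1 : R) (fun h : R => phi (h *: delta i + x))
      (partial i phi (s' *: delta i + x)).
    by apply/is_derive_line; exact: DeriveDef (dd _ _) _.
  exact: (is_deriveZ (u x) h).
pose G x := `|u x| * (c * \1_(box (a - k) (b + k)) x).
have absu : L2r mu (fun x => `|u x|).
  case: u2 => mu_ u2; split; first exact: measurableT_comp.
  by under eq_integral do rewrite real_normK ?num_real//.
have Gint : mu.-integrable setT (EFin \o G).
  apply: L2r_mul_integrable => //.
  exact: (L2rZ c (L2r_indic_box (a - k) (b + k))).
have Is : `]s - 1, s + 1[%classic s by rewrite /= in_itv/= ltrBlDr ltrDl ltr01.
have fint (s' : R) : `]s - 1, s + 1[%classic s' -> mu.-integrable setT (EFin \o f s').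
  move=> _; apply: L2r_mul_integrable => //; apply: L2r_test_function.
  exact: test_function_translate.
have Gge0 y : 0 <= G y by rewrite /G mulr_ge0// mulr_ge0// /c.
have fder (s' : R) y : `]s - 1, s + 1[%classic s' -> setT y -> derivable (f ^~ y) s' 1.
  by move=> _ _; have [] := Df s' y.
have Gub (s' : R) y : `]s - 1, s + 1[%classic s' -> setT y -> `|partial1of2 f s' y| <= G y.
  rewrite /= in_itv/= => /andP[s1 s2] _.
  rewrite partial1of2E (@derive_val _ _ _ _ _ _ _ (Df s' y)) normrM ler_wpM2l//.
  apply: (le_trans (hc _)); rewrite indicE.
  have [hb|hb] := boolP (s' *: delta i + y \in box a b); last first.
    by rewrite mulr0 mulr_ge0// /c.
  rewrite mulr1 indicE mem_set ?mulr1 ?ler_norm//.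
  move: hb; rewrite inE => hb j; have := hb j; rewrite !mxE eqxx/=.
  have hs : `|s' * (j == i)%:R| <= `|s| + 1.
    rewrite normrM; apply: (@le_trans _ _ `|s'|).
      by rewrite ler_piMr//; case: (j == i); rewrite ?normr1 ?normr0.
    have := ler_norm s; have := ler_norm (- s); rewrite normrN => h1 h2.
    by rewrite ler_norml; apply/andP; split; lra.
  move: hs; rewrite ler_norml => /andP[h1 h2] /andP[h3 h4].
  by apply/andP; split; lra.
split.
  exact: (derivable_under_integral measurableT Is fint fder Gge0 Gint Gub).
rewrite -derive1E (differentiation_under_integral measurableT Is fint fder Gge0 Gint Gub).
apply: eq_Rintegral => x _.
by rewrite partial1of2E (@derive_val _ _ _ _ _ _ _ (Df s x)).
Qed.

(* Tested against [phi], the difference is the increment of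
   s |-> \int u phi(. + s e_i), whose derivative is - \int g phi(. + s e_i). *)
Lemma translation_estimate i u g (t : R) : L2r mu u -> L2r mu g -> is_wp i u g ->
  ipr mu (fun x => u (x + t *: delta i) - u x) (fun x => u (x + t *: delta i) - u x) <=
  t ^+ 2 * ipr mu g g.
Proof.
move=> u2 g2 wu; have H := @prehilbert_L2r _ _ R mu.
have ut2 := L2r_translate (t *: delta i) u2.
have w2 : L2r mu (fun x => u (x + t *: delta i) - u x) by exact: (phB H ut2 u2).
have g0 := ip_ge0 H g2.
apply: norm_le_test_functions => //; first by rewrite mulr_ge0// sqr_ge0.
move=> phi tphi; have p2 := L2r_test_function tphi.
pose F (s : R) := ipr mu u (fun x => phi (s *: delta i + x)).
pose F' (s : R) := ipr mu u (partial i (fun x => phi (s *: delta i + x))).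
have FF' s : is_derive s (1 : R) F (F' s) by exact: is_derive_ipr_translate.
(* The shift is moved from [u] onto [phi], so that only test functions are differentiated. *)
have -> : ipr mu (fun x => u (x + t *: delta i) - u x) phi = F (- t) - F 0.
  rewrite -[X in ipr mu X]/((fun x => u (x + t *: delta i)) - u) (ipBl H)//.
  congr (_ - _); last first.
    by rewrite /F; congr ipr; apply/funext => x; rewrite scale0r add0r.
  rewrite -(ipr_translate (- t *: delta i))//.
  rewrite /F; congr (ipr _ _ _); apply/funext => x; last by rewrite addrC.
  by rewrite -addrA -scalerDl addNr scale0r addr0.
have pp s : ipr mu (fun x => phi (s *: delta i + x)) (fun x => phi (s *: delta i + x)) =
    ipr mu phi phi.
  rewrite -[RHS](ipr_translate (s *: delta i) p2 p2).
  by congr ipr; apply/funext => x; rewrite addrC.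
have F'b s : F' s ^+ 2 <= ipr mu g g * ipr mu phi phi.
  have ts := test_function_translate (s *: delta i) tphi.
  rewrite /F' wu// sqrrN -(pp s); apply: (ip_CS H) => //.
  exact: L2r_test_function.
have cF A : {within A, continuous F}.
  apply: continuous_subspaceT => s; apply: differentiable_continuous.
  by apply/derivable1_diffP; have [] := FF' s.
have [|t0|t0] := ltgtP t 0; last by rewrite t0 oppr0 subrr expr0n/= !mul0r.
- move=> t0; have tN : 0 < - t by rewrite oppr_gt0.
  have [c _ ->] := @MVT R F F' 0 (- t) tN (fun s _ => FF' s) (cF _).
  by rewrite subr0 exprMn sqrrN mulrC -mulrA ler_wpM2l ?sqr_ge0.
- have tN : - t < 0 by rewrite oppr_lt0.
  have [c _] := @MVT R F F' (- t) 0 tN (fun s _ => FF' s) (cF _).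
  rewrite sub0r opprK => e; rewrite -[F (- t) - F 0]opprB e sqrrN.
  by rewrite exprMn mulrC -mulrA ler_wpM2l ?sqr_ge0.
Qed.

End weak_derivatives.

(** * The real quadratic form and its closedness *)

Section real_form.
Context {R : realType} {d : nat}.
Local Notation mu := (mes R d).
Local Notation delta i := (delta_mx ord0 i : 'rV[R]_d).
Implicit Types (u v g w : 'rV[R]_d -> R) (i : 'I_d).

Definition wps i u : set ('rV[R]_d -> R) := [set g | L2r mu g /\ is_wp i u g].

Definition wp i u : 'rV[R]_d -> R := xget (fun=> 0) (wps i u).

Variable W : 'rV[R]_d -> R.
Hypothesis mW : measurable_fun setT W.

(** [W] plays the role of the square root of the potential: finiteness of the potential energy
    becomes membership of W u in L_2, and its polarization an L_2 product. *)
Definition real_domain : set ('rV[R]_d -> R) :=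
  [set u | [/\ L2r mu u, forall i, wps i u !=set0 & L2r mu (W \* u)]].

Definition real_form u v : R :=
  \sum_i ipr mu (wp i u) (wp i v) + ipr mu (W \* u) (W \* v).

Let H := @prehilbert_L2r _ _ R mu.

Lemma wp_in i u : wps i u !=set0 -> L2r mu (wp i u) /\ is_wp i u (wp i u).
Proof. by case=> g hg; rewrite /wp; case: xgetP => // h; have := h g. Qed.

Local Opaque wp ipr.

Lemma ipr_ae_eq u v w : L2r mu u -> L2r mu v -> L2r mu w ->
  {ae mu, forall x, (u - v) x = 0} -> ipr mu u w = ipr mu v w.
Proof.
move=> u2 v2 w2 uv; apply/eqP; rewrite -subr_eq0 -(ipBl H)//.
by rewrite (ae_eq0_ipr (phB H u2 v2) uv).
Qed.

Lemma ipr_wp i u g w : L2r mu g -> is_wp i u g -> L2r mu w ->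
  ipr mu (wp i u) w = ipr mu g w.
Proof.
move=> g2 wg w2; have [p2 wpu] : L2r mu (wp i u) /\ is_wp i u (wp i u).
  by apply: wp_in; exists g.
by apply: ipr_ae_eq => //; apply: is_wp_unique wpu wg.
Qed.

Lemma real_domainD u v : real_domain u -> real_domain v -> real_domain (u + v).
Proof.
move=> [u2 hu Wu] [v2 hv Wv]; split; first exact: (phD H).
  move=> i; have [gu2 wu] := wp_in (hu i); have [gv2 wv] := wp_in (hv i).
  exists (wp i u + wp i v); split; first exact: (phD H).
  exact: is_wpD.
rewrite (_ : W \* (u + v) = (W \* u) + (W \* v)); first exact: (phD H).
by apply/funext => x /=; rewrite -[(u + v) x]/(u x + v x) mulrDr.
Qed.

Lemma real_domainZ a u : real_domain u -> real_domain (a *: u).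
Proof.
move=> [u2 hu Wu]; split; first exact: (phZ H).
  move=> i; have [gu2 wu] := wp_in (hu i).
  exists (a *: wp i u); split; first exact: (phZ H).
  exact: is_wpZ.
rewrite (_ : W \* (a *: u) = a *: (W \* u)); first exact: (phZ H).
by apply/funext => x /=; rewrite -[(a *: u) x]/(a * u x) mulrCA.
Qed.

Let sumD_addACA (a b c : 'I_d -> R) (x y z : R) :
  (forall i, c i = a i + b i) -> z = x + y ->
  \sum_i c i + z = (\sum_i a i + x) + (\sum_i b i + y).
Proof. by move=> h ->; rewrite addrACA -big_split; congr (_ + _); exact: eq_bigr. Qed.

Lemma prehilbert_real_form : prehilbert real_domain real_form.
Proof.
split; [|exact: real_domainD|exact: real_domainZ|..].
- split; first exact: (ph0 H).
    move=> i; exists 0; split; first exact: (ph0 H).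
    move=> phi tphi; have p2 := L2r_test_function tphi.
    have dp2 := L2r_test_function (test_function_partial i tphi).
    by rewrite !(ip0l H)// oppr0.
  rewrite (_ : W \* 0 = 0); first exact: (ph0 H).
  by apply/funext => x /=; rewrite -[X in _ * X]/(0 : R) mulr0.
- move=> u v [u2 hu Wu] [v2 hv Wv]; rewrite /real_form (ipC H Wu Wv).
  apply: f_equal2; last by []; apply: eq_bigr => i _.
  have [gu2 _] := wp_in (hu i); have [gv2 _] := wp_in (hv i); exact: (ipC H).
- move=> u v w [u2 hu Wu] [v2 hv Wv] [w2 hw Ww]; rewrite /real_form.
  rewrite (_ : W \* (u + v) = (W \* u) + (W \* v)); last first.
    by apply/funext => x /=; rewrite -[(u + v) x]/(u x + v x) mulrDr.
  apply: sumD_addACA (ipDl H Wu Wv Ww) => i.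
  have [gu2 wu] := wp_in (hu i); have [gv2 wv] := wp_in (hv i).
  have [gw2 _] := wp_in (hw i).
  rewrite (ipr_wp (g := wp i u + wp i v))//; first exact: (ipDl H).
    exact: (phD H).
  exact: is_wpD.
- move=> a u v [u2 hu Wu] [v2 hv Wv]; rewrite /real_form.
  rewrite (_ : W \* (a *: u) = a *: (W \* u)); last first.
    by apply/funext => x /=; rewrite -[(a *: u) x]/(a * u x) mulrCA.
  rewrite (ipZl H)// mulrDr mulr_sumr.
  apply: f_equal2; last by []; apply: eq_bigr => i _.
  have [gu2 wu] := wp_in (hu i); have [gv2 wv] := wp_in (hv i).
  rewrite (ipr_wp (g := a *: wp i u))//; first exact: (ipZl H).
    exact: (phZ H).
  exact: is_wpZ.
- move=> u [u2 hu Wu]; rewrite addr_ge0 ?(ip_ge0 H)// sumr_ge0// => i _.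
  by have [? _] := wp_in (hu i); rewrite (ip_ge0 H).
Qed.

(** The sequence and its weak derivatives converge in L_2, and a limit of weak derivatives is a weak
    derivative. Multiplication by [W] may be unbounded, so convergence of W u_n comes instead from
    Fatou's lemma and the Cauchy property. *)
Lemma complete_real_form :
  complete_in real_domain (fun u v => real_form u v + ipr mu u v).
Proof.
move=> u_ Du cu; have HD := prehilbert_real_form.
have Lu n : L2r mu (u_ n) by case: (Du n).
have Lw n : L2r mu (W \* u_ n) by case: (Du n).
have hu n i : wps i (u_ n) !=set0 by case: (Du n).
have Lg i n : L2r mu (wp i (u_ n)) by have [] := wp_in (hu n i).
have wg i n : is_wp i (u_ n) (wp i (u_ n)) by have [] := wp_in (hu n i).
have Lum m n := phB H (Lu m) (Lu n).
have Lgm i m n := phB H (Lg i m) (Lg i n).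
have wgm i m n : is_wp i (u_ m - u_ n) (wp i (u_ m) - wp i (u_ n)).
  by apply: is_wpB.
have Wm m n : W \* (u_ m - u_ n) = (W \* u_ m) - (W \* u_ n).
  by apply/funext => x /=; rewrite -[(u_ m - u_ n) x]/(u_ m x - u_ n x) mulrBr.
have gE i m n : ipr mu (wp i (u_ m - u_ n)) (wp i (u_ m - u_ n)) =
    ipr mu (wp i (u_ m) - wp i (u_ n)) (wp i (u_ m) - wp i (u_ n)).
  have w2 : L2r mu (wp i (u_ m - u_ n)).
    have [] // : L2r mu (wp i (u_ m - u_ n)) /\ is_wp i (u_ m - u_ n) (wp i (u_ m - u_ n)).
    by apply: wp_in; exists (wp i (u_ m) - wp i (u_ n)).
  by rewrite (ipr_wp (Lgm i m n))// (ipC H)// (ipr_wp (Lgm i m n)).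
pose t u v := real_form u v + ipr mu u v.
have Wmn0 m n : 0 <= ipr mu (W \* (u_ m - u_ n)) (W \* (u_ m - u_ n)).
  by rewrite Wm (ip_ge0 H)//; exact: (phB H).
have g0 i m n : 0 <= ipr mu (wp i (u_ m - u_ n)) (wp i (u_ m - u_ n)).
  by rewrite gE (ip_ge0 H).
have tge_u m n : ipr mu (u_ m - u_ n) (u_ m - u_ n) <= t (u_ m - u_ n) (u_ m - u_ n).
  by rewrite /t lerDr /real_form addr_ge0// sumr_ge0.
have tge_g i m n : ipr mu (wp i (u_ m) - wp i (u_ n)) (wp i (u_ m) - wp i (u_ n)) <=
    t (u_ m - u_ n) (u_ m - u_ n).
  rewrite -gE /t /real_form (bigD1 i)//= -!addrA lerDl !addr_ge0 ?sumr_ge0//.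
  exact: (ip_ge0 H).
have tge_w m n : ipr mu (W \* (u_ m - u_ n)) (W \* (u_ m - u_ n)) <=
    t (u_ m - u_ n) (u_ m - u_ n).
  by rewrite /t /real_form -addrA addrCA lerDl addr_ge0 ?sumr_ge0// (ip_ge0 H).
have [|u u2 uu] := complete_L2r Lu.
  move=> e /cu[N hN]; exists N => m n Nm Nn.
  exact: le_trans (tge_u m n) (hN m n Nm Nn).
have /choice[g hg] : forall i, exists g, L2r mu g /\ cvg_in (ipr mu) (fun n => wp i (u_ n)) g.
  move=> i; have [|g g2 gg] := complete_L2r (Lg i); last by exists g.
  move=> e /cu[N hN]; exists N => m n Nm Nn.
  exact: le_trans (tge_g i m n) (hN m n Nm Nn).
have g2 i : L2r mu (g i) by case: (hg i).
have wu i : is_wp i u (g i).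
  by have [_ gg] := hg i; exact: (is_wp_cvg Lu (Lg i)).
have [phi phik phiu] := L2r_cvg_subseq Lu u2 uu.
have u_u2 n := phB H (Lu n) u2.
have Wkey (e : R) : 0 < e -> exists N, forall n, (N <= n)%N ->
    (\int[mu]_x ((W \* (u_ n - u)) x ^+ 2)%:E <= e%:E)%E.
  move=> /cu[N hN]; exists N => n Nn.
  rewrite (_ : (\int[mu]_x _)%E = (\int[mu]_x (W x ^+ 2 * (u_ n - u) x ^+ 2)%:E)%E); last first.
    by apply: eq_integral => x _; rewrite /= exprMn.
  apply: (@fatou_weighted _ _ _ mu (fun x => W x ^+ 2) (fun k => u_ n - u_ (phi k))).
  - exact: measurable_funX.
  - by move=> x; exact: sqr_ge0.
  - by move=> k; case: (Lum n (phi k)).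
  - by case: (u_u2 n).
  - apply: filterS phiu => x px.
    by apply: cvgB => //; exact: cvg_cst.
  - exists N => k Nk.
    rewrite (_ : (\int[mu]_x _)%E =
      (\int[mu]_x ((W \* (u_ n - u_ (phi k))) x ^+ 2)%:E)%E); last first.
      by apply: eq_integral => x _; rewrite /= exprMn.
    have Lwm : L2r mu (W \* (u_ n - u_ (phi k))) by rewrite Wm; exact: (phB H).
    rewrite -ipr_sqr// lee_fin (le_trans (tge_w _ _))// hN//.
    exact: leq_trans (phik k).
have WL2 n : (exists e : R, (\int[mu]_x ((W \* (u_ n - u)) x ^+ 2)%:E <= e%:E)%E) ->
    L2r mu (W \* (u_ n - u)).
  move=> [e he]; split.
    by apply: measurable_funM => //; case: (u_u2 n).
  exact: le_lt_trans he (ltry _).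
have Wu : L2r mu (W \* u).
  have [N hN] := Wkey 1 ltr01.
  have h : L2r mu (W \* (u_ N - u)) by apply: WL2; exists 1; exact: hN.
  rewrite (_ : W \* u = (W \* u_ N) - (W \* (u_ N - u))); first exact: (phB H).
  apply/funext => x; rewrite -[RHS]/(W x * u_ N x - W x * (u_ N x - u x)) /=; ring.
have Du' : real_domain u by split=> // i; exists (g i).
exists u => // e e0.
(* One share for each of the [d] derivatives, one for the potential and one for the L_2 term. *)
pose e' := e / (d%:R + 2).
have e'0 : 0 < e' by rewrite divr_gt0// ltr_wpDl.
have [N1 h1] := uu _ e'0.
have [N2 h2] := Wkey _ e'0.
have /choice[N3 h3] : forall i, exists N, forall n, (N <= n)%N ->
    ipr mu (wp i (u_ n) - g i) (wp i (u_ n) - g i) <= e'.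
  by move=> i; have [_ gg] := hg i; exact: gg.
exists (maxn (\max_i N3 i) (maxn N1 N2)) => n; rewrite !geq_max.
move=> /andP[Nn3 /andP[/h1 {}h1 /h2 {}h2]].
rewrite /real_form; apply: (@le_trans _ _ (\sum_(i < d) e' + e' + e')); last first.
  have -> : e = e' * (d%:R + 2) by rewrite /e' divfK// gt_eqF// ltr_wpDl.
  rewrite sumr_const card_ord -mulr_natl le_eqVlt; apply/orP; left; apply/eqP; ring.
have ? : L2r mu (W \* (u_ n - u)) by apply: WL2; exists e'.
rewrite lerD// lerD//; last by rewrite -lee_fin ipr_sqr.
apply: ler_sum => i _.
have wgi : is_wp i (u_ n - u) (wp i (u_ n) - g i) by apply: is_wpB.
have Lgi := phB H (Lg i n) (g2 i).
have w2 : L2r mu (wp i (u_ n - u)).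
  by have [] := @wp_in i (u_ n - u) (ex_intro _ _ (conj Lgi wgi)).
rewrite (ipr_wp Lgi wgi w2) (ipC H Lgi w2) (ipr_wp Lgi wgi Lgi) h3//.
exact: leq_trans (leq_bigmax i) Nn3.
Qed.

End real_form.

(** * Comparison of function values over cubes *)

Section averages.
Context {R : realType} {d : nat}.
Local Notation mu := (mes R d).
Local Notation delta i := (delta_mx ord0 i : 'rV[R]_d).
Implicit Types (u v g w : 'rV[R]_d -> R) (i : 'I_d).

Let H := @prehilbert_L2r _ _ R mu.

(** The shift [t] is made of [d] moves parallel to the axes; adding [d] increments in L_2 costs the
    factor [d]. *)
Lemma translation_estimate_vec u (g : 'I_d -> 'rV[R]_d -> R) (t : 'rV[R]_d) (l : R) :
  L2r mu u -> (forall i, L2r mu (g i)) -> (forall i, is_wp i u (g i)) ->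
  (forall i, `|t ord0 i| <= l) ->
  ipr mu (fun x => u (x + t) - u x) (fun x => u (x + t) - u x) <=
    d%:R * l ^+ 2 * \sum_i ipr mu (g i) (g i).
Proof.
move=> u2 g2 wu tl.
pose T (k : nat) : 'rV[R]_d := \row_j (if (j < k)%N then t ord0 j else 0).
have T0 : T 0%N = 0 by apply/rowP => j; rewrite !mxE.
have Td : T d = t by apply/rowP => j; rewrite !mxE ltn_ord.
have TS (k : 'I_d) : T k.+1 = t ord0 k *: delta k + T k.
  apply/rowP => j; rewrite !mxE eqxx/= ltnS leq_eqVlt.
  have [->|jk] := eqVneq j k; first by rewrite eqxx ltnn mulr1 addr0.
  by rewrite (negbTE (jk : (j != k :> nat))) mulr0 add0r.
pose e (k : 'I_d) := fun x => u (x + T k.+1) - u (x + T k).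
have eE k : e k = (fun x => (fun y => u (y + t ord0 k *: delta k) - u y) (x + T k)).
  by apply/funext => x; rewrite /e TS [_ *: _ + _]addrC addrA.
have dk2 k : L2r mu (fun y => u (y + t ord0 k *: delta k) - u y).
  by apply: (phB H) => //; exact: L2r_translate.
have e2 k : L2r mu (e k) by rewrite eE; exact: (L2r_translate (T k) (dk2 k)).
have -> : (fun x => u (x + t) - u x) = \sum_(k < d) 1 *: e k.
  apply/funext => x; rewrite fct_sumE.
  transitivity (\sum_(k < d) (u (x + T k.+1) - u (x + T k))).
    rewrite -(big_mkord xpredT (fun k => u (x + T k.+1) - u (x + T k))).
    by rewrite telescope_sumr// Td T0 addr0.
  by apply: eq_bigr => k _; rewrite scale1r.
apply: (le_trans (ip_sqr_sum_le H _ e2)).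
rewrite (eq_bigr (fun=> 1)); last by move=> *; rewrite expr1n.
rewrite sumr_const card_ord -mulrA ler_wpM2l ?ler0n// mulr_sumr.
apply: ler_sum => k _; rewrite eE (ipr_translate (T k) (dk2 k) (dk2 k)).
apply: (le_trans (translation_estimate _ u2 (g2 k) (wu k))).
rewrite ler_wpM2r ?(ip_ge0 H)//.
have l0 : 0 <= l := le_trans (normr_ge0 _) (tl k).
by rewrite -(real_normK (num_real (t ord0 k))) ler_sqr ?nnegrE ?tl.
Qed.

Definition cube (l : R) : set 'rV[R]_d := box (const_mx (- l)) (const_mx l).

Lemma mes_cube l : 0 <= l -> mu (cube l) = ((2 * l) ^+ d)%:E.
Proof.
move=> l0; rewrite [LHS]mes_box; last by move=> i; rewrite !mxE ge0_cp.
congr EFin; rewrite (eq_bigr (fun=> 2 * l)) ?prodr_const ?card_ord// => i _.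
by rewrite !mxE; ring.
Qed.

Local Open Scope ereal_scope.

Let mcube l : measurable (cube l).
Proof. exact: measurable_box. Qed.

Lemma measurable_fst_add : measurable_fun setT
  (fun p : 'rV[R]_d * 'rV[R]_d => p.1 + p.2)%R.
Proof. by apply: measurable_add2; [exact: measurable_fst|exact: measurable_snd]. Qed.

(** Tonelli puts the [y] integral inside; the uniform bound on it is then integrated over the shifts
    [t] in a cube of volume (2 l)^d. *)
Lemma int_cube_swap (F : 'rV[R]_d * 'rV[R]_d -> \bar R) (l : R) (c : \bar R) :
  (0 <= l)%R -> measurable_fun setT F -> (forall p, 0 <= F p) ->
  (forall t, cube l t -> \int[mu]_y F (y, t) <= c) -> 0 <= c ->
  \int[mu]_y \int[mu]_t ((\1_(cube l) t)%:E * F (y, t)) <= ((2 * l) ^+ d)%:E * c.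
Proof.
move=> l0 mF F0 hF c0.
have m1 : measurable_fun setT (fun p : 'rV[R]_d * 'rV[R]_d => (\1_(cube l) p.2 : R)%:E).
  apply/measurable_EFinP.
  exact: (measurableT_comp (measurable_indic (mcube l)) measurable_snd).
have m2 : measurable_fun setT (fun p : 'rV[R]_d * 'rV[R]_d => (\1_(cube l) p.2 : R)%:E * F p).
  exact: emeasurable_funM.
have p0 p : 0 <= (\1_(cube l) p.2)%:E * F p by rewrite mule_ge0// lee_fin.
rewrite (fubini_tonelli (m1 := mu) (m2 := mu)
  (fun p : 'rV[R]_d * 'rV[R]_d => (\1_(cube l) p.2 : R)%:E * F p))//.
apply: (@le_trans _ _ (\int[mu]_t (c * (\1_(cube l) t)%:E))).
  apply: ge0_le_integral => //.
  - by move=> t _; apply: integral_ge0 => y _; exact: (p0 (y, t)).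
  - exact: (measurable_fun_fubini_tonelli_G (m1 := mu)
      (fun p : 'rV[R]_d * 'rV[R]_d => (\1_(cube l) p.2 : R)%:E * F p)).
  - apply: measurable_funeM; apply/measurable_EFinP; exact: measurable_indic.
  - move=> t _ /=.
    rewrite indicE; have [tl|tl] := boolP (t \in cube l); last first.
      rewrite mule0 integral0_eq// => y _; by rewrite mul0e.
    rewrite mule1; under eq_integral do rewrite mul1e.
    by apply: hF; exact: set_mem.
rewrite ge0_integralZl//; last by apply/measurable_EFinP; exact: measurable_indic.
by rewrite integral_indic// setIT [X in _ * X](mes_cube l0) muleC.
Qed.

Lemma measurable_increment u : measurable_fun setT u -> measurable_fun setT
  (fun p : 'rV[R]_d * 'rV[R]_d => (((u (p.1 + p.2) - u p.1) ^+ 2)%R)%:E).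
Proof.
move=> mu_; apply/measurable_EFinP; apply: measurable_funX; apply: measurable_funB.
  exact: (measurableT_comp mu_ measurable_fst_add).
exact: (measurableT_comp mu_ measurable_fst).
Qed.

(** Not divided by the volume of the cube. Extended real values let Tonelli apply before finiteness
    is known. *)
Definition increment_avg u (l : R) (y : 'rV[R]_d) : \bar R :=
  \int[mu]_t ((\1_(cube l) t)%:E * (((u (y + t) - u y) ^+ 2)%R)%:E).

Definition local_mass u (l : R) (y : 'rV[R]_d) : \bar R :=
  \int[mu]_t ((\1_(cube l) t)%:E * (((u (y + t)) ^+ 2)%R)%:E).

Lemma increment_avg_ge0 u l y : 0 <= increment_avg u l y.
Proof. by apply: integral_ge0 => t _; rewrite mule_ge0// lee_fin ?sqr_ge0. Qed.

Lemma local_mass_ge0 u l y : 0 <= local_mass u l y.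
Proof. by apply: integral_ge0 => t _; rewrite mule_ge0// lee_fin ?sqr_ge0. Qed.

Lemma measurable_increment_avg u l : measurable_fun setT u ->
  measurable_fun setT (increment_avg u l).
Proof.
move=> mu_; apply: (measurable_fun_fubini_tonelli_F (m2 := mu)
  (fun p : 'rV[R]_d * 'rV[R]_d =>
     (\1_(cube l) p.2 : R)%:E * (((u (p.1 + p.2) - u p.1) ^+ 2)%R)%:E)); last first.
  by move=> p; rewrite mule_ge0// lee_fin ?sqr_ge0.
apply: emeasurable_funM; last exact: measurable_increment.
apply/measurable_EFinP.
exact: (measurableT_comp (measurable_indic (mcube l)) measurable_snd).
Qed.

Lemma measurable_local_mass u l : measurable_fun setT u ->
  measurable_fun setT (local_mass u l).
Proof.
move=> mu_; apply: (measurable_fun_fubini_tonelli_F (m2 := mu)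
  (fun p : 'rV[R]_d * 'rV[R]_d =>
     (\1_(cube l) p.2 : R)%:E * (((u (p.1 + p.2)) ^+ 2)%R)%:E)); last first.
  by move=> p; rewrite mule_ge0// lee_fin ?sqr_ge0.
apply: emeasurable_funM.
  apply/measurable_EFinP.
  exact: (measurableT_comp (measurable_indic (mcube l)) measurable_snd).
apply/measurable_EFinP; apply: measurable_funX.
exact: (measurableT_comp mu_ measurable_fst_add).
Qed.

Lemma integral_increment_avg u (g : 'I_d -> 'rV[R]_d -> R) l : (0 <= l)%R ->
  L2r mu u -> (forall i, L2r mu (g i)) -> (forall i, is_wp i u (g i)) ->
  \int[mu]_y increment_avg u l y <=
    ((2 * l) ^+ d * (d%:R * l ^+ 2 * \sum_i ipr mu (g i) (g i)))%:E.
Proof.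
move=> l0 u2 g2 wu; rewrite EFinM; have [mu_ _] := u2.
apply: (int_cube_swap (F := fun p => (((u (p.1 + p.2) - u p.1) ^+ 2)%R)%:E)) => //.
- exact: measurable_increment.
- by move=> p; rewrite lee_fin sqr_ge0.
- move=> t tl; have w2 : L2r mu (fun x => u (x + t)%R - u x)%R.
    by apply: (phB H) => //; exact: L2r_translate.
  rewrite -(ipr_sqr w2) lee_fin; apply: translation_estimate_vec => // i.
  have := tl i; rewrite !mxE => /andP[h1 h2].
  by rewrite ler_norml h2 andbT ltW.
- rewrite lee_fin mulr_ge0 ?mulr_ge0 ?sqr_ge0// sumr_ge0// => i _.
  exact: (ip_ge0 H).
Qed.

Lemma integral_local_mass u l : (0 <= l)%R -> L2r mu u ->
  \int[mu]_y local_mass u l y <= ((2 * l) ^+ d * ipr mu u u)%:E.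
Proof.
move=> l0 u2; rewrite EFinM; have [mu_ _] := u2.
apply: (int_cube_swap (F := fun p => (((u (p.1 + p.2)) ^+ 2)%R)%:E)) => //.
- apply/measurable_EFinP; apply: measurable_funX.
  exact: (measurableT_comp mu_ measurable_fst_add).
- by move=> p; rewrite lee_fin sqr_ge0.
- move=> t tl; have w2 := L2r_translate t u2.
  by rewrite -(ipr_sqr w2) lee_fin -{1}(ipr_translate t u2 u2).
- by rewrite lee_fin (ip_ge0 H).
Qed.

(* On [E], [W^2 >= s] controls [u(x)^2] by the potential energy, and [u(y)] is
   compared with [u(x)] for every [x] in [E]. *)
Lemma far_pointwise (W u : 'rV[R]_d -> R) (E : set 'rV[R]_d) y (l s d0 : R) :
  measurable_fun setT W -> measurable_fun setT u -> measurable E -> (0 < s)%R ->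
  (forall x, E x -> cube l (x - y)%R) -> (forall x, E x -> (s <= W x ^+ 2)%R) ->
  (0 <= d0)%R -> d0%:E <= mu E ->
  (d0 * u y ^+ 2)%:E <= 2%:E * increment_avg u l y + (2 / s)%:E * local_mass (W \* u)%R l y.
Proof.
move=> mW mu_ mE s0 EQ EW d00 hE.
pose F t := 2%:E * ((\1_(cube l) t)%:E * (((u (y + t) - u y) ^+ 2)%R)%:E) +
  (2 / s)%:E * ((\1_(cube l) t)%:E * ((((W \* u) (y + t)) ^+ 2)%R)%:E).
have s2 : (0 <= 2 / s)%R by rewrite divr_ge0// ltW.
have m1 : measurable_fun setT (fun t => (\1_(cube l) t)%:E * (((u (y + t) - u y) ^+ 2)%R)%:E).
  apply: emeasurable_funM; first by apply/measurable_EFinP; exact: measurable_indic.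
  apply/measurable_EFinP; apply: measurable_funX; apply: measurable_funB => //.
  have := measurableT_comp mu_ (measurable_addr y).
  by under eq_fun do rewrite addrC.
have m2 : measurable_fun setT (fun t => (\1_(cube l) t)%:E * ((((W \* u) (y + t)) ^+ 2)%R)%:E).
  apply: emeasurable_funM; first by apply/measurable_EFinP; exact: measurable_indic.
  apply/measurable_EFinP; apply: measurable_funX.
  have := measurableT_comp (measurable_funM mW mu_) (measurable_addr y).
  by under eq_fun do rewrite addrC.
have p1 t : 0 <= (\1_(cube l) t)%:E * (((u (y + t) - u y) ^+ 2)%R)%:E.
  by rewrite mule_ge0// lee_fin ?sqr_ge0.
have p2 t : 0 <= (\1_(cube l) t)%:E * ((((W \* u) (y + t)) ^+ 2)%R)%:E.
  by rewrite mule_ge0// lee_fin ?sqr_ge0.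
have mF : measurable_fun setT F by apply: emeasurable_funD; exact: measurable_funeM.
have F0 t : 0 <= F t by rewrite adde_ge0// mule_ge0// lee_fin.
have <- : \int[mu]_t F t = 2%:E * increment_avg u l y + (2 / s)%:E * local_mass (W \* u)%R l y.
  rewrite ge0_integralD//; [|by move=> t _; rewrite mule_ge0|exact: measurable_funeM|
    by move=> t _; rewrite mule_ge0// lee_fin|exact: measurable_funeM].
  by rewrite !ge0_integralZl_EFin.
rewrite -(ge0_integral_translate (- y)%R mF F0).
apply: (@le_trans _ _ (\int[mu]_(x in E) (u y ^+ 2)%:E)).
  rewrite integral_cst// EFinM muleC.
  by rewrite lee_wpmul2l// lee_fin sqr_ge0.
apply: (@le_trans _ _ (\int[mu]_(x in E) F (x - y)%R)); last first.
  apply: ge0_subset_integral => //.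
  exact: (measurableT_comp mF (measurable_addr (- y)%R)).
apply: ge0_le_integral => //.
- by move=> x _; rewrite lee_fin sqr_ge0.
- apply: measurable_funTS; exact: (measurableT_comp mF (measurable_addr (- y)%R)).
- move=> x Ex; rewrite /F indicE mem_set ?mul1e; last exact: EQ.
  rewrite -!EFinM -EFinD lee_fin addrCA subrr addr0 /=.
  have h := EW x Ex; rewrite exprMn.
  apply: (@le_trans _ _ (2 * (u x - u y) ^+ 2 + 2 * u x ^+ 2)%R).
    by have := sqr_ge0 (2 * u x - u y)%R; nra.
  rewrite lerD2l [leRHS]mulrA ler_wpM2r ?sqr_ge0//.
  by rewrite mulrAC ler_pdivlMr// ler_wpM2l.
Qed.

(** Compares u(y) with the mean of [u] over its cell: two points of a cell of side [l] differ by
    less than [l] in each coordinate, so the integral of (u(y) - u)^2 over the cell is at most the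
    increment integral over the cube of half-side [l]. *)
Lemma near_pointwise u (a b y : 'rV[R]_d) l : L2r mu u -> (0 < l)%R ->
  (forall i, b ord0 i - a ord0 i = l)%R -> box a b y ->
  (l ^+ d * u y ^+ 2)%:E <= 2%:E * increment_avg u l y +
    (2 / l ^+ d * ipr mu u (\1_(box a b)) ^+ 2)%:E.
Proof.
move=> u2 l0 abl yB; have [mu_ _] := u2.
set B := box a b in yB *; pose chi : 'rV[R]_d -> R := \1_B.
have ld0 : (0 < l ^+ d)%R by rewrite exprn_gt0.
have chi2 : L2r mu chi by exact: L2r_indic_box.
have mB : measurable B by exact: measurable_box.
have cc : ipr mu chi chi = (l ^+ d)%R.
  apply: EFin_inj; rewrite (ipr_sqr chi2).
  transitivity (\int[mu]_x (\1_B x)%:E).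
    by apply: eq_integral => x _; rewrite /chi indicE; case: (x \in B); rewrite ?expr1n ?expr0n.
  rewrite integral_indic// setIT [LHS]mes_box; last by move=> i; rewrite -subr_ge0 abl ltW.
  by congr EFin; rewrite (eq_bigr (fun=> l)) ?prodr_const ?card_ord.
pose uc : 'rV[R]_d -> R := (u \* chi)%R.
have uc2 : L2r mu uc.
  split; first by apply: measurable_funM => //; exact: measurable_indic.
  apply: le_lt_trans (u2.2); apply: ge0_le_integral => //.
  - by move=> x _; rewrite lee_fin sqr_ge0.
  - apply/measurable_EFinP; apply: measurable_funX.
    by apply: measurable_funM => //; exact: measurable_indic.
  - by apply/measurable_EFinP; exact: measurable_funX.
  - move=> x _; rewrite lee_fin exprMn /chi indicE; case: (x \in B).
      by rewrite expr1n mulr1.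
    by rewrite expr0n mulr0 sqr_ge0.
pose f : 'rV[R]_d -> R := (u y *: chi - uc)%R.
have f2 : L2r mu f by apply: (phB H) => //; exact: (phZ H).
have mE : ipr mu chi uc = ipr mu u chi.
  apply: eq_Rintegral => x _; rewrite /uc /chi /= indicE; case: (x \in B); rewrite ?mul1r//.
  by rewrite mul0r mulr0.
have fE : (ipr mu f f = u y ^+ 2 * l ^+ d - 2 * (u y * ipr mu u chi) + ipr mu uc uc)%R.
  have yc2 : L2r mu (u y *: chi)%R by exact: (phZ H).
  rewrite /f (ip_sqrB H yc2 uc2) (ipZl H _ chi2 yc2) (ipZr H _ chi2 chi2).
  by rewrite (ipZl H _ chi2 uc2) cc mE; ring.
have CS : (ipr mu u chi ^+ 2 <= l ^+ d * ipr mu uc uc)%R.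
  by rewrite -mE -cc; exact: (ip_CS H).
have key : (l ^+ d * u y ^+ 2 <= 2 * ipr mu f f + 2 / l ^+ d * ipr mu u chi ^+ 2)%R.
  have : (ipr mu u chi ^+ 2 / l ^+ d <= ipr mu uc uc)%R by rewrite ler_pdivrMr// mulrC.
  rewrite fE; move: (ipr mu u chi) (ipr mu uc uc) (u y) => m n v h.
  have e : (2 / l ^+ d * m ^+ 2 = 2 * (m ^+ 2 / l ^+ d))%R by rewrite mulrAC mulrA.
  (* Once [ipr mu uc uc] is bounded below by m^2 / l^d, the difference of the two sides is at least
     this perfect square. *)
  have : (0 <= l ^+ d * (v - 2 * (m / l ^+ d)) ^+ 2)%R by rewrite mulr_ge0 ?sqr_ge0// ltW.
  have -> : (l ^+ d * (v - 2 * (m / l ^+ d)) ^+ 2 =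
     l ^+ d * v ^+ 2 - 4 * (v * m) + 4 * (m ^+ 2 / l ^+ d))%R by field; rewrite gt_eqF.
  by rewrite e; lra.
apply: (@le_trans _ _ (2 * ipr mu f f + 2 / l ^+ d * ipr mu u chi ^+ 2)%:E).
  by rewrite lee_fin.
rewrite EFinD leeD2r// EFinM lee_wpmul2l// (ipr_sqr f2).
rewrite /increment_avg.
have mi : measurable_fun setT (fun t => (\1_(cube l) t)%:E * (((u (y + t) - u y) ^+ 2)%R)%:E).
  apply: emeasurable_funM; first by apply/measurable_EFinP; exact: measurable_indic.
  apply/measurable_EFinP; apply: measurable_funX; apply: measurable_funB => //.
  have := measurableT_comp mu_ (measurable_addr y).
  by under eq_fun do rewrite addrC.
rewrite -(ge0_integral_translate (- y)%R mi); last first.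
  by move=> t; rewrite mule_ge0// lee_fin ?sqr_ge0.
apply: ge0_le_integral => //.
- by move=> x _; rewrite lee_fin sqr_ge0.
- by apply/measurable_EFinP; apply: measurable_funX; case: f2.
- exact: (measurableT_comp mi (measurable_addr (- y)%R)).
- move=> x _ /=; rewrite addrCA subrr addr0.
  have -> : f x = (u y * chi x - u x * chi x)%R by [].
  rewrite -EFinM lee_fin -mulrBl exprMn /chi [in leLHS]indicE.
  have [xB|xB] := boolP (x \in B); last by rewrite expr0n/= mulr0 mulr_ge0 ?sqr_ge0.
  rewrite expr1n mulr1 indicE mem_set ?mul1r; first by rewrite -sqrrN opprB.
  move=> i; move/set_mem/(_ i) : xB; have := yB i; have := abl i; rewrite !mxE.
  move=> e /andP[h1 h2] /andP[h3 h4]; apply/andP; split; lra.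
Qed.

End averages.

(** * The finite-rank inequality for the real form *)

Section garding.
Context {R : realType} {d : nat}.
Local Notation mu := (mes R d).
Implicit Types (u : 'rV[R]_d -> R) (y : 'rV[R]_d).

Let H := @prehilbert_L2r _ _ R mu.

Variable W : 'rV[R]_d -> R.
Hypothesis mW : measurable_fun setT W.

(* Near infinity, [W^2] is large on a part of every small cube that is not too
   thin compared with the square of the side. *)
Definition thick_at_infinity := forall eps : R, 0 < eps ->
  exists l s d0 N : R, [/\ [/\ 0 < l, 0 < s & 0 < d0],
    2 / d0 * ((2 * l) ^+ d * (d%:R * l ^+ 2)) <= eps,
    2 / s / d0 * (2 * l) ^+ d <= eps &
    forall y, N < enorm y -> exists E : set 'rV[R]_d, [/\ measurable E,
      (d0%:E <= mu E)%E & forall x, E x -> cube l (x - y) /\ s <= W x ^+ 2]].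

Lemma coord_le_enorm y i : `|y ord0 i| <= enorm y.
Proof.
rewrite /enorm -sqrtr_sqr ler_wsqrtr// (bigD1 i)//= lerDl sumr_ge0// => j _.
exact: sqr_ge0.
Qed.

(** A sup-norm ball of radius l/2 is an open cube contained in the half-open box of side [l] with
    the same centre, so a finite cover by balls suffices. *)
Lemma finite_box_cover (N l : R) : 0 < l -> exists (n : nat) (c : 'I_n -> 'rV[R]_d),
  forall y, enorm y <= N -> exists j : 'I_n,
    box (c j - const_mx (l / 2)) (c j + const_mx (l / 2)) y.
Proof.
move=> l0; have l2 : 0 < l / 2 by rewrite divr_gt0.
pose K : set 'rV[R]_d := [set y | forall i, `[- N, N]%classic (y ord0 i)].
have cK : compact K.
  by apply: (@rV_compact _ _ (fun=> `[- N, N]%classic)) => i; exact: segment_compact.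
move: cK; rewrite compact_cover => cK.
have [|y Ky|D _ KD] := cK 'rV[R]_d setT (fun c => ball c (l / 2)).
- by move=> c _; exact: ball_open.
- by exists y => //; exact: ballxx.
pose s := finmap.enum_fset D.
exists (size s), (fun j => nth 0 s j) => y yN.
have Ky : K y.
  move=> i; rewrite /= in_itv/= -ler_norml.
  exact: le_trans (coord_le_enorm y i) yN.
have [c /= cD [_ cy]] := KD y Ky.
have cs : (index c s < size s)%N by rewrite index_mem.
exists (Ordinal cs) => i; rewrite !mxE nth_index//.
have := cy ord0 i; rewrite /ball/= ltr_norml => /andP[h1 h2].
by apply/andP; split; lra.
Qed.

Local Open Scope ereal_scope.

(** Each of the two estimates is enlarged by the nonnegative terms of the other, so that one
    integrand serves all [y] and the domain of integration is not split. *)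
Lemma pointwise_bound u (n : nat) (B : 'I_n -> set 'rV[R]_d) (m : 'I_n -> R)
    (l s d0 l' : R) y :
  (0 < d0)%R -> (0 < s)%R -> (0 < l')%R ->
  ((d0 * u y ^+ 2)%:E <= 2%:E * increment_avg u l y + (2 / s)%:E * local_mass (W \* u)%R l y) \/
  (exists j, B j y /\ (l' ^+ d * u y ^+ 2)%:E <= 2%:E * increment_avg u l' y +
     (2 / l' ^+ d * m j ^+ 2)%:E) ->
  (u y ^+ 2)%:E <= (2 / d0)%:E * increment_avg u l y +
    ((2 / s / d0)%:E * local_mass (W \* u)%R l y +
    ((2 / l' ^+ d)%:E * increment_avg u l' y +
     (\sum_j (2 / l' ^+ d / l' ^+ d * m j ^+ 2 * \1_(B j) y))%:E)).
Proof.
move=> d00 s0 l0; have ld0 : (0 < l' ^+ d)%R by rewrite exprn_gt0.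
have a1 : 0 <= (2 / d0)%:E * increment_avg u l y.
  by rewrite mule_ge0 ?increment_avg_ge0// lee_fin divr_ge0// ltW.
have a2 : 0 <= (2 / s / d0)%:E * local_mass (W \* u)%R l y.
  by rewrite mule_ge0 ?local_mass_ge0// lee_fin !divr_ge0// ltW.
have a3 : 0 <= (2 / l' ^+ d)%:E * increment_avg u l' y.
  by rewrite mule_ge0 ?increment_avg_ge0// lee_fin divr_ge0// ltW.
have c4 j : (0 <= 2 / l' ^+ d / l' ^+ d * m j ^+ 2)%R.
  by rewrite mulr_ge0 ?sqr_ge0// !divr_ge0// ltW.
have a4 : 0 <= (\sum_j (2 / l' ^+ d / l' ^+ d * m j ^+ 2 * \1_(B j) y))%:E.
  by rewrite lee_fin sumr_ge0// => j _; rewrite mulr_ge0.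
case=> [h|[j [yB h]]].
  have dV : (0 <= d0^-1)%R by rewrite invr_ge0 ltW.
  have := lee_wpmul2l (_ : 0 <= d0^-1%:E) h; rewrite lee_fin => /(_ dV).
  rewrite -EFinM mulrA mulVf ?gt_eqF// mul1r ge0_muleDr; last 2 first.
  - by rewrite mule_ge0 ?increment_avg_ge0// lee_fin.
  - by rewrite mule_ge0 ?local_mass_ge0// lee_fin divr_ge0// ltW.
  rewrite !muleA -!EFinM ![(d0^-1 * _)%R]mulrC => /le_trans; apply.
  by rewrite leeD2l// leeDl// adde_ge0.
have dV : (0 <= (l' ^+ d)^-1)%R by rewrite invr_ge0 ltW.
have := lee_wpmul2l (_ : 0 <= (l' ^+ d)^-1%:E) h; rewrite lee_fin => /(_ dV).
rewrite -EFinM mulrA mulVf ?gt_eqF// mul1r ge0_muleDr; last 2 first.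
- by rewrite mule_ge0 ?increment_avg_ge0// lee_fin.
- by rewrite lee_fin mulr_ge0 ?sqr_ge0// divr_ge0// ltW.
rewrite !muleA -!EFinM ![((l' ^+ d)^-1 * _)%R]mulrC => /le_trans; apply.
rewrite addeA; apply: (@le_trans _ _ ((2 / l' ^+ d)%:E * increment_avg u l' y +
     (\sum_j (2 / l' ^+ d / l' ^+ d * m j ^+ 2 * \1_(B j) y))%:E)).
  rewrite leeD2l// lee_fin (bigD1 j)//= indicE mem_set// mulr1.
  rewrite [X in (X <= _)%R](_ : _ = 2 / l' ^+ d / l' ^+ d * m j ^+ 2)%R; last by ring.
  by rewrite lerDl sumr_ge0// => k _; rewrite mulr_ge0.
by rewrite leeDr// adde_ge0.
Qed.

Lemma integral_sum_indic n (B : 'I_n -> set 'rV[R]_d) (c : 'I_n -> R) (v : R) :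
  (forall j, measurable (B j)) -> (forall j, mu (B j) = v%:E) -> (forall j, (0 <= c j)%R) ->
  \int[mu]_y (\sum_j c j * \1_(B j) y)%:E = (\sum_j c j * v)%:E.
Proof.
move=> mB hB c0; under eq_integral do rewrite -sumEFin.
rewrite ge0_integral_sum//; last 2 first.
- by move=> j; apply/measurable_EFinP; apply: measurable_funM => //; exact: measurable_indic.
- by move=> j y _; rewrite lee_fin mulr_ge0.
rewrite -sumEFin; apply: eq_bigr => j _.
under eq_integral do rewrite EFinM.
rewrite ge0_integralZl_EFin//; last by apply/measurable_EFinP; exact: measurable_indic.
by rewrite integral_indic// setIT EFinM; congr (_ * _); exact: hB.
Qed.

Local Close Scope ereal_scope.

Lemma garding_real_form : thick_at_infinity ->
  finite_rank_garding (L2r mu) (real_domain W) (ipr mu) (real_form W).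
Proof.
(* Half of [eps] for each scale: the gradient term is charged once with cubes of size [l] far away
   and once with cells of side [l'] on the ball. *)
move=> thick eps eps0; pose e := eps / 2.
have e0 : 0 < e by rewrite divr_gt0.
have [l [s [d0 [N [[l0 s0 d00] c1 c2 far]]]]] := thick _ e0.
(* The gradient constant of the cells is 2 * 2^d * d * l'^2; as l' <= 1 it is at most M l' <= e. The
   [+ 1] keeps [M] positive. *)
pose M : R := 2 * 2 ^+ d * d%:R + 1.
have M0 : 0 < M by rewrite ltr_wpDl// mulr_ge0// mulr_ge0// exprn_ge0.
pose l' := Num.min 1 (e / M).
have l'0 : 0 < l' by rewrite lt_min ltr01 divr_gt0.
have ld0 : 0 < l' ^+ d by rewrite exprn_gt0.
have c3 : 2 / l' ^+ d * ((2 * l') ^+ d * (d%:R * l' ^+ 2)) <= e.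
  rewrite exprMn [leLHS](_ : _ = 2 * 2 ^+ d * d%:R * l' ^+ 2); last by field; rewrite gt_eqF.
  have h1 : l' ^+ 2 <= l' by rewrite expr2 ger_pMl// ge_min lexx.
  have h2 : l' * M <= e by rewrite -ler_pdivlMr// ge_min lexx orbT.
  apply: le_trans h2; rewrite mulrC ler_pM ?sqr_ge0 ?mulr_ge0 ?exprn_ge0//.
  by rewrite /M lerDl.
have [n [c hc]] := finite_box_cover N l'0.
pose B j := box (c j - const_mx (l' / 2)) (c j + const_mx (l' / 2)).
have mB j : measurable (B j) by exact: measurable_box.
have vB j : mu (B j) = (l' ^+ d)%:E.
  rewrite [LHS]mes_box; last by move=> i; rewrite !mxE; lra.
  by congr EFin; rewrite (eq_bigr (fun=> l')) ?prodr_const ?card_ord// => i _; rewrite !mxE; lra.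
have chi2 j : L2r mu (\1_(B j) : 'rV[R]_d -> R) by exact: L2r_indic_box.
exists n, (fun j => \1_(B j)), (2 / l' ^+ d); split=> //.
  by rewrite divr_ge0// ltW.
move=> u [u2 hu Wu].
have [mu_ _] := u2; have [mWu _] := Wu.
have g2 i : L2r mu (wp i u) by have [] := wp_in (hu i).
have wg i : is_wp i u (wp i u) by have [] := wp_in (hu i).
set G := \sum_i ipr mu (wp i u) (wp i u).
set V := ipr mu (W \* u) (W \* u).
have G0 : 0 <= G by apply: sumr_ge0 => i _; exact: (ip_ge0 H).
have V0 : 0 <= V by exact: (ip_ge0 H).
pose m j := ipr mu u (\1_(B j)).
have pw y : ((u y ^+ 2)%:E <= (2 / d0)%:E * increment_avg u l y +
    ((2 / s / d0)%:E * local_mass (W \* u)%R l y +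
    ((2 / l' ^+ d)%:E * increment_avg u l' y +
     (\sum_j (2 / l' ^+ d / l' ^+ d * m j ^+ 2 * \1_(B j) y))%:E)))%E.
  apply: pointwise_bound => //.
  have [yN|yN] := leP (enorm y) N; [right|left].
    have [j yB] := hc y yN; exists j; split=> //.
    by apply: near_pointwise => // i; rewrite !mxE; lra.
  have [E [mE hE EW]] := far y yN.
  by apply: (far_pointwise (E := E)) => //; [move=> x /EW[]|move=> x /EW[]|exact: ltW].
have a1 y : (0 <= (2 / d0)%:E * increment_avg u l y)%E.
  by rewrite mule_ge0 ?increment_avg_ge0// lee_fin divr_ge0// ltW.
have a2 y : (0 <= (2 / s / d0)%:E * local_mass (W \* u)%R l y)%E.
  by rewrite mule_ge0 ?local_mass_ge0// lee_fin !divr_ge0// ltW.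
have a3 y : (0 <= (2 / l' ^+ d)%:E * increment_avg u l' y)%E.
  by rewrite mule_ge0 ?increment_avg_ge0// lee_fin divr_ge0// ltW.
have c4 j : 0 <= 2 / l' ^+ d / l' ^+ d * m j ^+ 2.
  by rewrite mulr_ge0 ?sqr_ge0// !divr_ge0// ltW.
have a4 y : (0 <= (\sum_j (2 / l' ^+ d / l' ^+ d * m j ^+ 2 * \1_(B j) y))%:E)%E.
  by rewrite lee_fin sumr_ge0// => j _; rewrite mulr_ge0.
have m1 : measurable_fun setT (fun y => (2 / d0)%:E * increment_avg u l y)%E.
  by apply: measurable_funeM; exact: measurable_increment_avg.
have m2 : measurable_fun setT (fun y => (2 / s / d0)%:E * local_mass (W \* u)%R l y)%E.
  by apply: measurable_funeM; exact: measurable_local_mass.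
have m3 : measurable_fun setT (fun y => (2 / l' ^+ d)%:E * increment_avg u l' y)%E.
  by apply: measurable_funeM; exact: measurable_increment_avg.
have m4 : measurable_fun setT
    (fun y => (\sum_j (2 / l' ^+ d / l' ^+ d * m j ^+ 2 * \1_(B j) y))%:E).
  apply/measurable_EFinP; apply: measurable_sum => j.
  by apply: measurable_funM => //; exact: measurable_indic.
have : (\int[mu]_y (u y ^+ 2)%:E <= \int[mu]_y ((2 / d0)%:E * increment_avg u l y +
    ((2 / s / d0)%:E * local_mass (W \* u)%R l y +
    ((2 / l' ^+ d)%:E * increment_avg u l' y +
     (\sum_j (2 / l' ^+ d / l' ^+ d * m j ^+ 2 * \1_(B j) y))%:E))))%E.
  apply: ge0_le_integral => //.
  - by move=> y _; rewrite lee_fin sqr_ge0.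
  - by apply/measurable_EFinP; exact: measurable_funX.
  - by do !apply: emeasurable_funD.
rewrite -(ipr_sqr u2) ge0_integralD//; last 2 first.
- by move=> y _; do !apply: adde_ge0.
- by do !apply: emeasurable_funD.
rewrite ge0_integralD//; last 2 first.
- by move=> y _; do !apply: adde_ge0.
- by do !apply: emeasurable_funD.
rewrite ge0_integralD// (integral_sum_indic mB vB c4).
rewrite ge0_integralZl_EFin//; last 3 first.
- by move=> y _; exact: increment_avg_ge0.
- exact: measurable_increment_avg.
- by rewrite divr_ge0// ltW.
rewrite ge0_integralZl_EFin//; last 3 first.
- by move=> y _; exact: local_mass_ge0.
- exact: measurable_local_mass.
- by rewrite !divr_ge0// ltW.
rewrite ge0_integralZl_EFin//; last 3 first.
- by move=> y _; exact: increment_avg_ge0.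
- exact: measurable_increment_avg.
- by rewrite divr_ge0// ltW.
move=> main; rewrite -lee_fin.
apply: (le_trans main).
have i1 := integral_increment_avg (ltW l0) u2 g2 wg.
have i2 := integral_local_mass (ltW l0) Wu.
have i3 := integral_increment_avg (ltW l'0) u2 g2 wg.
apply: (@le_trans _ _ ((2 / d0 * ((2 * l) ^+ d * (d%:R * l ^+ 2 * G)))%:E +
  ((2 / s / d0 * ((2 * l) ^+ d * V))%:E + ((2 / l' ^+ d *
     ((2 * l') ^+ d * (d%:R * l' ^+ 2 * G)))%:E +
   (\sum_j (2 / l' ^+ d / l' ^+ d * m j ^+ 2 * l' ^+ d))%:E)))%E).
  apply: leeD; first by rewrite [leRHS]EFinM lee_wpmul2l// lee_fin divr_ge0// ltW.
  apply: leeD; first by rewrite [leRHS]EFinM lee_wpmul2l// lee_fin !divr_ge0// ltW.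
  by rewrite leeD2r// [leRHS]EFinM lee_wpmul2l// lee_fin divr_ge0// ltW.
rewrite -!EFinD lee_fin.
rewrite [X in _ + (_ + (_ + X))](_ : _ = 2 / l' ^+ d * \sum_j m j ^+ 2); last first.
  by rewrite mulr_sumr; apply: eq_bigr => j _; field; rewrite gt_eqF.
rewrite !addrA lerD2r /real_form -/G -/V.
have h1 := ler_wpM2r G0 c1; have h2 := ler_wpM2r V0 c2; have h3 := ler_wpM2r G0 c3.
have ee : eps = e + e by rewrite /e -splitr.
have hV : 0 <= e * V by rewrite mulr_ge0// ltW.
rewrite ee mulrDr.
have -> : 2 / d0 * ((2 * l) ^+ d * (d%:R * l ^+ 2 * G)) =
  2 / d0 * ((2 * l) ^+ d * (d%:R * l ^+ 2)) * G by ring.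
have -> : 2 / s / d0 * ((2 * l) ^+ d * V) = 2 / s / d0 * (2 * l) ^+ d * V by ring.
have -> : 2 / l' ^+ d * ((2 * l') ^+ d * (d%:R * l' ^+ 2 * G)) =
  2 / l' ^+ d * ((2 * l') ^+ d * (d%:R * l' ^+ 2)) * G by ring.
by lra.
Qed.

End garding.

(** * From the rearrangement to thick sets *)

Section thickness.
Context {R : realType} {d : nat}.
Local Notation mu := (mes R d).
Implicit Types (G : set 'rV[R]_d) (V : 'rV[R]_d -> R) (y : 'rV[R]_d).

Lemma dilateE G r y : dilate G r y = [set z | G (r^-1 *: (z - y))].
Proof.
apply/seteqP; split=> [_ [x Gx <-]|z Gz] /=; first by rewrite addrK.
by exists (z - y); rewrite //= subrK.
Qed.

Lemma measurable_dilate G r y : open G -> measurable (dilate G r y).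
Proof.
move=> oG; rewrite dilateE.
have mf : measurable_fun setT (fun z : 'rV[R]_d => r^-1 *: (z - y)).
  apply: measurable_rV => i; under eq_fun do rewrite !mxE.
  apply: measurable_funM => //; apply: measurable_funB => //.
  exact: measurable_coord.
by rewrite -[X in measurable X]setTI; apply: mf => //; exact: measurable_open_rV.
Qed.

Lemma cube_sub_eball (rho : R) : 0 < rho ->
  cube (rho / d.+1%:R) `<=` @eball R d rho.
Proof.
move=> rho0 x cx; rewrite /eball/= /enorm.
set k := rho / d.+1%:R in cx.
have k0 : 0 < k by rewrite divr_gt0.
have -> : rho = Num.sqrt (rho ^+ 2) by rewrite sqrtr_sqr gtr0_norm.
rewrite ltr_sqrt ?exprn_gt0//.
have /le_lt_trans : \sum_i x ord0 i ^+ 2 <= \sum_(i < d) k ^+ 2.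
  apply: ler_sum => i _; have := cx i; rewrite !mxE => /andP[h1 h2].
  by rewrite -real_normK ?num_real// lerXn2r ?nnegrE ?(ltW k0)// ler_norml ltW.
apply; rewrite sumr_const card_ord -mulr_natr.
have -> : rho = k * d.+1%:R by rewrite divfK.
rewrite [ltRHS]exprMn ltr_pM2l ?exprn_gt0// -natrX ltr_nat.
by rewrite (leq_trans (ltnSn d))// leq_pmulr.
Qed.

(** As 0 lies in [G] and the diameter is 2, points of the dilate are within 2 r of [y]; a point of
    the closure adds at most another r. *)
Lemma closure_dilate_sub G r y : 0 < r -> G 0 -> ediam G = 2%:E ->
  closure (dilate G r y) `<=` [set x | cube (3 * r) (x - y)].
Proof.
move=> r0 G0 dG x clx i; have /clx[w []] : nbhs x (ball x r) by exact: nbhsx_ballx.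
rewrite dilateE/= => Gw [_ /(_ ord0 i)]; rewrite /ball/= !mxE => xw.
have h : enorm (r^-1 *: (w - y)) <= 2.
  rewrite -lee_fin -dG; apply: ereal_sup_ubound => /=.
  by exists (r^-1 *: (w - y)) => //; exists 0 => //; rewrite subr0.
have /(le_trans (coord_le_enorm _ i)) := h.
rewrite !mxE normrM gtr0_norm ?invr_gt0// mulrC ler_pdivrMr// ler_norml.
by move: xw; rewrite ltr_norml => /andP[h1 h2] /andP[h3 h4]; apply/andP; split; lra.
Qed.

(** The upper limit is at most the supremum over any right neighbourhood of 0, in particular over
    (0, r0). *)
Lemma limf_esup_right_ub (f : R -> \bar R) (r0 : R) (A : R) : 0 < r0 ->
  limf_esup f 0^'+ = +oo%E -> exists2 r, 0 < r < r0 & (A%:E < f r)%E.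
Proof.
move=> r00 flim.
have : (limf_esup f 0^'+ <= ereal_sup (f @` [set r | 0 < r < r0]%R))%E.
  rewrite limf_esupE; apply: ereal_inf_lbound => /=; exists [set r | 0 < r < r0] => //.
  near=> r; apply/andP; split; near: r; [exact: nbhs_right_gt|exact: nbhs_right_lt].
rewrite flim leye_eq => /eqP fsup.
have /ereal_sup_gt[_ [r rr0 <-] Af] : (A%:E < ereal_sup (f @` [set r | 0 < r < r0]%R))%E.
  by rewrite fsup ltry.
by exists r.
Unshelve. all: by end_near. Qed.

Lemma rearrangement_gt V G t y r s : 0 < s -> (s%:E < rearrangement V G t y r)%E ->
  exists2 s', s < s' & (t <= mu [set x | closure (dilate G r y) x /\ (s' <= V x)%R])%E.
Proof.
move=> s0 /ereal_sup_gt[_ [->|[s' [_ ts'] <-]]].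
  by rewrite lte_fin => /(lt_trans s0); rewrite ltxx.
by rewrite lte_fin => ss'; exists s'.
Qed.

Lemma thick_at_infinity_sqrt V G (r0 : R) (gamma : R -> R) :
  (2 <= d)%N -> measurable_fun setT V -> admissible_domain G -> 0 < r0 ->
  (forall r, 0 < r < r0 -> 0 < gamma r < 1) ->
  limf_esup
     (fun r : R => (r `^ (- (2 * (d%:R - 2) / d%:R)) * gamma r)%:E) 0^'+ = +oo%E ->
  (forall r, 0 < r < r0 ->
     tends_to_infty (fun y =>
       rearrangement V G ((gamma r)%:E * mu (dilate G r 0))%E y r)) ->
  thick_at_infinity (fun x => Num.sqrt (Num.max (V x) 0)).
Proof.
move=> d2 mV [oG _ _ [rho [rho0 rhoG _]] dG] r00 hgamma hlimsup hlim eps eps0.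
pose k := rho / d.+1%:R.
have k0 : 0 < k by rewrite divr_gt0.
have kG : cube k `<=` G by apply: subset_trans rhoG; exact: cube_sub_eball.
have G0 : G 0 by apply: rhoG; rewrite /eball/= /enorm big1 ?sqrtr0// => i _; rewrite mxE expr0n.
have d_gt0 : 0 < d%:R :> R by rewrite ltr0n (leq_trans _ d2).
(* With l = 3 r and d0 = g (2 k r)^d, the first constant of [thick_at_infinity] equals C r^2 / g;
   here 18 is 2 * 3^2, and (3/k)^d is the ratio of the volumes of the two cubes. *)
pose C := 18 * d%:R * (3 / k) ^+ d.
have C0 : 0 < C by rewrite !mulr_gt0// exprn_gt0// divr_gt0.
(* A radius below 1 is needed for r^2 to be at most the power of r in the limsup hypothesis. *)
have m0 : 0 < Num.min r0 1 by rewrite lt_min r00/=.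
have [r /andP[r_gt0]] := limf_esup_right_ub (C / eps) m0 hlimsup.
rewrite lt_min => /andP[rr0 r1]; rewrite lte_fin => hr.
have rr : 0 < r < r0 by rewrite r_gt0.
have /andP[g0 g1] := hgamma r rr.
set g := gamma r in g0 g1 hr.
have gr : C / eps * r ^+ 2 <= g.
  set p := 2 * (d%:R - 2) / d%:R in hr.
  have rp0 : 0 < r `^ p by exact: powR_gt0.
  move: hr; rewrite powRN [ltRHS]mulrC ltr_pdivlMr// => /ltW; apply: le_trans.
  rewrite ler_pM2l ?divr_gt0// -powR_mulrn ?(ltW r_gt0)//.
  apply: ger_powR; first by rewrite r_gt0 ltW.
  rewrite /p ler_pdivrMr//; lra.
(* A lower bound for the measure in the rearrangement: the dilate of [G] contains a cube of
   half-side k r. *)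
pose d0 := g * (2 * (k * r)) ^+ d.
have kr0 : 0 < k * r by rewrite mulr_gt0.
have d00 : 0 < d0 by rewrite mulr_gt0// exprn_gt0// mulr_gt0.
have l0 : 0 < 3 * r by rewrite mulr_gt0.
have ld0 : 0 < (2 * (3 * r)) ^+ d by rewrite exprn_gt0// mulr_gt0.
(* Solves the second condition of [thick_at_infinity] with equality. *)
pose s := 2 * (2 * (3 * r)) ^+ d / (d0 * eps).
have s0 : 0 < s by apply: divr_gt0; apply: mulr_gt0.
(* The level [s + 1] leaves room for a strict inequality, which the supremum in [rearrangement]
   needs in order to yield an attained level above [s]. *)
have [N hN] := hlim r rr (s + 1).
exists (3 * r), s, d0, N; split=> //.
- have -> : 2 / d0 * ((2 * (3 * r)) ^+ d * (d%:R * (3 * r) ^+ 2)) = C * r ^+ 2 / g.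
    have -> : 2 * (3 * r) = (3 / k) * (2 * (k * r)) by field; rewrite gt_eqF.
    rewrite /d0 /C [((3 / k) * _) ^+ d]exprMn; field.
    by rewrite expf_neq0 ?gt_eqF// mulr_gt0.
  by rewrite ler_pdivrMr// -ler_pdivrMl// mulrA [_ * C]mulrC.
- rewrite le_eqVlt; apply/orP; left; apply/eqP; rewrite /s; field.
  by rewrite !gt_eqF.
- move=> y /hN hy.
  have [|s' ss' hs'] := @rearrangement_gt V G (g%:E * mu (dilate G r 0))%E y r s s0.
    by apply: lt_le_trans hy; rewrite lte_fin ltrDl.
  exists [set x | closure (dilate G r y) x /\ s' <= V x]; split.
  + apply: measurableI; first by apply: measurable_closed_rV; exact: closed_closure.
    rewrite [X in measurable X](_ : _ = V @^-1` `[s', +oo[%classic); last first.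
      by apply/seteqP; split=> x; rewrite /= in_itv/= andbT.
    by rewrite -[X in measurable X]setTI; apply: mV.
  + apply: le_trans hs'; rewrite /d0 EFinM lee_pmul2l// -mes_cube ?(ltW kr0)//.
    apply: le_measure; rewrite ?inE.
    * exact: measurable_box.
    * exact: measurable_dilate.
    move=> x cx; rewrite dilateE/= subr0; apply: kG => i.
    have := cx i; rewrite !mxE => /andP[h1 h2].
    by rewrite ler_pdivrMl// ltr_pdivlMl// mulrN [r * k]mulrC h1 h2.
  + move=> x [clx s'V]; split; first exact: (closure_dilate_sub r_gt0 G0 dG clx).
    have V0 : s <= V x by rewrite (le_trans (ltW ss')).
    by rewrite sqr_sqrtr ?le_max ?V0// lexx orbT.
Qed.

End thickness.

(** * Counting real eigenvalues *)

Section eigenvalues.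
Context {R : realType} {E : lmodType R} (L D : set E) (ip q : E -> E -> R).
Hypothesis HL : prehilbert L ip.
Hypothesis HD : prehilbert D q.
Hypothesis DL : D `<=` L.
Hypothesis garding : finite_rank_garding L D ip q.
Local Notation op := (operator_of L D ip q).
Implicit Types (a b : R) (u v : E).

Definition real_eigenvalue a := exists2 u, op u (a *: u) & ip u u != 0.

Lemma eigenvectors_orthogonal a b u v : op u (a *: u) -> op v (b *: v) ->
  a != b -> ip u v = 0.
Proof.
move=> [Du _ qu] [Dv _ qv] ab; have Lu := DL Du; have Lv := DL Dv.
have : a * ip u v = b * ip u v.
  by rewrite -(ipZl HL)// -qu// (ipC HD Du Dv) qv// (ipZl HL)// (ipC HL Lv Lu).
by move/eqP; rewrite -subr_eq0 -mulrBl mulf_eq0 subr_eq0 (negPf ab)/= => /eqP.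
Qed.

(** Normalised eigenvectors of distinct eigenvalues are orthonormal, and [q] takes the eigenvalue
    itself on each of them, so [orthonormal_bounded] applies. *)
Lemma eigenvalues_bounded_card M : 0 <= M -> exists N : nat,
  forall (n : nat) (a : 'I_n -> R), injective a ->
    (forall i, a i <= M /\ real_eigenvalue (a i)) -> (n <= N)%N.
Proof.
move=> M0; have [N hN] := orthonormal_bounded HL DL garding M0.
exists N => n a ainj ha.
have /choice[u hu] : forall i, exists u, op u (a i *: u) /\ ip u u = 1.
  move=> i; have [_ [u [Du _ qu] uu]] := ha i; have Lu := DL Du.
  have c0 : 0 < ip u u by rewrite lt_neqAle eq_sym uu (ip_ge0 HL).
  pose c := (Num.sqrt (ip u u))^-1.
  exists (c *: u); split; last first.
    rewrite (ipZl HL) ?(ipZr HL)//; try exact: (phZ HL).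
    by rewrite mulrA -expr2 exprVn sqr_sqrtr ?ltW// mulVf.
  split; [exact: (phZ HD)|by do 2 apply: (phZ HL)|move=> v Dv].
  have Lv := DL Dv.
  by rewrite scalerA mulrC -scalerA (ipZl HD)// qu// [RHS](ipZl HL)//; exact: (phZ HL).
have Du i : D (u i) by case: (hu i) => -[].
apply: (hN n u) => // [i j|i].
  have [<-|ij] := eqVneq i j; first by case: (hu i).
  have [[hi _] [hj _]] := (hu i, hu j).
  by rewrite (eigenvectors_orthogonal hi hj)// (inj_eq ainj).
have [[_ _ qu] uu] := hu i; have Lu := DL (Du i).
by rewrite qu// (ipZl HL)// uu mulr1; case: (ha i).
Qed.

End eigenvalues.

(** * Complex functions through real and imaginary parts *)

Section complex_functions.
Context {R : realType} {d : nat}.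
Local Notation mu := (mes R d).
Local Notation fn := ('rV[R]_d -> R[i]).
Implicit Types (u v f g : fn) (w : 'rV[R]_d -> R) (i : 'I_d).

Definition rpart u : 'rV[R]_d -> R := fun x => complex.Re (u x).
Definition ipart u : 'rV[R]_d -> R := fun x => complex.Im (u x).

Let H := @prehilbert_L2r _ _ R mu.

Lemma L2E u : L2 u <-> L2r mu (rpart u) /\ L2r mu (ipart u).
Proof. by rewrite /L2/= !L2rP. Qed.

Lemma innerE u v : L2 u -> L2 v -> inner u v = Complex
  (ipr mu (rpart u) (rpart v) + ipr mu (ipart u) (ipart v))
  (ipr mu (ipart u) (rpart v) - ipr mu (rpart u) (ipart v)).
Proof.
move=> /L2E[ur ui] /L2E[vr vi]; rewrite /inner /cintegral /ipr.
congr Complex.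
  rewrite -RintegralD//; try exact: L2r_mul_integrable.
  apply: eq_Rintegral => x _; rewrite /rpart /ipart.
  by case: (u x) (v x) => a b [c e] /=; rewrite mulrN opprK.
rewrite -RintegralB//; try exact: L2r_mul_integrable.
apply: eq_Rintegral => x _; rewrite /rpart /ipart.
by case: (u x) (v x) => a b [c e] /=; rewrite mulrN addrC.
Qed.

Lemma cintegral_mulr u w : cintegral (fun x => u x * (w x)%:C%C) =
  Complex (ipr mu (rpart u) w) (ipr mu (ipart u) w).
Proof.
rewrite /cintegral /ipr; congr Complex; apply: eq_Rintegral => x _;
  by rewrite /rpart /ipart; case: (u x) => a b /=; rewrite mulr0 ?subr0 ?add0r.
Qed.

Lemma weak_partialsE i u g : weak_partials i u g <->
  wps i (rpart u) (rpart g) /\ wps i (ipart u) (ipart g).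
Proof.
split=> [[/L2E[gr gi] h]|[[gr hr] [gi hi]]].
  by split; split=> // phi tphi; have := h phi tphi; rewrite !cintegral_mulr => -[].
split; first exact/L2E.
by move=> phi tphi; rewrite !cintegral_mulr hr// hi.
Qed.

Lemma weak_partials_neq0 i u : weak_partials i u !=set0 <->
  wps i (rpart u) !=set0 /\ wps i (ipart u) !=set0.
Proof.
split=> [[g /weak_partialsE[gr gi]]|[[gr hr] [gi hi]]].
  by split; [exists (rpart g)|exists (ipart g)].
by exists (fun x => Complex (gr x) (gi x)); apply/weak_partialsE.
Qed.

Lemma weak_partial_in i u : weak_partials i u !=set0 ->
  weak_partials i u (weak_partial i u).
Proof. by case=> g hg; rewrite /weak_partial; case: xgetP => // h; have := h g. Qed.

Lemma sqr_normc (z : R[i]) :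
  ComplexField.Normc.normc z ^+ 2 = complex.Re z ^+ 2 + complex.Im z ^+ 2.
Proof. by case: z => a b /=; rewrite sqr_sqrtr ?addr_ge0 ?sqr_ge0. Qed.

Lemma aeq0E u : L2 u -> aeq u (fun=> 0) <->
  ipr mu (rpart u) (rpart u) + ipr mu (ipart u) (ipart u) = 0.
Proof.
move=> /L2E[ur ui]; split=> [u0|/eqP].
  rewrite !ae_eq0_ipr ?addr0//; apply: filterS u0 => x.
    by rewrite /ipart => ->.
  by rewrite /rpart => ->.
rewrite paddr_eq0 ?(ip_ge0 H)// => /andP[/eqP/(ipr_eq0 ur) r0 /eqP/(ipr_eq0 ui) i0].
apply: filterS2 r0 i0 => x; rewrite /rpart /ipart.
by case: (u x) => a b /= -> ->.
Qed.

Variables V W : 'rV[R]_d -> R.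
Hypothesis mV : measurable_fun setT V.
Hypothesis mW : measurable_fun setT W.
Hypothesis VW : {ae mu, forall x, V x = W x ^+ 2}.

Let m2 w : measurable_fun setT w -> measurable_fun setT (fun x => (w x ^+ 2)%:E).
Proof. by move=> mw; apply/measurable_EFinP; exact: measurable_funX. Qed.

Lemma integrable_potentialE u : L2 u ->
  mu.-integrable setT
    (fun x => (V x * ComplexField.Normc.normc (u x) ^+ 2)%:E) <->
  L2r mu (W \* rpart u) /\ L2r mu (W \* ipart u).
Proof.
move=> /L2E[[mr _] [mi _]].
have mWr : measurable_fun setT (W \* rpart u) by exact: measurable_funM.
have mWi : measurable_fun setT (W \* ipart u) by exact: measurable_funM.
have mVu : measurable_fun setT
    (fun x => (V x * ComplexField.Normc.normc (u x) ^+ 2)%:E).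
  apply/measurable_EFinP; apply: measurable_funM => //.
  under eq_fun do rewrite sqr_normc.
  by apply: measurable_funD; apply: measurable_funX.
have e : (\int[mu]_x `|(V x * ComplexField.Normc.normc (u x) ^+ 2)%:E| =
    \int[mu]_x ((W \* rpart u) x ^+ 2)%:E + \int[mu]_x ((W \* ipart u) x ^+ 2)%:E)%E.
  rewrite -ge0_integralD//; try exact: m2; try by move=> x _; rewrite lee_fin sqr_ge0.
  apply: ge0_ae_eq_integral => //.
  - exact: measurableT_comp.
  - by apply: emeasurable_funD; exact: m2.
  - by move=> x _; rewrite -EFinD lee_fin addr_ge0 ?sqr_ge0.
  apply: filterS VW => x VWx _; rewrite -EFinD VWx sqr_normc/= /rpart /ipart.
  have h : 0 <= W x ^+ 2 * (complex.Re (u x) ^+ 2 + complex.Im (u x) ^+ 2).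
    by rewrite mulr_ge0 ?addr_ge0 ?sqr_ge0.
  by rewrite (ger0_norm h) !exprMn mulrDr.
have p0 w : (0 <= \int[mu]_x (w x ^+ 2)%:E)%E.
  by apply: integral_ge0 => x _; rewrite lee_fin sqr_ge0.
split=> [/integrableP[_]|[[_ hr] [_ hi]]]; last first.
  by apply/integrableP; split=> //; rewrite e lte_add_pinfty.
rewrite e => h; split; split=> //.
  by apply: le_lt_trans h; rewrite leeDl.
by apply: le_lt_trans h; rewrite leeDr.
Qed.

Lemma form_domainE u : form_domain V u <->
  real_domain W (rpart u) /\ real_domain W (ipart u).
Proof.
split=> [[[u2 hu] Vu]|[[ur hr Wr] [ui hi Wi]]].
  have /integrable_potentialE := Vu => /(_ u2)[Wr Wi].
  have /L2E[ur ui] := u2.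
  by split; split=> // i; have /weak_partials_neq0[] := hu i.
have u2 : L2 u by exact/L2E.
split; last exact/integrable_potentialE.
by split=> // i; apply/weak_partials_neq0.
Qed.

Local Opaque wp ipr.

(** [weak_partial] and [wp] choose representatives independently; they agree almost everywhere,
    which is all that inner products see. *)
Lemma inner_weak_partial i u v :
  weak_partials i u !=set0 -> weak_partials i v !=set0 ->
  inner (weak_partial i u) (weak_partial i v) = Complex
  (ipr mu (wp i (rpart u)) (wp i (rpart v)) + ipr mu (wp i (ipart u)) (wp i (ipart v)))
  (ipr mu (wp i (ipart u)) (wp i (rpart v)) - ipr mu (wp i (rpart u)) (wp i (ipart v))).
Proof.
move=> /weak_partial_in hu /weak_partial_in hv.
have [u2 _] := hu; have [v2 _] := hv; rewrite innerE//.
have [[ur2 ur] [ui2 ui]] := (weak_partialsE _ _ _).1 hu.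
have [[vr2 vr] [vi2 vi]] := (weak_partialsE _ _ _).1 hv.
have key (a b ga gb : 'rV[R]_d -> R) : L2r mu ga -> is_wp i a ga ->
    L2r mu gb -> is_wp i b gb -> ipr mu (wp i a) (wp i b) = ipr mu ga gb.
  move=> ga2 wa gb2 wb; have [b2 _] : L2r mu (wp i b) /\ is_wp i b (wp i b).
    by apply: wp_in; exists gb.
  by rewrite (ipr_wp ga2 wa b2) (ipC H ga2 b2) (ipr_wp gb2 wb ga2) (ipC H gb2 ga2).
by rewrite (key _ _ _ _ ur2 ur vr2 vr) (key _ _ _ _ ui2 ui vi2 vi)
  (key _ _ _ _ ui2 ui vr2 vr) (key _ _ _ _ ur2 ur vi2 vi).
Qed.

Lemma cintegral_ae f g :
  measurable_fun setT (rpart f) -> measurable_fun setT (ipart f) ->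
  measurable_fun setT (rpart g) -> measurable_fun setT (ipart g) ->
  aeq f g -> cintegral f = cintegral g.
Proof.
move=> fr fi gr gi fg; rewrite /cintegral /Rintegral.
congr (Complex (fine _) (fine _)); apply: ae_eq_integral => //;
  try (by apply/measurable_EFinP); by apply: filterS fg => x -> _.
Qed.

Let rpart_mulr w u : rpart (fun x => (w x)%:C%C * u x) = w \* rpart u.
Proof. by apply/funext => x; rewrite /= /rpart; case: (u x) => a b /=; rewrite mul0r subr0. Qed.

Let ipart_mulr w u : ipart (fun x => (w x)%:C%C * u x) = w \* ipart u.
Proof. by apply/funext => x; rewrite /= /ipart; case: (u x) => a b /=; rewrite mul0r addr0. Qed.

Let measurable_mulc f g :
  measurable_fun setT (rpart f) -> measurable_fun setT (ipart f) ->
  measurable_fun setT (rpart g) -> measurable_fun setT (ipart g) ->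
  measurable_fun setT (rpart (fun x => f x * conjc (g x))) /\
  measurable_fun setT (ipart (fun x => f x * conjc (g x))).
Proof.
move=> fr fi gr gi; split.
  rewrite (_ : rpart _ = fun x => rpart f x * rpart g x + ipart f x * ipart g x).
    by apply: measurable_funD; exact: measurable_funM.
  apply/funext => x; rewrite /rpart /ipart.
  by case: (f x) (g x) => a b [c e] /=; rewrite mulrN opprK.
rewrite (_ : ipart _ = fun x => ipart f x * rpart g x - rpart f x * ipart g x).
  by apply: measurable_funB; exact: measurable_funM.
apply/funext => x; rewrite /rpart /ipart.
by case: (f x) (g x) => a b [c e] /=; rewrite mulrN addrC.
Qed.

Lemma inner_potential u v : L2 u -> L2 v ->
  L2 (fun x => (W x)%:C%C * u x) -> L2 (fun x => (W x)%:C%C * v x) ->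
  inner (fun x => (V x)%:C%C * u x) v =
  inner (fun x => (W x)%:C%C * u x) (fun x => (W x)%:C%C * v x).
Proof.
move=> /L2E[[mur _] [mui _]] /L2E[[mvr _] [mvi _]].
move=> /L2E[[mWur _] [mWui _]] /L2E[[mWvr _] [mWvi _]]; rewrite /inner.
have mVu : measurable_fun setT (rpart (fun x => (V x)%:C%C * u x)) /\
    measurable_fun setT (ipart (fun x => (V x)%:C%C * u x)).
  by rewrite rpart_mulr ipart_mulr; split; exact: measurable_funM.
have [mVur mVui] := mVu.
have [? ?] := measurable_mulc mVur mVui mvr mvi.
have [? ?] := measurable_mulc mWur mWui mWvr mWvi.
apply: cintegral_ae => //; apply: filterS VW => x ->.
case: (u x) (v x) => a b [c e]; apply/eqP; rewrite eq_complex /=.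
by apply/andP; split; apply/eqP; ring.
Qed.

Let ReD (z z' : R[i]) : complex.Re (z + z') = complex.Re z + complex.Re z'.
Proof. by case: z z' => a b []. Qed.
Let ImD (z z' : R[i]) : complex.Im (z + z') = complex.Im z + complex.Im z'.
Proof. by case: z z' => a b []. Qed.

Let subrACA (a b c e : R) : (a - b) + (c - e) = (a + c) - (b + e).
Proof. by rewrite opprD addrACA. Qed.

Lemma schrodinger_formE u v : form_domain V u -> form_domain V v ->
  schrodinger_form V u v = Complex
  (real_form W (rpart u) (rpart v) + real_form W (ipart u) (ipart v))
  (real_form W (ipart u) (rpart v) - real_form W (rpart u) (ipart v)).
Proof.
move=> Du Dv; have [[u2 hu] _] := Du; have [[v2 hv] _] := Dv.
have [[_ _ Wur] [_ _ Wui]] := (form_domainE _).1 Du.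
have [[_ _ Wvr] [_ _ Wvi]] := (form_domainE _).1 Dv.
have Wu2 : L2 (fun x => (W x)%:C%C * u x) by apply/L2E; rewrite rpart_mulr ipart_mulr.
have Wv2 : L2 (fun x => (W x)%:C%C * v x) by apply/L2E; rewrite rpart_mulr ipart_mulr.
rewrite /schrodinger_form inner_potential// (innerE Wu2 Wv2) !rpart_mulr !ipart_mulr.
rewrite (eq_bigr _ (fun i _ => inner_weak_partial (hu i) (hv i))) /real_form.
apply/eqP; rewrite eq_complex ReD ImD.
rewrite (big_morph _ ReD (erefl _)) (big_morph _ ImD (erefl _)) /=.
by rewrite sumrB big_split/=; apply/andP; split; apply/eqP; [exact: addrACA|exact: subrACA].
Qed.

End complex_functions.

(** * Multiplication by complex numbers on pairs *)

Section complex_structure.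
Context {R : realType} {E : lmodType R} (L D : set E) (ip q : E -> E -> R).
Implicit Types (p : (E * E)%type) (z : R[i]).

(* Multiplication by i, a pair standing for real and imaginary parts. *)
Definition mul_i p : (E * E)%type := (- p.2, p.1).

Definition cscale z p : (E * E)%type := complex.Re z *: p + complex.Im z *: mul_i p.

Lemma cscaleD z : {morph cscale z : p p' / p + p'}.
Proof.
by move=> p p'; rewrite /cscale /mul_i; apply: injective_projections => /=;
  rewrite ?opprD !scalerDr addrACA.
Qed.

Lemma cscaleZ z a p : cscale z (a *: p) = a *: cscale z p.
Proof.
rewrite /cscale [RHS]scalerDr (_ : mul_i (a *: p) = a *: mul_i p).
  by rewrite !scalerA ![a * _]mulrC.
by apply: injective_projections => //=; rewrite scalerN.
Qed.

Lemma prehilbertD : prehilbert D q -> prehilbert L ip -> D `<=` L ->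
  prehilbert D (fun u v => q u v + ip u v).
Proof.
move=> HD HL DL; split; [exact: (ph0 HD)|exact: (phD HD)|exact: (phZ HD)|..].
- by move=> u v Du Dv; rewrite (ipC HD Du Dv) (ipC HL (DL _ Du) (DL _ Dv)).
- move=> u v w Du Dv Dw; rewrite (ipDl HD Du Dv Dw).
  by rewrite (ipDl HL (DL _ Du) (DL _ Dv) (DL _ Dw)) addrACA.
- move=> a u v Du Dv; rewrite (ipZl HD a Du Dv).
  by rewrite (ipZl HL a (DL _ Du) (DL _ Dv)) mulrDr.
- by move=> u Du; rewrite addr_ge0 ?(ip_ge0 HD)// (ip_ge0 HL)//; exact: DL.
Qed.

Hypothesis HL : prehilbert L ip.
Hypothesis HD : prehilbert D q.
Hypothesis DL : D `<=` L.

Lemma mul_i_orthogonal p : pair_set L p -> pair_form ip p (mul_i p) = 0.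
Proof.
by move=> [p1 p2]; rewrite /pair_form/= (ipNr HL)// (ipC HL p1 p2) addNr.
Qed.

Lemma mul_i_isometry p : pair_set L p ->
  pair_form ip (mul_i p) (mul_i p) = pair_form ip p p.
Proof.
move=> [p1 p2]; have p2' := phN HL p2.
by rewrite /pair_form/= (ipNr HL)// (ipNl HL)// opprK addrC.
Qed.

Lemma pair_set_mul_i p : pair_set L p -> pair_set L (mul_i p).
Proof. by move=> [p1 p2]; split=> //=; exact: (phN HL). Qed.

Lemma pair_set_cscale z p : pair_set L p -> pair_set L (cscale z p).
Proof.
move=> Lp; have HP := prehilbert_pair HL.
by apply: (phD HP); apply: (phZ HP) => //; exact: pair_set_mul_i.
Qed.

Lemma cscale_bounded z p : pair_set L p ->
  pair_form ip (cscale z p) (cscale z p) <=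
  (2 * complex.Re z ^+ 2 + 2 * complex.Im z ^+ 2) * pair_form ip p p.
Proof.
move=> Lp; have HP := prehilbert_pair HL; have Jp := pair_set_mul_i Lp.
have La := phZ HP (complex.Re z) Lp; have Lb := phZ HP (complex.Im z) Jp.
apply: le_trans (ip_sqrD_le HP La Lb) _.
rewrite (ipZl HP)// (ipZr HP)// [X in 2 * X + _](mulrA) (ipZl HP)// (ipZr HP)//.
rewrite mul_i_isometry//; set c := pair_form ip p p.
by rewrite le_eqVlt; apply/orP; left; apply/eqP; ring.
Qed.

(** Test the equation with i p: the form side vanishes by symmetry of [q], and the other side is Im
    z times the squared norm of p. *)
Lemma eigenvalue_real z p :
  operator_of (pair_set L) (pair_set D) (pair_form ip) (pair_form q) p (cscale z p) ->
  pair_form ip p p != 0 -> complex.Im z = 0.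
Proof.
move=> [Dp _ qp] p0; have Lp : pair_set L p by case: Dp => /DL p1 /DL p2.
have HP := prehilbert_pair HL; have Jp := pair_set_mul_i Lp.
have : pair_form q p (mul_i p) = 0.
  by case: Dp => p1 p2; rewrite /pair_form/= (ipNr HD)// (ipC HD p1 p2) addNr.
rewrite qp; last by case: Dp => p1 p2; split=> //=; exact: (phN HD).
have La := phZ HP (complex.Re z) Lp; have Lb := phZ HP (complex.Im z) Jp.
rewrite (ipDl HP La Lb Jp) (ipZl HP)// mul_i_orthogonal// mulr0 add0r.
by rewrite (ipZl HP)// mul_i_isometry// => /eqP; rewrite mulf_eq0 (negPf p0) orbF => /eqP.
Qed.

End complex_structure.

Lemma finite_set_isolated (R : realType) (S : set R[i]) z : finite_set S -> isolated_in S z.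
Proof.
move=> /finite_seqP[s ->]; elim: s => [|w s [e e0 he]]; first by exists 1.
have [->|wz] := eqVneq w z.
  exists e => // v /=; rewrite inE => /orP[/eqP//|]; exact: he.
have w0 : 0 < ComplexField.Normc.normc (w - z).
  rewrite lt_neqAle eq_sym; apply/andP; split.
    by apply: contra wz => /eqP/ComplexField.Normc.eq0_normc/eqP; rewrite subr_eq0.
  by case: (w - z) => a b; exact: sqrtr_ge0.
exists (Num.min e (ComplexField.Normc.normc (w - z))); first by rewrite lt_min e0.
move=> v /=; rewrite inE lt_min => /orP[/eqP ->|sv] /andP[ve vw]; last exact: he.
by rewrite ltxx in vw.
Qed.

Lemma Re_le_normc (R : realType) (z : R[i]) : complex.Re z <= ComplexField.Normc.normc z.
Proof.
case: z => a b /=; apply: le_trans (ler_norm a) _.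
by rewrite -sqrtr_sqr ler_wsqrtr// lerDl sqr_ge0.
Qed.

(** * The operator on pairs and its spectrum *)

Section schrodinger_on_pairs.
Context {R : realType} {d : nat}.
Local Notation mu := (mes R d).
Local Notation fn := ('rV[R]_d -> R[i]).
Local Notation rfn := ('rV[R]_d -> R).
Implicit Types (u v f g : fn) (p : (rfn * rfn)%type) (z : R[i]).

Definition parts u : (rfn * rfn)%type := (rpart u, ipart u).
Definition of_parts p : fn := fun x => Complex (p.1 x) (p.2 x).

Lemma of_partsK : cancel of_parts parts.
Proof. by case. Qed.

Lemma partsD u v : parts (fun x => u x + v x) = parts u + parts v.
Proof.
by congr pair; apply/funext => x; rewrite /rpart /ipart;
  [rewrite -[RHS]/(complex.Re (u x) + complex.Re (v x))
  |rewrite -[RHS]/(complex.Im (u x) + complex.Im (v x))];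
  case: (u x) (v x) => a b [].
Qed.

Lemma parts_mul z u : parts (fun x => z * u x) = cscale z (parts u).
Proof.
rewrite /cscale; congr pair; apply/funext => x; case: z => a b /=.
  rewrite -[RHS]/(a * complex.Re (u x) + b * - complex.Im (u x)) mulrN.
  by rewrite /rpart; case: (u x).
rewrite -[RHS]/(a * complex.Im (u x) + b * complex.Re (u x)).
by rewrite /ipart; case: (u x).
Qed.

Local Notation L := (pair_set (L2r mu)).
Local Notation ip := (pair_form (ipr mu)).

Let H := @prehilbert_L2r _ _ R mu.
Let HP := prehilbert_pair H.

Lemma parts_L2 u : L (parts u) <-> L2 u.
Proof. by rewrite L2E. Qed.

Lemma norm2E u : L2 u -> norm2 u = Num.sqrt (ip (parts u) (parts u)).
Proof. by move=> u2; rewrite /norm2 innerE. Qed.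

Lemma aeq_parts u : L2 u -> aeq u (fun=> 0) <-> ip (parts u) (parts u) = 0.
Proof. by move=> u2; rewrite aeq0E. Qed.

Variables V W : 'rV[R]_d -> R.
Hypothesis mV : measurable_fun setT V.
Hypothesis mW : measurable_fun setT W.
Hypothesis VW : {ae mu, forall x, V x = W x ^+ 2}.

Local Notation D := (pair_set (real_domain W)).
Local Notation q := (pair_form (real_form W)).
Local Notation op := (operator_of L D ip q).

Local Opaque real_form ipr.

(** [op] carries only the real part of the complex form identity. The imaginary part is recovered by
    testing with i v, which stays in the domain. *)
Lemma schrodingerE u f : schrodinger V u f <-> op (parts u) (parts f).
Proof.
split=> [[Du f2 h]|[Du /parts_L2 f2 h]].
  split; [exact/(form_domainE mV mW VW)|exact/parts_L2|move=> p Dp].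
  have Dv : form_domain V (of_parts p) by apply/(form_domainE mV mW VW).
  have v2 : L2 (of_parts p) by case: Dv => -[].
  have := h _ Dv; rewrite (schrodinger_formE mV mW VW)// innerE// => -[+ _].
  by case: p {Dp Dv v2}.
have Du' : form_domain V u by apply/(form_domainE mV mW VW).
split=> // v Dv; have [[v2 _] _] := Dv.
have [vr vi] := (form_domainE mV mW VW v).1 Dv.
have HD := prehilbert_real_form W.
rewrite (schrodinger_formE mV mW VW)// innerE//; congr Complex.
  exact: (h (parts v)).
have /h : D (mul_i (parts v)) by split=> //=; exact: (phN HD).
have [ur ui] := Du; have [fr fi] := (parts_L2 f).2 f2.
have [vr2 vi2] := (parts_L2 v).2 v2.
rewrite /pair_form/= (ipNr HD)// (ipNr H)//.
by rewrite addrC [X in _ = X -> _]addrC.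
Qed.

Lemma parts_comb n (a : 'I_n -> R) (e : 'I_n -> (rfn * rfn)%type) u :
  parts (fun x => u x - \sum_k (a k)%:C%C * of_parts (e k) x) =
  parts u - \sum_k a k *: e k.
Proof.
have h b v : parts (fun x => b%:C%C * v x) = b *: parts v.
  by rewrite parts_mul /cscale /= scale0r addr0.
have hB v w : parts (fun x => v x - w x) = parts v - parts w.
  apply/eqP; rewrite eq_sym subr_eq eq_sym -partsD; apply/eqP; congr parts.
  by apply/funext => x /=; rewrite subrK.
rewrite hB; congr (_ - _).
transitivity (parts (\sum_k (fun x => (a k)%:C%C * of_parts (e k) x))).
  by congr parts; apply/funext => x; rewrite fct_sumE.
rewrite (big_morph parts partsD (erefl _ : parts 0 = 0)).
by apply: eq_bigr => k _; rewrite h of_partsK.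
Qed.

Hypothesis thickW : thick_at_infinity W.

Let HDr : prehilbert (real_domain W) (real_form W) := prehilbert_real_form W.
Let DLr : real_domain W `<=` L2r mu.
Proof. by move=> u []. Qed.
Let HD : prehilbert D q := prehilbert_pair HDr.
Let DL : D `<=` L.
Proof. by move=> p [/DLr p1 /DLr p2]. Qed.
Let Lmul z p := @pair_set_cscale _ _ _ _ H z p.

Lemma spectrum_dichotomy z :
  finite_multiplicity (schrodinger V) z /\
  (complex.Im z = 0 /\ real_eigenvalue L D ip q (complex.Re z) \/
   resolvent_set (schrodinger V) z).
Proof.
have gar := garding_pair H DLr (garding_real_form mW thickW).
have cD : complete_in D (fun p p' => q p p' + ip p p').
  have := complete_pair (prehilbertD HDr H DLr) (complete_real_form mW).
  rewrite (_ : pair_form _ = fun p p' => q p p' + ip p p')//.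
  by apply/funext => p; apply/funext => p'; exact: addrACA.
have Zb : exists2 m, 0 < m & forall p, L p -> ip (cscale z p) (cscale z p) <= m * ip p p.
  exists (2 * complex.Re z ^+ 2 + 2 * complex.Im z ^+ 2 + 1).
    by rewrite ltr_wpDl// addr_ge0//; apply: mulr_ge0 => //; exact: sqr_ge0.
  move=> p Lp; apply: le_trans (cscale_bounded H z Lp) _.
  by rewrite ler_wpM2r ?(ip_ge0 HP)// lerDl.
have [[k [e [he ge]]] alt] :=
  fredholm_alternative HP HD DL cD gar (@Lmul z) (cscaleD z) (cscaleZ z) Zb.
split.
  exists k, (fun i => of_parts (e i)); split=> [i|u /schrodingerE].
    by apply/schrodingerE; rewrite parts_mul of_partsK.
  rewrite parts_mul => hu; have [a ha] := ge _ hu.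
  (* The family spans the solutions on pairs already over the reals, so real coefficients
     suffice. *)
  exists (fun i => (a i)%:C%C); rewrite -parts_comb in ha.
  have Lu : L (parts u) by case: hu => /DL.
  have /parts_L2 u2 : L (parts (fun x => u x - \sum_k (a k)%:C%C * of_parts (e k) x)).
    rewrite parts_comb; apply: (phB HP) => //; apply: (ph_sum HP) => i.
    by case: (he i) => /DL.
  have /aeq_parts := ha => /(_ u2); apply: filterS => x /eqP.
  by rewrite subr_eq0 => /eqP.
case: alt => [[p hp p0]|[surj [C hC]]].
  left; have z0 := eigenvalue_real H HDr DLr hp p0; split=> //.
  by exists p => //; move: hp; rewrite /cscale z0 scale0r addr0.
right; split.
- move=> u /schrodingerE; rewrite parts_mul -[cscale _ _]addr0 => hu.
  have Lu : L (parts u) by case: hu => /DL.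
  have := hC _ _ (ph0 HP) hu; rewrite (ip0l HP) ?mulr0; last exact: (ph0 HP).
  move=> h; apply/aeq_parts; first exact/parts_L2.
  by apply/eqP; rewrite eq_le h (ip_ge0 HP).
- move=> f /parts_L2/surj[p hp]; exists (of_parts p); apply/schrodingerE.
  by rewrite partsD parts_mul of_partsK.
(* The abstract bound is on squared norms with a constant of unknown sign, hence the root of the
   absolute value. *)
- exists (Num.sqrt `|C|) => u f f2 /schrodingerE; rewrite partsD parts_mul => hu.
  have Lu : L (parts u) by case: hu => /DL.
  have /parts_L2 Lf := f2.
  rewrite !norm2E//; last exact/parts_L2.
  rewrite -sqrtrM// ler_wsqrtr// (le_trans (hC _ _ Lf hu))//.
  by rewrite ler_wpM2r ?(ip_ge0 HP)// ler_norm.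
Qed.

Lemma discrete_schrodinger : discrete_spectrum (schrodinger V).
Proof.
have sp w : spectrum (schrodinger V) w ->
    complex.Im w = 0 /\ real_eigenvalue L D ip q (complex.Re w).
  by move=> nw; have [_ []] := spectrum_dichotomy w.
move=> z hz; split; last by have [] := spectrum_dichotomy z.
  have gar := garding_pair H DLr (garding_real_form mW thickW).
  have M0 : 0 <= `|complex.Re z| + 1 by rewrite addr_ge0.
  have [N hN] := eigenvalues_bounded_card HP HD DL gar M0.
  (* Isolation concerns only a neighbourhood of z: spectral points within distance 1 have real part
     at most |Re z| + 1. Being real, they are told apart by their real parts, so at most [N] of them
     exist. *)
  pose S := [set w | spectrum (schrodinger V) w /\ ComplexField.Normc.normc (w - z) < 1].
  suff finS : finite_set S.
    have [e e0 he] := finite_set_isolated z finS.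
    exists (Num.min e 1); first by rewrite lt_min e0/=.
    by move=> w hw; rewrite lt_min => /andP[we w1]; apply: he.
  apply: contrapT => /(infinite_set_fset N.+1)[B BS NB].
  pose f (i : 'I_(size (finmap.enum_fset B))) := nth z (finmap.enum_fset B) i.
  have fS i : S (f i) by apply: BS => /=; exact: mem_nth.
  suff /(leq_trans NB) : (size (finmap.enum_fset B) <= N)%N by rewrite ltnn.
  apply: (hN _ (fun i => complex.Re (f i))) => [i j fij|i].
    have [[/sp[i0 _] _] [/sp[j0 _] _]] := (fS i, fS j).
    apply/val_inj/eqP; rewrite -(nth_uniq z (ltn_ord i) (ltn_ord j) (finmap.fset_uniq B)).
    rewrite -/(f i) -/(f j) eq_complex i0 j0 eqxx andbT; exact/eqP.
  have [/sp[_ ei] iz] := fS i; split=> //.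
  have -> : complex.Re (f i) = complex.Re z + complex.Re (f i - z).
    by move: (f i) => w; clear; case: w z => a b [a' b'] /=; rewrite addrC subrK.
  rewrite lerD ?ler_norm// ltW// (le_lt_trans _ iz)//; exact: Re_le_normc.
have [_ [p hp p0]] := sp _ hz.
exists (of_parts p).
  by apply/schrodingerE; rewrite parts_mul of_partsK /cscale (sp _ hz).1 scale0r addr0.
have Lp : L p by case: hp => /DL.
move=> /aeq_parts; rewrite of_partsK => h; move/eqP: p0; apply; apply: h.
by apply/parts_L2; rewrite of_partsK.
Qed.

End schrodinger_on_pairs.

Theorem theorem3p7 (R : realType) (d : nat) (hd : (3 <= d)%N)
  (V : 'rV[R]_d -> R) (hVloc : locally_L1 V)
  (hV : {ae mes R d, forall x, 0 <= V x})
  (G : set 'rV[R]_d) (hG : admissible_domain G)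
  (r0 : R) (hr0 : 0 < r0) (gamma : R -> R)
  (hgamma : forall r, 0 < r < r0 -> 0 < gamma r < 1)
  (hlimsup : limf_esup
     (fun r : R => (r `^ (- (2 * (d%:R - 2) / d%:R)) * gamma r)%:E) 0^'+ = +oo%E)
  (hlim : forall r, 0 < r < r0 ->
     tends_to_infty (fun y =>
       rearrangement V G ((gamma r)%:E * mes R d (dilate G r 0))%E y r)) :
  discrete_spectrum (schrodinger V).
Proof.
have [mV _] := hVloc; have d2 := ltnW hd.
(* [V] is nonnegative only almost everywhere; truncation at 0 makes the root meaningful everywhere
   and changes [V] on a null set only. *)
pose W x := Num.sqrt (Num.max (V x) 0).
have mW : measurable_fun setT W.
  apply: (@measurableT_comp _ _ _ _ _ _ (@Num.sqrt R)).
    by apply: continuous_measurable_fun; exact: sqrt_continuous.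
  exact: measurable_maxr.
have VW : {ae mes R d, forall x, V x = W x ^+ 2}.
  apply: filterS hV => x V0.
  by rewrite /W sqr_sqrtr ?le_max ?lexx ?orbT// (max_idPl V0).
apply: (discrete_schrodinger mV mW VW).
exact: thick_at_infinity_sqrt d2 mV hG hr0 hgamma hlimsup hlim.
Qed.
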